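(* Let $d\in\mathbb{Z}_{\geq 3}$ be odd and let $p\equiv 3\bmod 4$ be a prime number with $p\nmid d$. Then $\mathcal{H}_d$ is maximal over some finite field of characteristic $p$ if and only if the subgroup $\langle \bar{p}\rangle\subseteq(\mathbb{Z}/4d\mathbb{Z})^\times$ generated by $\bar p = p \bmod 4d$ contains either $\overline{-1}$ or $\overline{1+2d}$. If these equivalent conditions are satisfied, then, writing $q=p^n$ (with $n$ a positive integer) and $2k=\mathrm{ord}(\bar p)$ for the order of $\bar p$ in $(\mathbb{Z}/4d\mathbb{Z})^\times$, it holds that $k$ is an odd integer, and the following three conditions are equivalent: (i) $\mathcal{H}_d$ is maximal over $\mathbb{F}_{q^2}$; (ii) $n=km$ with $m\in\mathbb{Z}_{\geq 1}$ odd; (iii) $q\equiv -1\bmod 4d$ or $q\equiv 1+2d\bmod 4d$.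
   Context: For $d\in\mathbb{Z}_{>0}$ the $d$-th Chebyshev polynomial $\Phi_d(x)\in\mathbb{Z}[x]$ is the unique polynomial such that $\Phi_d(x+\frac1x)=x^d+\frac1{x^d}$ in $\mathbb{Z}[x,x^{-1}]$. For a prime $p$, $\varphi_d(x)\in\mathbb{F}_p[x]$ denotes the reduction of $\Phi_d(x)$ modulo $p$. For $p\nmid 2d$, $\varphi_d(x)$ is separable, and $\mathcal{H}_d$ denotes the complete, regular, absolutely irreducible (hyperelliptic) curve over $\mathbb{F}_p$ (and, by base change, over extensions of $\mathbb{F}_p$) given by the affine equation $y^2=\varphi_d(x)$; its genus is $g(\mathcal{H}_d)=\lfloor (d-1)/2\rfloor$. For $q$ a power of $p$, the curve $\mathcal{H}_d$ is called maximal over $\mathbb{F}_{q^2}$ if $\#\mathcal{H}_d(\mathbb{F}_{q^2})=q^2+1+2g(\mathcal{H}_d)q$. ''Maximal over some finite field of characteristic $p$'' means maximal over $\mathbb{F}_{q^2}$ for some power $q$ of $p$. *)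

(* Defs.v *)
From HB Require Import structures.
From mathcomp Require Import all_boot all_order all_algebra all_fingroup.
From mathcomp Require Import ring.

Set Implicit Arguments.
Unset Strict Implicit.
Unset Printing Implicit Defensive.

Import GRing.Theory.
Local Open Scope ring_scope.

Lemma chebyshev_exists_in (K : fieldType) (x : K) (d : nat) : x != 0 ->
  exists P : {poly int}, (map_poly intr P).[x + x^-1] = x ^+ d + x ^- d.
Proof.
move=> x0.
suff [P [Q [HP _]]] : exists P Q : {poly int},
    (map_poly intr P).[x + x^-1] = x ^+ d + x ^- d /\
    (map_poly intr Q).[x + x^-1] = x ^+ d.+1 + x ^- d.+1.
  by exists P.
elim: d => [|d [P [Q [HP HQ]]]].
  exists 2%:P, 'X; split; last by rewrite map_polyX hornerX !expr1.
  by rewrite map_polyC hornerC /= !expr0 invr1.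
exists Q, ('X * Q - P); split => //.
rewrite rmorphB rmorphM /= map_polyX hornerD hornerN hornerM hornerX HP HQ.
have xd0 : x ^+ d != 0 by rewrite expf_neq0.
by rewrite !exprS; field; rewrite x0 xd0.
Qed.

Lemma chebyshev_unique_in (K : fieldType) (iota : {rmorphism {poly int} -> K})
    (Q R : {poly int}) (x := iota 'X) : injective iota ->
  (map_poly intr Q).[x + x^-1] = (map_poly intr R).[x + x^-1] -> Q = R.
Proof.
move=> iota_inj HQR; apply/subr0_eq; set P := Q - R.
have HP : (map_poly intr P).[x + x^-1] = 0.
  by rewrite rmorphB hornerD hornerN HQR subrr.
have x0 : x != 0 by rewrite (raddf_eq0 _ iota_inj) polyX_eq0.
apply/eqP; apply: contraTT isT => P0.
have sP : (size P).-1.+1 = size P by rewrite prednK // size_poly_gt0.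
pose n := (size P).-1.
have E : \sum_(i < n.+1) (P`_i)%:P * ('X ^+ 2 + 1) ^+ i * 'X ^+ (n - i)
         = 0 :> {poly int}.
  apply: iota_inj; rewrite rmorph0 rmorph_sum /=.
  transitivity (x ^+ n * (map_poly intr P).[x + x^-1]); last first.
    by rewrite HP mulr0.
  rewrite (@horner_coef_wide _ n.+1); last first.
    by rewrite sP (leq_trans (size_poly _ _)).
  rewrite mulr_sumr; apply: eq_bigr => i _.
  have le_in : (i <= n)%N by rewrite -ltnS.
  rewrite coef_map /= !rmorphM !rmorphXn rmorphD rmorphXn rmorph1 /= -/x.
  have -> : iota (P`_i)%:P = (P`_i)%:~R.
    by rewrite -[in LHS](intz P`_i) rmorph_int rmorph_int.
  rewrite -[X in x ^+ X * _](subnK le_in) exprD.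
  have -> : x ^+ 2 + 1 = x * (x + x^-1) by rewrite mulrDr divff // expr2.
  rewrite exprMn.
  by move: (x ^+ (n - i)) (x ^+ i) ((x + x^-1) ^+ i) _%:~R => a b c e; ring.
move/(congr1 (horner^~ 0)): E; rewrite horner0 horner_sum big_ord_recr /=.
rewrite big1 => [|i _]; last first.
  by rewrite hornerM hornerXn expr0n subn_eq0 leqNgt ltn_ord /= mulr0.
rewrite add0r subnn expr0 mulr1 hornerM hornerC horner_exp hornerD hornerXn.
rewrite hornerC expr0n /= add0r expr1n mulr1 => lc0.
by move: P0; rewrite -lead_coef_eq0 /lead_coef -/n lc0 eqxx.
Qed.

(* Z[x, x^-1] is viewed inside the field of fractions of Z[x]. *)
Definition fracX : {fraction {poly int}} := tofrac 'X.

Definition chebyshev_eq (d : nat) (P : {poly int}) : bool :=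
  (map_poly intr P).[fracX + fracX^-1] == fracX ^+ d + fracX ^- d.

Lemma chebyshev_exists (d : nat) : exists P : {poly int}, chebyshev_eq d P.
Proof.
have X0 : fracX != 0 by rewrite /fracX tofrac_eq0 polyX_eq0.
by have [P HP] := chebyshev_exists_in d X0; exists P; apply/eqP.
Qed.

Definition chebyshev (d : nat) : {poly int} := xchoose (chebyshev_exists d).

Lemma chebyshevP (d : nat) : chebyshev_eq d (chebyshev d).
Proof. exact: xchooseP. Qed.

Lemma chebyshev_unique (d : nat) (P : {poly int}) :
  chebyshev_eq d P -> P = chebyshev d.
Proof.
move=> /eqP HP; have /eqP HQ := chebyshevP d.
apply: (@chebyshev_unique_in _ (@tofrac _)); last exact: etrans HP (esym HQ).
by move=> a b /eqP; rewrite tofrac_eq => /eqP.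
Qed.

(* Reduction of the d-th Chebyshev polynomial along Z -> R.  When R is a field
   of characteristic p this map factors through F_p, so the result is the base
   change to R of the reduction modulo p. *)
Definition phi (R : nzRingType) (d : nat) : {poly R} :=
  map_poly (intr : int -> R) (chebyshev d).

(* The complete regular model of y^2 = f(x), for f separable of degree 2g+1 or
   2g+2, is the curve Y^2 = Z^(2g+2) f(X/Z) in the weighted projective plane
   with coordinates (X : Y : Z) of weights (1, g+1, 1); it does not meet the
   point X = Z = 0.  As X and Z have weight 1, its F-rational points are the
   F-valued solutions with (X, Z) <> (0, 0) up to scaling by units of F. *)
Section HyperellipticPoints.
Variables (F : finFieldType) (g : nat) (f : {poly F}).

Definition hyper_form (X Z : F) : F :=
  \sum_(i < (2 * g + 2).+1) f`_i * X ^+ i * Z ^+ (2 * g + 2 - i).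

Definition hyper_cone : {set F * F * F} :=
  [set P : F * F * F | let: (X, Y, Z) := P in
     ((X, Z) != (0, 0)) && (Y ^+ 2 == hyper_form X Z)].

Definition weighted_eq (P Q : F * F * F) : bool :=
  let: (X, Y, Z) := P in
  [exists c : F, (c != 0) && (Q == (c * X, c ^+ g.+1 * Y, c * Z))].

Definition hyper_points : {set {set F * F * F}} :=
  equivalence_partition weighted_eq hyper_cone.

End HyperellipticPoints.

Definition genusH (d : nat) : nat := ((d - 1) %/ 2)%N.

(* The F-rational points of the complete regular curve y^2 = phi_d(x). *)
Definition pointsH (d : nat) (F : finFieldType) : {set {set F * F * F}} :=
  hyper_points (genusH d) (phi F d).

Definition maximalH (d q : nat) (F : finFieldType) : Prop :=
  #|F| = (q ^ 2)%N /\ #|pointsH d F| = (q ^ 2 + 1 + 2 * genusH d * q)%N.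

(* The class of a in (Z/mZ)^*; meaningful for m > 1 and a prime to m, with
   junk value 1 otherwise. *)
Definition residue (m : nat) (a : int) : {unit 'Z_m} :=
  insubd (1%g : {unit 'Z_m}) (a%:~R : 'Z_m).

Lemma val_residue (m : nat) (a : int) :
  (1 < m)%N -> coprimez a m -> val (residue m a) = a%:~R.
Proof.
move=> m1 cop; rewrite /residue val_insubd ifT //.
case: (intP a) cop => [|n|n] cop; rewrite ?rmorphN /= ?unitrN.
- by rewrite -[0%:~R]/(0%:R) unitZpE // coprime_sym.
- by rewrite -pmulrn unitZpE // coprime_sym.
- by rewrite -pmulrn unitZpE // coprime_sym; move: cop; rewrite coprimeNz.
Qed.

(* Main.v *)
From HB Require Import structures.
From mathcomp Require Import all_boot all_order all_algebra all_fingroup.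
From mathcomp Require Import all_solvable all_field all_character.
From Stdlib Require Reals Lra.
From mathcomp Require boolp Rstruct.
Require Import Defs.

(** Write Q = q^2 for the order of the field F.  Points of the curve are counted
    by S = sum of chi (phi_d (x)), where chi is the quadratic character.  Every x
    in F is t + 1/t for two values of t, which lie in F* or in the norm-one group
    of the quadratic extension E; since phi_d (t + 1/t) = t^d + t^-d, the number
    2 S is a sum over the 2 d complex roots w of w^(2d) = -1 of Jacobi sums of F
    (if w^(Q-1) = 1) and Eisenstein sums of E (if w^(Q+1) = -1), all of absolute
    value q, in which the terms of the two roots i and - i cancel (this is the
    case d = 1).  So the curve is maximal if and only if every other term equals
    q (maximal_terms).

    Suppose that it is.  The terms cannot be Eisenstein sums: that would make a
    vanishing sum of an odd number of signs (Esum_not_constant).  So 4 d divides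
    Q - 1 and the Jacobi sums J(w) are all q.  The sum J(i) is an integer that is
    -1 modulo 4, hence it is q if and only if q is 3 modulo 4; and taking powers
    of w by an odd prime l changes J(w) into a number congruent to J(w)^l modulo
    l, which propagates the signs between J(i) and the other sums.  This is
    maximal_necessary, and, read backwards, maximal_sufficient: if q is -1 or
    1 + 2 d modulo 4 d then each J(w) is real, so it is q or - q, and the sign
    is that of J(i).

    Next, if all J(w) are q then some power of p is -1 or 1 + 2 d modulo 4 d.  By Stickelberger, computed here by the binomial theorem in
    an unramified p-adic model, the p-adic valuation of J(w^j) at a place is the
    number of t < 2 n for which p^t j mod 4 d lies in the lower half
    [0, 2 d[; so this number is at most n for all odd j (count_lower_half), and
    then equal to n, as j and - j are complementary.  If neither -1 nor 1 + 2 d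
    were a power of p modulo 4 d, there would be a Dirichlet character x modulo
    4 d trivial on p with x (-1) = x (1 + 2 d) = -1.  Expanding x in sines
    and using the value pi / 4 or - pi / 4 of the series of sin (m a) / m over
    the odd m, this even distribution forces L(1, x) = 0, with an error O(1 / X)
    for the partial sums (harmonic_bound).  That contradicts Dirichlet's
    theorem, which is proved for real x by Monsky's Lambert series
    (real_character_absurd), and for the other x by an Euler product at
    1 + 1 / m, where the product over all the powers of x has two zeros but
    only one pole (complex_character_absurd).

    What remains is the arithmetic of the cyclic group generated by p: the powers
    of p that are -1 or 1 + 2 d modulo 4 d are 3 modulo 4 and of square 1, so they
    are the odd powers of p^k, where 2 k is the order of p (half_turn_order). *)

Set Implicit Arguments.
Unset Strict Implicit.
Unset Printing Implicit Defensive.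

Import Order.TTheory GRing.Theory Num.Theory.

(** * The sine series of pi / 4 *)

Section SineSeries.

Import Stdlib.Reals.Reals Stdlib.micromega.Lra.
Local Open Scope R_scope.

Fixpoint sin_series (T : nat) (x : R) : R :=
  match T with
  | O => 0
  | S k => sin_series k x + sin ((2 * INR k + 1) * x) / (2 * INR k + 1)
  end.

Fixpoint cos_sum (T : nat) (x : R) : R :=
  match T with O => 0 | S k => cos_sum k x + cos ((2 * INR k + 1) * x) end.

(** The telescoping that makes the derivative of the sine sum explicit. *)
Lemma cos_sumE T x : 2 * sin x * cos_sum T x = sin (2 * INR T * x).
Proof.
induction T as [|k IH]; simpl cos_sum.
  simpl; rewrite Rmult_0_r Rmult_0_r Rmult_0_l sin_0; reflexivity.
rewrite Rmult_plus_distr_l IH S_INR.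
replace (2 * INR k * x) with ((2 * INR k + 1) * x - x) by ring.
replace (2 * (INR k + 1) * x) with ((2 * INR k + 1) * x + x) by ring.
rewrite sin_plus sin_minus; ring.
Qed.

Lemma derivable_linear c x : derivable_pt_lim (fun y => c * y) x c.
Proof.
assert (h := derivable_pt_lim_scal id c x 1 (derivable_pt_lim_id x)).
rewrite Rmult_1_r in h; exact h.
Qed.

Lemma derivable_sin_series T x : derivable_pt_lim (sin_series T) x (cos_sum T x).
Proof.
induction T as [|k IH]; simpl; first exact: derivable_pt_lim_const.
apply derivable_pt_lim_plus with (1 := IH).
pose (c := 2 * INR k + 1); fold c.
assert (c0 : c <> 0) by (assert (h := pos_INR k); unfold c; lra).
replace (cos (c * x)) with (/ c * (cos (c * x) * c)) by (field; exact c0).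
apply derivable_pt_lim_ext with (f := fun y => / c * sin (c * y)).
  intros z; field; exact c0.
apply (derivable_pt_lim_scal (fun y => sin (c * y))).
apply (derivable_pt_lim_comp (fun y => c * y) sin).
  apply derivable_linear.
apply derivable_pt_lim_sin.
Qed.

(** The derivative of the partial sum is sin (2 T x) / (2 sin x), which oscillates
    but is not small.  Adding cos (2 T x) / (4 T sin x), itself O(1 / T), cancels
    it and leaves a derivative that is O(1 / T). *)
Lemma derivable_corrected T x : T <> 0%nat -> sin x <> 0 ->
  derivable_pt_lim
    (fun y => sin_series T y + / (4 * INR T) * (cos (2 * INR T * y) / sin y)) x
    (/ (4 * INR T) * (- (cos x * cos (2 * INR T * x)) / (sin x * sin x))).
Proof.
intros T0 s0; assert (t0 : INR T <> 0) by (exact (not_0_INR T T0)).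
pose (c := 2 * INR T); fold c.
assert (eC := cos_sumE T x); fold c in eC.
replace (_ * (- _ / _)) with (cos_sum T x + / (4 * INR T) *
   (((- sin (c * x) * c) * sin x - cos x * cos (c * x)) / Rsqr (sin x))).
  apply (derivable_pt_lim_plus (sin_series T) (fun y => / (4 * INR T) * (cos (c * y) / sin y))).
    apply derivable_sin_series.
  apply (derivable_pt_lim_scal (fun y => (cos (c * y) / sin y))).
  apply (derivable_pt_lim_div (fun y => cos (c * y)) sin).
  - apply (derivable_pt_lim_comp (fun y => c * y) cos).
      apply derivable_linear.
    apply derivable_pt_lim_cos.
  - apply derivable_pt_lim_sin.
  - exact s0.
rewrite -eC; unfold Rsqr, c; field; split; assumption.
Qed.

(** By the mean value theorem for the corrected sums: the series takes the same
    value, pi / 4, at all points of ]0, pi / 2]. *)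
Lemma sin_series_bound a : 0 < a <= PI / 2 ->
  exists C, forall T, T <> 0%nat -> Rabs (sin_series T a - sin_series T (PI / 2)) <= C / INR T.
Proof.
intros [a0 aP]; assert (pi0 := PI_RGT_0).
assert (s0 : 0 < sin a) by (apply sin_gt_0; lra).
pose (s := sin a); fold s in s0.
exists (/ 4 * (/ s + 1 + / (s * s) * (PI / 2))); intros T T0.
assert (t0 : 0 < INR T) by (assert (h := pos_INR T); assert (h' := not_0_INR T T0); lra).
pose (D := fun y => sin_series T y + / (4 * INR T) * (cos (2 * INR T * y) / sin y)).
pose (D' := fun x => / (4 * INR T) * (- (cos x * cos (2 * INR T * x)) / (sin x * sin x))).
assert (sx : forall x, a <= x <= PI / 2 -> s <= sin x).
  intros x Hx; apply sin_incr_1; lra.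
assert (i4 : 0 < / (4 * INR T)) by (apply Rinv_0_lt_compat; lra).
assert (is0 : 0 < / s) by (apply Rinv_0_lt_compat; lra).
assert (bdiv : forall u v m, Rabs u <= 1 -> 0 < m -> m <= v -> Rabs (u / v) <= / m).
  intros u v m Hu Hm Hv; unfold Rdiv; rewrite Rabs_mult.
  rewrite -(Rmult_1_l (/ m)); apply Rmult_le_compat; try apply Rabs_pos; auto.
  rewrite Rabs_right.
    apply Rinv_le_contravar; lra.
  apply Rle_ge, Rlt_le, Rinv_0_lt_compat; lra.
assert (bcos : forall x, Rabs (cos x) <= 1).
  intros x; apply Rabs_le; apply COS_bound.
assert (bD : Rabs (D (PI / 2) - D a) <= / (4 * INR T) * / (s * s) * (PI / 2)).
  destruct aP as [aP|aP].
    destruct (MVT_cor2 D D' a (PI / 2) aP) as [c [eq_c Hc]].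
      intros c Hc; apply derivable_corrected; auto.
      assert (h := sx c Hc); lra.
    rewrite eq_c Rabs_mult; apply Rmult_le_compat; try apply Rabs_pos.
      unfold D'; rewrite Rabs_mult (Rabs_right (/ _)); last lra.
      apply Rmult_le_compat_l; try lra.
      apply bdiv; try nra.
        rewrite Rabs_Ropp Rabs_mult.
        assert (h1 := bcos c); assert (h2 := bcos (2 * INR T * c)).
        assert (h3 := Rabs_pos (cos c)); assert (h4 := Rabs_pos (cos (2 * INR T * c))); nra.
      assert (h := sx c (conj (Rlt_le _ _ (proj1 Hc)) (Rlt_le _ _ (proj2 Hc)))); nra.
    rewrite Rabs_right; lra.
  rewrite aP Rminus_diag Rabs_R0.
  assert (0 < / (s * s)) by (apply Rinv_0_lt_compat; nra).
  apply Rmult_le_pos; [apply Rmult_le_pos|]; lra.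
assert (bE : forall x, a <= x <= PI / 2 ->
    Rabs (/ (4 * INR T) * (cos (2 * INR T * x) / sin x)) <= / (4 * INR T) * / s).
  intros x Hx; rewrite Rabs_mult (Rabs_right (/ _)); last lra.
  apply Rmult_le_compat_l; try lra.
  apply bdiv; auto.
assert (bP : Rabs (/ (4 * INR T) * (cos (2 * INR T * (PI / 2)) / sin (PI / 2))) <= / (4 * INR T) * 1).
  rewrite Rabs_mult (Rabs_right (/ _)); last lra.
  apply Rmult_le_compat_l; try lra.
  rewrite sin_PI2; unfold Rdiv; rewrite Rinv_1 Rmult_1_r; auto.
assert (ba := bE a (conj (Rle_refl a) aP)).
replace (/ 4 * (/ s + 1 + / (s * s) * (PI / 2)) / INR T) with
  (/ (4 * INR T) * / s + / (4 * INR T) * 1 + / (4 * INR T) * / (s * s) * (PI / 2)) by (field; lra).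
assert (inv : forall x b, Rabs x <= b -> - b <= x <= b).
  intros x b; unfold Rabs; destruct Rcase_abs; lra.
apply Rabs_le; apply inv in ba; apply inv in bP; apply inv in bD.
unfold D in bD; lra.
Qed.

End SineSeries.

From mathcomp Require Import ring lra zify.

Local Open Scope ring_scope.

(** * Roots of unity and multiplicative characters of finite fields *)

Section RootsOfUnity.

Definition prim_rootC (N : nat) : algC :=
  if N is N'.+1 then sval (C_prim_root_exists (ltn0Sn N')) else 1.

Lemma prim_rootCP N : (0 < N)%N -> N.-primitive_root (prim_rootC N).
Proof. by case: N => // N _; rewrite /prim_rootC; case: C_prim_root_exists. Qed.

Definition unity_roots (N : nat) : seq algC :=
  [seq prim_rootC N ^+ k | k <- iota 0 N].

Lemma mem_unity_roots N z : (0 < N)%N -> (z \in unity_roots N) = (z ^+ N == 1).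
Proof.
move=> /prim_rootCP pw; apply/mapP/eqP => [[k _ ->]|zN1].
  by rewrite exprAC (prim_expr_order pw) expr1n.
have [i ->] := prim_rootP pw zN1; exists (i : nat) => //.
by rewrite mem_iota add0n ltn_ord.
Qed.

Lemma uniq_unity_roots N : uniq (unity_roots N).
Proof.
have [->|/prim_rootCP pw] := posnP N; first by [].
rewrite map_inj_in_uniq ?iota_uniq // => i j; rewrite !mem_iota !add0n /= => ltiN ltjN.
by move/eqP; rewrite (eq_prim_root_expr pw) !modn_small // => /eqP.
Qed.

Lemma sum_expr_unity (R : idomainType) N (z : R) : z ^+ N = 1 -> z != 1 ->
  \sum_(k < N) z ^+ k = 0.
Proof.
move=> zN z1; apply/eqP; have /eqP := subrX1 z N; rewrite zN subrr eq_sym mulf_eq0.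
by rewrite subr_eq0 (negPf z1).
Qed.

Lemma sum_unity_roots (N a : nat) : (0 < N)%N ->
  \sum_(w <- unity_roots N) w ^+ a = if (N %| a)%N then N%:R else 0.
Proof.
move=> /prim_rootCP pw; set w := prim_rootC N in pw.
rewrite big_map (_ : iota 0 N = index_iota 0 N) ?big_mkord -/w; last by rewrite /index_iota subn0.
under eq_bigr do rewrite exprAC.
rewrite (prim_order_dvd pw).
case: eqP => [->|/eqP wa1]; last first.
  by rewrite sum_expr_unity // exprAC (prim_expr_order pw) expr1n.
under eq_bigr do rewrite expr1n.
by rewrite sumr_const card_ord.
Qed.

(** The main use: the roots of w^(2d) = -1 that are (Q - 1)-th roots of unity may
    be listed inside the roots of unity of order 4 d or Q - 1. *)
Lemma big_unity_roots M N (P : pred algC) (f : algC -> algC) :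
    (0 < M)%N -> (0 < N)%N ->
    (forall z, P z -> z ^+ M = 1) ->
  \sum_(w <- unity_roots N | P w) f w =
  \sum_(w <- unity_roots M | P w && (w ^+ N == 1)) f w.
Proof.
move=> M0 N0 PM; rewrite -big_filter -[RHS]big_filter; apply: perm_big.
apply: uniq_perm; rewrite ?filter_uniq ?uniq_unity_roots // => z.
rewrite !mem_filter !mem_unity_roots //.
by case Pz: (P z) => //=; rewrite (PM z Pz) eqxx andbT.
Qed.

End RootsOfUnity.

Lemma finField_prim_root (F : finFieldType) : {g : F | (#|F|.-1).-primitive_root g}.
Proof.
apply: sigW; have N_gt0 : (0 < #|F|.-1)%N by have := finNzRing_gt1 F; case: #|F| => [|[]].
have /hasP[g _ prim_g] : has (#|F|.-1).-primitive_root (enum (predC1 (0 : F))); last by exists g.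
apply: has_prim_root => //; last by rewrite -cardE cardC1.
  apply/allP => x; rewrite mem_enum unity_rootE inE => x0.
  by apply/eqP/(mulfI x0); rewrite -exprS mulr1 prednK ?expf_card // ltnW ?finNzRing_gt1.
exact: enum_uniq.
Qed.

Section MulChar.

Variables (F : finFieldType) (g : F).
Local Notation N := (#|F|.-1).
Hypothesis prim_g : N.-primitive_root g.

Lemma N_gt0 : (0 < N)%N.
Proof. by have := finNzRing_gt1 F; case: #|F| => [|[]]. Qed.
Local Hint Resolve N_gt0 : core.

Lemma prim_neq0 : g != 0.
Proof.
apply/eqP => g0; have /eqP := prim_expr_order prim_g.
by rewrite g0 expr0n eqn0Ngt N_gt0 eq_sym oner_eq0.
Qed.

Lemma expf_pred_card (x : F) : x != 0 -> x ^+ N = 1.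
Proof.
move=> x0; apply: (mulfI x0); rewrite -exprS mulr1 prednK ?expf_card //.
by apply: leq_trans (finNzRing_gt1 F).
Qed.

(** Discrete logarithm to the base g; the junk value 0 is taken at 0. *)
Definition dlog (x : F) : nat := odflt ord0 [pick i : 'I_N.+1 | (i < N)%N && (g ^+ i == x)].

Lemma dlogP x : x != 0 -> (dlog x < N)%N /\ g ^+ (dlog x) = x.
Proof.
move=> x0; rewrite /dlog; case: pickP => [i /andP[? /eqP]|nox] //.
have [i xE] := prim_rootP prim_g (expf_pred_card x0).
by have /negP[] := nox (widen_ord (leqnSn N) i); rewrite /= ltn_ord xE eqxx.
Qed.

Lemma dlogX a : dlog (g ^+ a) = a %[mod N].
Proof.
have ga0 : g ^+ a != 0 by rewrite expf_neq0 ?prim_neq0.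
by have [_ /eqP] := dlogP ga0; rewrite (eq_prim_root_expr prim_g) => /eqP.
Qed.

Lemma sum_nz_prim (R : nmodType) (f : F -> R) :
  \sum_(x | x != 0) f x = \sum_(a < N) f (g ^+ a).
Proof.
pose h (a : 'I_N) := g ^+ a.
pose h' (x : F) : 'I_N := Ordinal (ltn_pmod (dlog x) N_gt0).
rewrite (reindex_onto h h') => [|x x0] /=; last first.
  by rewrite /h /=; have [lt xE] := dlogP x0; rewrite modn_small.
apply: eq_bigl => a; rewrite /h expf_neq0 ?prim_neq0 //=.
by apply/eqP/val_inj; rewrite /= dlogX modn_small.
Qed.

Lemma sum_prim (R : nmodType) (f : F -> R) :
  \sum_x f x = f 0 + \sum_(a < N) f (g ^+ a).
Proof. by rewrite (bigD1 0) //= sum_nz_prim. Qed.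

(** The multiplicative character that sends the generator g to z, extended by 0;
    it is a character when z is a root of unity of order N. *)
Definition mchar (z : algC) (x : F) : algC := if x == 0 then 0 else z ^+ dlog x.

Lemma mchar0 z : mchar z 0 = 0. Proof. by rewrite /mchar eqxx. Qed.

Lemma mcharX z a : z ^+ N = 1 -> mchar z (g ^+ a) = z ^+ a.
Proof.
move=> zN; rewrite /mchar expf_eq0 (negPf prim_neq0) andbF.
by rewrite -(expr_mod _ zN) dlogX expr_mod.
Qed.

Lemma mchar1 z : z ^+ N = 1 -> mchar z 1 = 1.
Proof. by move=> zN; rewrite -(expr0 g) mcharX // expr0. Qed.

Lemma mcharM z x y : z ^+ N = 1 -> mchar z (x * y) = mchar z x * mchar z y.
Proof.
move=> zN; have [->|x0] := eqVneq x 0; first by rewrite mul0r mchar0 mul0r.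
have [->|y0] := eqVneq y 0; first by rewrite mulr0 mchar0 mulr0.
have [[_ <-] [_ <-]] := (dlogP x0, dlogP y0).
by rewrite -exprD !mcharX // exprD.
Qed.

Lemma mcharXn z x k : z ^+ N = 1 -> mchar z (x ^+ k.+1) = mchar z x ^+ k.+1.
Proof. by move=> zN; elim: k => // k IHk; rewrite exprS mcharM // IHk -exprS. Qed.

Lemma mcharXl z x k : mchar (z ^+ k.+1) x = mchar z x ^+ k.+1.
Proof. by rewrite /mchar; case: eqP => _; rewrite ?expr0n // exprAC. Qed.

Lemma mcharMl z w x : mchar (z * w) x = mchar z x * mchar w x.
Proof. by rewrite /mchar; case: eqP; rewrite ?mulr0 // exprMn. Qed.

Lemma mcharVl z x : mchar z^-1 x = (mchar z x)^-1.
Proof. by rewrite /mchar; case: eqP; rewrite ?invr0 // exprVn. Qed.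

Lemma mcharV z x : z ^+ N = 1 -> mchar z x^-1 = (mchar z x)^-1.
Proof.
move=> zN; have [->|x0] := eqVneq x 0; first by rewrite invr0 mchar0 invr0.
have : mchar z x * mchar z x^-1 = 1 by rewrite -mcharM // divff ?mchar1.
move=> e; have x0' : mchar z x != 0.
  by apply: contraTneq (oner_neq0 algC) => x0'; rewrite -e x0' mul0r eqxx.
by apply: (mulfI x0'); rewrite e divff.
Qed.

Lemma mchar_neq0 z x : z ^+ N = 1 -> (mchar z x != 0) = (x != 0).
Proof.
move=> zN; rewrite /mchar; case: (eqVneq x) => [|x0]; rewrite ?eqxx //.
by rewrite expf_neq0 //; apply: contraTneq (oner_neq0 algC) => z0;
   rewrite -zN z0 expr0n eqn0Ngt N_gt0 eqxx.
Qed.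

Lemma mchar_trivial x : mchar 1 x = (x != 0)%:R.
Proof. by rewrite /mchar; case: eqP => // _; rewrite expr1n. Qed.

Lemma norm_unity_root (z : algC) k : (0 < k)%N -> z ^+ k = 1 -> `|z| = 1.
Proof. by move=> k0 zk; apply/eqP; rewrite -(pexpr_eq1 k0 (normr_ge0 z)) -normrX zk normr1. Qed.

Lemma norm_mchar z x : z ^+ N = 1 -> x != 0 -> `|mchar z x| = 1.
Proof. by move=> zN x0; rewrite /mchar (negPf x0) normrX (norm_unity_root _ zN) ?expr1n. Qed.

Lemma conj_mchar z x : z ^+ N = 1 -> (mchar z x)^* = mchar z^-1 x.
Proof.
move=> zN; rewrite mcharVl; have [->|x0] := eqVneq x 0.
  by rewrite mchar0 invr0 conjC0.
by rewrite invC_norm norm_mchar // expr1n invr1 mul1r.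
Qed.

Lemma sum_mchar z : z ^+ N = 1 -> z != 1 -> \sum_x mchar z x = 0.
Proof.
move=> zN z1; rewrite sum_prim mchar0 add0r.
by under eq_bigr do rewrite mcharX //; rewrite sum_expr_unity.
Qed.

(** Fourier duality on the cyclic group of units: detect t^m = x by the
    orthogonality of characters and sum over t first. *)
Lemma sum_mchar_pow u m x : u ^+ N = 1 -> x != 0 ->
  \sum_(t | (t != 0) && (t ^+ m == x)) mchar u t =
  \sum_(w <- unity_roots N | w ^+ m == u) mchar w x.
Proof.
move=> uN x0; have [ltb <-] := dlogP x0; move: (dlog x) ltb => b ltb.
have N0 : N%:R != 0 :> algC by rewrite pnatr_eq0 -lt0n.
have delta w : w ^+ N = 1 -> (\sum_(a < N) u ^+ a * (w ^- m) ^+ a) = N%:R * (w ^+ m == u)%:R.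
  move=> wN; have wm0 : w ^+ m != 0.
    by rewrite expf_neq0 //; apply: contraTneq (oner_neq0 algC) => w0;
       rewrite -wN w0 expr0n eqn0Ngt N_gt0 eqxx.
  under eq_bigr do rewrite -exprMn.
  case: eqP => [<-|/eqP neq].
    by under eq_bigr do rewrite divff // expr1n; rewrite sumr_const card_ord mulr1.
  rewrite mulr0 sum_expr_unity //; last first.
    by rewrite -(inj_eq (mulIf wm0)) divfK // mul1r eq_sym.
  by rewrite exprMn uN mul1r exprVn exprAC wN expr1n invr1.
apply: (mulfI N0); transitivity (\sum_(w <- unity_roots N)
     w ^+ b * \sum_(a < N) u ^+ a * (w ^- m) ^+ a); last first.
  rewrite mulr_sumr [RHS]big_mkcond [LHS]big_seq [RHS]big_seq.
  apply: eq_bigr => w; rewrite mem_unity_roots // => /eqP wN.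
  by rewrite delta //; case: ifP => _; rewrite ?mulr0 // mulr1 mcharX // mulrC.
under [RHS]eq_bigr do rewrite mulr_sumr.
rewrite exchange_big /= big_mkcondr (sum_nz_prim (fun t => if t ^+ m == g ^+ b then mchar u t else 0)).
rewrite mulr_sumr; apply: eq_bigr => a _.
have -> : (if (g ^+ a) ^+ m == g ^+ b then mchar u (g ^+ a) else 0)
        = ((N %| b + (N - (a * m) %% N))%N)%:R * u ^+ a.
  rewrite -exprM (eq_prim_root_expr prim_g) mcharX //.
  have -> : (a * m == b %[mod N]) = (N %| b + (N - (a * m) %% N))%N.
    rewrite addnBA; last by rewrite ltnW ?ltn_mod.
    rewrite -eqn_mod_dvd; last by rewrite (leq_trans (ltnW (ltn_pmod _ N_gt0))) ?leq_addl.
    by rewrite modnDr modn_mod eq_sym.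
  by case: ifP => _; rewrite ?mul1r ?mul0r.
have -> : N%:R * (((N %| b + (N - (a * m) %% N))%N)%:R * u ^+ a) =
  u ^+ a * (\sum_(w <- unity_roots N) w ^+ (b + (N - (a * m) %% N))).
  by rewrite sum_unity_roots //; case: ifP => _; rewrite ?mul1r ?mul0r ?mulr0 // mulrC.
rewrite mulr_sumr [LHS]big_seq [RHS]big_seq; apply: eq_bigr => w; rewrite mem_unity_roots // => /eqP wN.
have w0 : w != 0 by apply: contraTneq (oner_neq0 algC) => w0;
       rewrite -wN w0 expr0n eqn0Ngt N_gt0 eqxx.
suff -> : (w ^- m) ^+ a = w ^+ (N - (a * m) %% N) by rewrite exprD; ring.
rewrite exprVn -exprM mulnC -(expr_mod (a * m) wN).
apply: (mulIf (expf_neq0 (a * m %% N) w0)); rewrite mulVf ?expf_neq0 //.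
by rewrite -exprD subnK ?wN // ltnW ?ltn_mod.
Qed.

(** The quadratic character. *)
Definition chi := mchar (-1).

Hypothesis odd_card : odd #|F|.

Lemma signN : (-1 : algC) ^+ N = 1.
Proof.
by rewrite -signr_odd; move: odd_card; rewrite -(prednK (ltnW (finNzRing_gt1 F))) oddS => /negPf->.
Qed.

Lemma chi0 : chi 0 = 0. Proof. exact: mchar0. Qed.
Lemma chi1 : chi 1 = 1. Proof. exact/mchar1/signN. Qed.
Lemma chiM x y : chi (x * y) = chi x * chi y. Proof. exact/mcharM/signN. Qed.
Lemma chiX x k : chi (x ^+ k.+1) = chi x ^+ k.+1. Proof. exact/mcharXn/signN. Qed.
Lemma chi_sgn x : x != 0 -> chi x = (-1) ^+ odd (dlog x).
Proof. by rewrite /chi /mchar => /negPf->; rewrite signr_odd. Qed.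
Lemma chi_sq x : x != 0 -> chi x ^+ 2 = 1.
Proof. by move=> x0; rewrite chi_sgn // sqrr_sign. Qed.
Lemma chi_sqr x : x != 0 -> chi (x ^+ 2) = 1.
Proof. by move=> x0; rewrite chiX chi_sq. Qed.
Lemma chiV x : chi x^-1 = chi x.
Proof.
have [->|x0] := eqVneq x 0; first by rewrite invr0.
by rewrite /chi mcharV ?signN // -/(chi x) chi_sgn // signr_odd -exprVn invrN1.
Qed.
Lemma chi_odd x k : odd k -> chi (x ^+ k) = chi x.
Proof.
case: k => // k ok; rewrite chiX; have [->|x0] := eqVneq x 0; first by rewrite chi0 expr0n.
rewrite -(odd_double_half k.+1) ok -muln2 mulnC addnC exprD exprM chi_sq // expr1n mul1r.
by rewrite expr1.
Qed.
Lemma conj_chi x : (chi x)^* = chi x.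
Proof. by rewrite conj_mchar ?signN // invrN1. Qed.

Lemma card_sqrt x : (#|[set y : F | y ^+ 2 == x]|)%:R = 1 + chi x :> algC.
Proof.
have [->|x0] := eqVneq x 0.
  rewrite chi0 addr0 (_ : [set _ | _] = [set 0]) ?cards1 //.
  by apply/setP => y; rewrite !inE sqrf_eq0.
have := @sum_mchar_pow 1 2 x (expr1n _ _) x0.
have -> : \sum_(w <- unity_roots N | w ^+ 2 == 1) mchar w x =
          \sum_(w <- [:: 1; -1]) mchar w x.
  rewrite -big_filter; apply: perm_big; apply: uniq_perm.
  - by rewrite filter_uniq ?uniq_unity_roots.
  - by rewrite /= inE andbT -subr_eq0 opprK -(natrD _ 1 1) pnatr_eq0.
  move=> w; rewrite mem_filter mem_unity_roots // sqrf_eq1 !inE.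
  have [->|_] := eqVneq w 1; first by rewrite expr1n eqxx.
  by have [->|//] := eqVneq w (-1); rewrite signN eqxx.
rewrite !big_cons big_nil addr0 mchar_trivial x0 => <-.
rewrite -sum1_card natr_sum big_mkcond [RHS]big_mkcond.
apply: eq_bigr => y _; rewrite inE mchar_trivial; case: (eqVneq y 0) => [->|_] /=.
  by rewrite expr0n eq_sym (negPf x0).
by case: ifP.
Qed.

End MulChar.

(** * Jacobi sums with the quadratic character *)

Section JacobiSum.

Variables (F : finFieldType) (g : F).
Local Notation N := (#|F|.-1).
Hypothesis prim_g : N.-primitive_root g.
Hypothesis odd_card : odd #|F|.
Local Notation chi := (chi g).
Local Notation mchar := (mchar g).

(** Up to the value of the character at -1 this is the Jacobi sum of the
    character of w and the quadratic character. *)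
Definition Jsum (w : algC) : algC := \sum_s mchar w s * chi (1 + s).

Lemma sum_chi_line a b : a != 0 -> \sum_z chi (b + a * z) = 0.
Proof.
move=> a0; transitivity (\sum_z chi z).
  by rewrite [RHS](reindex_inj (h := fun z => b + a * z)) // => x y /addrI/(mulfI a0).
by apply: sum_mchar; rewrite ?signN // eq_sym -subr_eq0 opprK -(natrD _ 1 1) pnatr_eq0.
Qed.

Lemma sum_chi_quad u : u != 1 -> \sum_y chi (1 + u * y) * chi (1 + y) = - chi u.
Proof.
move=> u1; have a0 : 1 - u != 0 by rewrite subr_eq0 eq_sym.
(* the homography y |-> (1 + u y) / (1 + y) misses only the value u *)
have := sum_chi_line u a0; rewrite (bigD1 0) //= mulr0 addr0 => /eqP.
rewrite addrC addr_eq0 => /eqP <-.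
rewrite (bigD1 (-1)) //= subrr chi0 mulr0 add0r.
have cond y : (y != -1) = (1 + y != 0) by rewrite addrC addr_eq0.
rewrite (reindex (fun z => z^-1 - 1)) /=; last first.
  exists (fun y => (1 + y)^-1) => z; rewrite inE => _.
    by rewrite addrC subrK invrK.
  by rewrite invrK addrC addKr.
apply: eq_big => z.
  by rewrite cond addrC subrK invr_eq0.
move=> z1; have z0 : z != 0 by move: z1; rewrite cond addrC subrK invr_eq0.
have -> : 1 + (z^-1 - 1) = z^-1 by rewrite addrC subrK.
by rewrite chiV // -chiM //; congr (chi _); field.
Qed.

(** In J(w) times its conjugate, put x = u y: the sum over y is elementary
    (sum_chi_quad), it is - chi (u) - 1 except at u = 1, and only the excess there
    survives the summation over u. *)
Lemma Jsum_norm w : w ^+ N = 1 -> w != 1 -> w != -1 -> `|Jsum w| ^+ 2 = #|F|%:R.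
Proof.
move=> wN w1 wm1; have N0 := N_gt0 F.
have m1 : (-1 : algC) != 1 by rewrite eq_sym -subr_eq0 opprK -(natrD _ 1 1) pnatr_eq0.
rewrite normCK /Jsum rmorph_sum /=.
transitivity (\sum_(u | u != 0) mchar w u * \sum_(y | y != 0) chi (1 + u * y) * chi (1 + y)).
  rewrite mulr_sumr (bigD1 0) //= mchar0 mul0r conjC0 mulr0 add0r.
  under [RHS]eq_bigr do rewrite mulr_sumr.
  rewrite [RHS]exchange_big /=; apply: eq_bigr => y y0.
  rewrite mulr_suml (bigD1 0) //= mchar0 !mul0r add0r.
  rewrite (reindex_inj (h := fun x => x * y)) /=; last by move=> a b /(mulIf y0).
  apply: eq_big => u; first by rewrite mulf_eq0 negb_or y0 andbT.
  move=> _; rewrite rmorphM /= conj_chi // conj_mchar // mcharM // mcharVl.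
  have ly0 : mchar w y != 0 by rewrite mchar_neq0.
  by move: (chi _) (chi _) => A B; field.
have inner u : u != 1 -> \sum_(y | y != 0) chi (1 + u * y) * chi (1 + y) = - chi u - 1.
  move=> u1; have := sum_chi_quad u1; rewrite (bigD1 0) //= mulr0 addr0 chi1 // mulr1 => <-.
  by rewrite [RHS]addrC addKr.
have inner1 : \sum_(y | y != 0) chi (1 + 1 * y) * chi (1 + y) = #|F|%:R - 2.
  have : \sum_y chi (1 + y) ^+ 2 = #|F|%:R - 1.
    rewrite (reindex_inj (addrI (-1))) /=; under eq_bigr do rewrite addNKr.
    rewrite (bigD1 0) //= chi0 expr0n add0r.
    under eq_bigr => y y0 do rewrite chi_sq //.
    rewrite -[LHS]/(\sum_(y in predC1 0) 1) sumr_const cardC1.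
    by rewrite -subn1 natrB // ltnW ?finNzRing_gt1.
  rewrite (bigD1 0) //= addr0 chi1 // expr1n => e.
  under eq_bigr do rewrite mul1r -expr2.
  by apply: (addrI 1); rewrite e; ring.
rewrite (bigD1 1) ?oner_neq0 //= inner1 mchar1 // mul1r.
under eq_bigr => u /andP[_ u1] do rewrite inner //.
have : \sum_(u | u != 0) mchar w u * (- chi u - 1) = 0.
  have := sum_mchar prim_g wN w1; rewrite (bigD1 0) //= mchar0 add0r => s1.
  have := @sum_mchar F g prim_g (- w); rewrite -mulN1r exprMn signN // mul1r.
  rewrite mulN1r => /(_ wN); rewrite eqr_oppLR => /(_ wm1).
  rewrite (bigD1 0) //= mchar0 add0r => s2.
  transitivity (- \sum_(u | u != 0) mchar (- w) u - \sum_(u | u != 0) mchar w u).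
    rewrite -!sumrN -big_split; apply: eq_bigr => u u0 /=.
    have -> : mchar (- w) u = chi u * mchar w u by rewrite -mcharMl mulN1r.
    by ring.
  by rewrite s1 s2 subr0 oppr0.
rewrite (bigD1 1) ?oner_neq0 //= mchar1 // chi1 // mul1r => /eqP.
by rewrite addrC addr_eq0 => /eqP ->; ring.
Qed.

Lemma Jsum_conj w : w ^+ N = 1 -> (Jsum w)^* = Jsum w^-1.
Proof.
move=> wN; rewrite rmorph_sum; apply: eq_bigr => s _.
by rewrite rmorphM /= conj_chi // conj_mchar.
Qed.

(** Substitute 1 / s for s. *)
Lemma Jsum_inv w : w ^+ N = 1 -> Jsum (- w^-1) = Jsum w.
Proof.
move=> wN; rewrite /Jsum (reindex_inj invr_inj) /=; apply: eq_bigr => s _.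
have [->|s0] := eqVneq s 0; first by rewrite invr0 !mchar0 !mul0r.
rewrite -mulN1r mcharMl -/(chi _) chiV // mcharVl mcharV // invrK.
have -> : 1 + s^-1 = (1 + s) * s^-1 by field.
rewrite chiM // chiV //; transitivity (chi s ^+ 2 * (mchar w s * chi (1 + s))); first by ring.
by rewrite chi_sq // mul1r.
Qed.

Lemma pchar_pexp (p m : nat) : p \in [pchar F] -> [pchar F].-nat (p ^ m)%N.
Proof. by move=> pF; rewrite pnatX pnatE ?pF // (pcharf_prime pF). Qed.

(** Substitute s^(p^m) for s, and use that Frobenius is additive. *)
Lemma Jsum_frob (p m : nat) w : p \in [pchar F] -> odd p -> w ^+ N = 1 ->
  Jsum (w ^+ (p ^ m)) = Jsum w.
Proof.
move=> pF op wN; have p0 : (0 < p ^ m)%N by rewrite expn_gt0 prime_gt0 ?(pcharf_prime pF).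
have nat_pm := pchar_pexp m pF.
have inj : injective (fun s : F => s ^+ (p ^ m)).
  elim: m {p0 nat_pm} => [|m IH] a b; first by rewrite !expr1.
  rewrite expnSr !exprM => /= /(fmorph_inj (pFrobenius_aut pF)); exact: IH.
rewrite [RHS](reindex_inj inj); apply: eq_bigr => s _.
rewrite -(prednK p0) mcharXl -mcharXn // prednK //; congr (_ * _).
rewrite -{2}(expr1n _ (p ^ m)%N) -exprDn_pchar //.
by rewrite chi_odd // oddX op orbT.
Qed.

(** The split part of the count: t^d + t^-d is 1 + t^(2d) up to the square class
    of t^d, which is absorbed by the sign in w^(2d) = -1. *)
Lemma sum_chi_split d : odd d ->
  \sum_(t | t != 0) chi (t ^+ d + t ^- d) =
  \sum_(w <- unity_roots N | w ^+ (2 * d) == -1) Jsum w.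
Proof.
move=> od; have N0 := N_gt0 F.
have d0 : (0 < 2 * d)%N by case: d od.
transitivity (\sum_(s | s != 0) chi (1 + s) *
    \sum_(w <- unity_roots N | w ^+ (2 * d) == -1) mchar w s); last first.
  under eq_bigr do rewrite mulr_sumr.
  rewrite exchange_big /=; apply: eq_bigr => w _.
  rewrite /Jsum [RHS](bigD1 0) //= mchar0 mul0r add0r.
  by apply: eq_bigr => s _; rewrite mulrC.
under [RHS]eq_bigr => s s0 do rewrite -(sum_mchar_pow prim_g (2 * d) (signN odd_card) s0) -/chi mulr_sumr.
rewrite (exchange_big_dep (fun t => t != 0)) /=; last by move=> ? ? _ /andP[].
apply: eq_bigr => t t0.
rewrite (big_pred1 (t ^+ (2 * d))); last first.
  move=> s /=; rewrite t0 /= [_ == s]eq_sym; have [->|_] := eqVneq s (t ^+ (2 * d)).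
    by rewrite expf_neq0.
  by rewrite andbF.
have -> : t ^+ d + t ^- d = (1 + t ^+ (2 * d)) * t ^- d.
  by rewrite mulrDl mul1r mul2n -addnn exprD mulfK ?expf_neq0 // addrC.
by rewrite chiM // chiV // chi_odd.
Qed.

End JacobiSum.

(** * Quadratic extensions and Eisenstein sums *)

(** The generator of the unit group is not a square; adjoin its square root. *)
Lemma quadratic_extension (F : finFieldType) : odd #|F| ->
  {E : finFieldType & {iota : {rmorphism F -> E} | #|E| = (#|F| ^ 2)%N}}.
Proof.
move=> oF.
have [a prim_a] := finField_prim_root F.
have nsq y : y ^+ 2 != a.
  have e : (#|F|.-1./2.*2 = #|F|.-1)%N.
    by rewrite even_halfK // -oddS prednK ?oF // ltnW ?finNzRing_gt1.
  apply/eqP => ya; have : (#|F|.-1 %| #|F|.-1./2)%N.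
    rewrite (prim_order_dvd prim_a) -ya -exprM mul2n e expf_pred_card //.
    apply: contraTneq (prim_neq0 prim_a) => y0.
    by rewrite -ya y0 expr0n eqxx.
  have N0 := N_gt0 F; have h0 : (0 < #|F|.-1./2)%N by rewrite -double_gt0 e.
  by rewrite gtnNdvd // -{2}e -addnn -{1}[_./2]addn0 ltn_add2l.
have irr : irreducible_poly ('X^2 - a%:P).
  apply: cubic_irreducible; rewrite ?size_XnsubC // => x.
  rewrite /root !hornerE subr_eq0; exact: nsq.
have [L dimL _] := irredp_FAdjoin irr.
exists (FinFieldExtType L); exists (in_alg L).
by rewrite -(@card_vspacef F _ (Falgebra.on (finvect_type L))) card_vspace dimL size_XnsubC.
Qed.

Section QuadExt.

Variables (F E : finFieldType) (iota : {rmorphism F -> E}) (g : F) (G : E) (p m : nat).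
Local Notation Q := #|F|.
Local Notation N := (#|F|.-1).
Local Notation M := (#|E|.-1).
Hypothesis prim_G : M.-primitive_root G.
Hypothesis card_E : #|E| = (Q ^ 2)%N.
Hypothesis iota_g : iota g = G ^+ Q.+1.
Hypotheses (pr_p : prime p) (odd_p : odd p) (card_F : Q = (p ^ m)%N).
Local Notation chiE := (chi G).
Local Notation chi := (chi g).
Local Notation mcharF := (mchar g).
Local Notation mcharE := (mchar G).

Lemma cardF_gt1 : (1 < Q)%N. Proof. exact: finNzRing_gt1. Qed.

Lemma M_eq : M = (N * Q.+1)%N.
Proof. by rewrite card_E; case: Q cardF_gt1 => // n _; rewrite -subn1 -(exp1n 2) subn_sqr subn1 addn1. Qed.

Lemma N_gt0' : (0 < N)%N. Proof. exact: N_gt0. Qed.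

Lemma prim_g : N.-primitive_root g.
Proof.
rewrite -(fmorph_primitive_root iota) iota_g.
have := dvdn_prim_root prim_G (m := N); rewrite M_eq dvdn_mulr // mulKn ?N_gt0' //.
exact.
Qed.

Lemma oddF : odd Q. Proof. by rewrite card_F oddX odd_p orbT. Qed.
Lemma oddE : odd #|E|. Proof. by rewrite card_E oddX oddF. Qed.

Lemma pchar_E : p \in [pchar E].
Proof. by apply: (@card_finPcharP _ _ (m * 2)) => //; rewrite card_E card_F expnM. Qed.

Lemma frobD (x y : E) : (x + y) ^+ Q = x ^+ Q + y ^+ Q.
Proof. by rewrite exprDn_pchar // card_F; exact: pchar_pexp pchar_E. Qed.
Lemma frobN (x : E) : (- x) ^+ Q = - x ^+ Q.
Proof. by rewrite exprNn -signr_odd oddF mulN1r. Qed.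
Lemma frobB (x y : E) : (x - y) ^+ Q = x ^+ Q - y ^+ Q.
Proof. by rewrite frobD frobN. Qed.
Lemma frob_iota x : (iota x) ^+ Q = iota x.
Proof. by rewrite -rmorphXn expf_card. Qed.
Lemma frobK (x : E) : (x ^+ Q) ^+ Q = x.
Proof. by rewrite -exprM mulnn -card_E expf_card. Qed.

Lemma fixed_iota (y : E) : y ^+ Q = y -> exists x, iota x = y.
Proof.
have [->|y0] := eqVneq y 0; first by exists 0; rewrite rmorph0.
have [_ <-] := dlogP prim_G y0 => /eqP.
rewrite -exprM (eq_prim_root_expr prim_G) -{2}[dlog G y]muln1 eqn_mod_dvd; last first.
  by rewrite leq_mul2l ltnW ?cardF_gt1 ?orbT.
rewrite -mulnBr M_eq mulnC subn1 dvdn_pmul2r ?N_gt0' // => /dvdnP[k ->].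
by exists (g ^+ k); rewrite rmorphXn iota_g -exprM mulnC.
Qed.

(** Inverse of the embedding on its image; traces and norms to F are defined
    through it, as fixed elements of the Frobenius of F. *)
Definition descend (y : E) : F := odflt 0 [pick x | iota x == y].

Lemma descendK y : y ^+ Q = y -> iota (descend y) = y.
Proof.
move=> /fixed_iota[x xy]; rewrite /descend; case: pickP => [z /eqP //|/(_ x)].
by rewrite xy eqxx.
Qed.

Definition tr y := descend (y + y ^+ Q).
Definition nm y := descend (y ^+ Q.+1).

Lemma trE y : iota (tr y) = y + y ^+ Q.
Proof. by rewrite descendK // frobD frobK addrC. Qed.
Lemma nmE y : iota (nm y) = y ^+ Q.+1.
Proof. by rewrite descendK // exprS exprMn frobK mulrC. Qed.

Lemma trZ a y : tr (iota a * y) = a * tr y.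
Proof.
by apply: (fmorph_inj iota); rewrite rmorphM !trE exprMn frob_iota mulrDr.
Qed.
Lemma tr_frob y : tr (y ^+ Q) = tr y.
Proof. by apply: (fmorph_inj iota); rewrite !trE frobK addrC. Qed.

Lemma unityNM (w : algC) : w ^+ Q.+1 = -1 -> w ^+ M = 1.
Proof. by move=> w1; rewrite M_eq mulnC exprM w1 signN // oddF. Qed.

Lemma mchar_iota w x : w ^+ M = 1 -> mcharE w (iota x) = mcharF (w ^+ Q.+1) x.
Proof.
move=> wM; have [->|x0] := eqVneq x 0; first by rewrite rmorph0 !mchar0.
have [_ <-] := dlogP prim_g x0.
by rewrite rmorphXn iota_g -exprM !mcharX ?prim_g // -exprM // mulnC -M_eq.
Qed.

Lemma chi_nm y : chi (nm y) = chiE y.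
Proof.
have [->|y0] := eqVneq y 0.
  by rewrite chi0 (_ : nm 0 = 0) ?chi0 //; apply: (fmorph_inj iota); rewrite nmE rmorph0 expr0n.
have [_ <-] := dlogP prim_G y0.
have -> : nm (G ^+ dlog G y) = g ^+ dlog G y.
  by apply: (fmorph_inj iota); rewrite nmE rmorphXn iota_g exprAC.
by rewrite /(chi _) /(chiE _) !mcharX ?signN ?prim_g ?oddF ?oddE.
Qed.

(** Eisenstein sum of the character of w. *)
Definition Esum (w : algC) : algC := \sum_(x | tr x == 1) mcharE w x.

(** A common zero of the two traces would be multiplied by u without leaving the
    line of trace zero, which forces u to be in F. *)
Lemma tr_coord u : u ^+ Q != u -> bijective (fun y => (tr y, tr (u * y))).
Proof.
move=> uQ; apply: inj_card_bij; last by rewrite card_prod card_E.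
move=> x y [e1 e2]; apply/eqP; rewrite -subr_eq0; apply: contraNT uQ => xy0.
have t1 : (x - y) ^+ Q = - (x - y).
  move/(congr1 iota): e1; rewrite !trE frobB => /eqP; rewrite -subr_eq0 => /eqP e1.
  by apply/eqP; rewrite -subr_eq0 opprK -e1; apply/eqP; ring.
have t2 : (u * (x - y)) ^+ Q = - (u * (x - y)).
  move/(congr1 iota): e2; rewrite !trE mulrBr frobB => /eqP; rewrite -subr_eq0 => /eqP e2.
  by apply/eqP; rewrite -subr_eq0 opprK -e2; apply/eqP; ring.
by move: t2; rewrite exprMn t1 -mulrN => /eqP; rewrite (inj_eq (mulIf _)) ?oppr_eq0.
Qed.

(** In the Eisenstein sum times its conjugate, collect the ratios u of the two
    variables: a ratio outside F occurs once (tr_coord), 1 occurs Q times, and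
    other elements of F do not occur.  Compared with the zero sum of the
    character, the excess is Q minus the sum of chi over F. *)
Lemma Esum_norm w : w ^+ Q.+1 = -1 -> `|Esum w| ^+ 2 = Q%:R.
Proof.
move=> wQ; have wM := unityNM wQ.
have w1 : w != 1.
  apply: contra_eqN wQ => /eqP->; rewrite expr1n eq_sym.
  by rewrite eq_sym -subr_eq0 opprK -(natrD _ 1 1) pnatr_eq0.
have chi_iota x : mcharE w (iota x) = chi x by rewrite mchar_iota // wQ.
pose c u := #|[set y | (tr y == 1) && (tr (u * y) == 1)]|.
have -> : `|Esum w| ^+ 2 = \sum_u mcharE w u * (c u)%:R.
  rewrite normCK /Esum rmorph_sum mulr_sumr /=.
  transitivity (\sum_(y | tr y == 1) \sum_(u | tr (u * y) == 1) mcharE w u).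
    apply: eq_bigr => y ty; have y0 : y != 0.
      apply: contraTneq ty => ->; rewrite (_ : tr 0 = 0) 1?eq_sym ?oner_eq0 //.
      by apply: (fmorph_inj iota); rewrite trE rmorph0 expr0n add0r eqn0Ngt (ltnW cardF_gt1).
    rewrite mulr_suml (reindex_inj (h := fun u => u * y)) /=; last by move=> a b /(mulIf y0).
    apply: eq_bigr => u _; rewrite mcharM // conj_mchar // mcharVl mulfK //.
    by rewrite mchar_neq0.
  rewrite (exchange_big_dep predT) //=; apply: eq_bigr => u _.
  rewrite sumr_const mulr_natr; congr (_ *+ _); apply: eq_card => y.
  by rewrite !inE.
have cnotin u : u ^+ Q != u -> c u = 1%N.
  move=> /tr_coord[h hK Kh]; rewrite /c (_ : [set _ | _] = [set h (1, 1)]) ?cards1 //.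
  apply/setP => y; rewrite !inE -(can2_eq hK Kh).
  by rewrite xpair_eqE.
have c1 : c 1 = Q.
  have GQ : G ^+ Q != G.
    have N0 := N_gt0'; have lt1Q := cardF_gt1.
    have NM : (N < M)%N by rewrite M_eq -{1}[N]muln1 ltn_pmul2l // ltnS ltnW.
    apply/eqP => GQ; have /eqP : G ^+ N = 1.
      by apply: (mulfI (prim_neq0 prim_G)); rewrite -exprS mulr1 prednK ?GQ // ltnW.
    by rewrite -(prim_order_dvd prim_G) gtnNdvd.
  have [h hK Kh] := tr_coord GQ.
  rewrite /c -[RHS]cardsT -(card_imset setT (f := fun b => h (1, b))); last first.
    by move=> a b /(can_inj Kh) [].
  apply: eq_card => y; rewrite inE mul1r andbb; apply/eqP/imsetP => [ty|[b _ ->]].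
    by exists (tr (G * y)) => //; rewrite -ty hK.
  by have [-> _] := Kh (1, b).
have cin x : x != 1 -> c (iota x) = 0%N.
  move=> x1; apply/eqP; rewrite cards_eq0; apply/eqP/setP => y; rewrite !inE trZ.
  by apply/negP => /andP[/eqP -> /eqP]; rewrite mulr1; apply/eqP.
transitivity (\sum_u mcharE w u + \sum_u mcharE w u * ((c u)%:R - 1)).
  by rewrite -big_split; apply: eq_bigr => u _ /=; ring.
rewrite sum_mchar // add0r.
rewrite (bigID (fun u => u \in codom iota)) /= [X in _ + X]big1 ?addr0; last first.
  move=> u nu; rewrite cnotin ?subrr ?mulr0 //; apply: contraNneq nu => /fixed_iota[x <-].
  exact: codom_f.
have -> : \sum_(u in codom iota) mcharE w u * ((c u)%:R - 1) = \sum_x chi x * ((c (iota x))%:R - 1).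
  rewrite (eq_bigl (mem (iota @: setT))); last first.
    by move=> u; rewrite inE; apply/codomP/imsetP => [[x ->]|[x _ ->]]; exists x.
  rewrite big_imset /=; last by move=> a b _ _; exact: fmorph_inj.
  by apply: eq_big => x; rewrite ?inE // chi_iota.
transitivity (\sum_x chi x * (c (iota x))%:R - \sum_x chi x).
  by rewrite -sumrB; apply: eq_bigr => x _; rewrite mulrBr mulr1.
rewrite (sum_mchar prim_g) ?signN ?oddF //; last first.
  by rewrite eq_sym -subr_eq0 opprK -(natrD _ 1 1) pnatr_eq0.
rewrite subr0 (bigD1 1) //= rmorph1 c1 chi1 ?prim_g ?oddF // mul1r big1 ?addr0 // => x x1.
by rewrite cin // mulr0.
Qed.

Lemma neg1_neq1 : (-1 : algC) != 1.
Proof. by rewrite eq_sym -subr_eq0 opprK -(natrD _ 1 1) pnatr_eq0. Qed.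

(** Slice along the values c of the trace; scaling by c reduces each slice to that
    of trace 1. *)
Lemma sum_mchar_tr w : w ^+ M = 1 ->
  \sum_x mcharE w x * chi (tr x) = if w ^+ Q.+1 == -1 then N%:R * Esum w else 0.
Proof.
move=> wM; have wN : (w ^+ Q.+1) ^+ N = 1 by rewrite -exprM mulnC -M_eq.
transitivity (\sum_(c | c != 0) mcharF (w ^+ Q.+1 * -1) c * Esum w); last first.
  rewrite -mulr_suml; have := mchar0 g (w ^+ Q.+1 * -1); move: (w ^+ Q.+1) wN => z zN m0.
  case: eqP => [->|/eqP zm1].
    under eq_bigr => c c0 do rewrite mulrNN mul1r mchar_trivial c0.
    by rewrite -[\sum_(_ | _) _]/(\sum_(c in predC1 0) 1) sumr_const cardC1.
  have := @sum_mchar F g prim_g (z * -1); rewrite (bigD1 0) //= m0 add0r => ->; first by rewrite mul0r.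
    by rewrite exprMn zN signN ?oddF ?mulr1.
  by rewrite mulrN1 eqr_oppLR.
under [RHS]eq_bigr => c c0 do rewrite mulr_sumr.
rewrite [RHS](exchange_big_dep predT) //=.
transitivity (\sum_x \sum_(c | (c != 0) && (tr x == c)) mcharE w x * chi c).
  apply: eq_bigr => x _; have [t0|t0] := eqVneq (tr x) 0.
    by rewrite t0 chi0 mulr0 big_pred0 // => c; rewrite [0 == c]eq_sym andNb.
  rewrite (big_pred1 (tr x)) // => c /=; rewrite [tr x == c]eq_sym.
  by have [->|_] := eqVneq c (tr x); rewrite ?t0 ?andbF.
rewrite (exchange_big_dep predT) //= [RHS](exchange_big_dep predT) //=.
rewrite big_mkcond [RHS]big_mkcond; apply: eq_bigr => c _.
have [->|c0] := eqVneq c 0; first by rewrite !big_pred0_eq.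
have ic0 : iota c != 0 by rewrite fmorph_eq0.
rewrite (reindex_inj (h := fun x => iota c * x)) /=; last by move=> a b /(mulfI ic0).
apply: eq_big => [x|x _]; first by rewrite trZ -{2}[c]mulr1 (inj_eq (mulfI c0)).
rewrite mcharM // mchar_iota // mcharMl -/(chi c); ring.
Qed.

(** The nonsplit part of the count: t = y^(Q-1) parametrizes the norm-one group,
    Q - 1 times each, and the trace of t^d is that of y^(2d) up to the norm of
    y^d. *)
Lemma sum_chi_nonsplit d : odd d ->
  \sum_(t | t ^+ Q.+1 == 1) chi (tr (t ^+ d)) =
  \sum_(w <- unity_roots M | (w ^+ (2 * d) == -1) && (w ^+ Q.+1 == -1)) Esum w.
Proof.
move=> od; have N0 := N_gt0'; have M0 : (0 < M)%N by rewrite M_eq muln_gt0 N0.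
have d0 : (0 < 2 * d)%N by case: d od.
have NR : N%:R != 0 :> algC by rewrite pnatr_eq0 -lt0n.
apply: (mulfI NR); rewrite !mulr_sumr.
transitivity (\sum_(w <- unity_roots M | w ^+ (2 * d) == -1) \sum_x mcharE w x * chi (tr x)); last first.
  rewrite big_mkcondr [LHS]big_seq_cond [RHS]big_seq_cond.
  by apply: eq_bigr => w /andP[]; rewrite mem_unity_roots // => /eqP wM _; rewrite sum_mchar_tr.
transitivity (\sum_(x | x != 0) chi (tr x) * 
    \sum_(w <- unity_roots M | w ^+ (2 * d) == -1) mcharE w x); last first.
  under eq_bigr do rewrite mulr_sumr.
  rewrite exchange_big /=; apply: eq_bigr => w _.
  rewrite [RHS](bigD1 0) //= mchar0 mul0r add0r.
  by apply: eq_bigr => s _; rewrite mulrC.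
have sM := signN oddE.
under [RHS]eq_bigr => s s0 do rewrite -(sum_mchar_pow prim_G (2 * d) sM s0) mulr_sumr.
rewrite [RHS](exchange_big_dep (fun t => t != 0)) /=; last by move=> ? ? _ /andP[].
transitivity (\sum_(y | y != 0) chi (tr ((y ^+ N) ^+ d))); last first.
  apply: eq_bigr => t t0.
  rewrite (big_pred1 (t ^+ (2 * d))); last first.
    move=> s /=; rewrite t0 /= [_ == s]eq_sym; have [->|_] := eqVneq s (t ^+ (2 * d)).
      by rewrite expf_neq0.
    by rewrite andbF.
  rewrite -/(chiE t) -chi_nm -(chi_odd prim_g oddF (nm t) od) -(chiV prim_g oddF (nm t ^+ d)).
  have nt0 : nm t != 0 by rewrite -(fmorph_eq0 iota) nmE expf_neq0.
  have ntd : nm t ^+ d != 0 by rewrite expf_neq0.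
  rewrite mulrC -chiM ?prim_g ?oddF // -trZ; congr (chi _).
  rewrite -[RHS]tr_frob; congr tr.
  rewrite exprMn frob_iota fmorphV rmorphXn nmE.
  have -> : t ^+ N = t ^+ Q / t.
    by rewrite -[in RHS](prednK (ltnW cardF_gt1)) exprSr mulfK.
  have tQ : t ^+ Q != 0 by rewrite expf_neq0.
  rewrite exprS [(t ^+ (2 * d)) ^+ Q]exprAC; move: (t ^+ Q) tQ => u u0.
  rewrite expr_div_n exprMn [(2 * d)%N]mulnC exprM.
  by field; rewrite !expf_neq0.
pose f t := chi (tr (t ^+ d)).
rewrite -/(f _) (eq_bigr (fun t => N%:R * f t)) // [RHS](eq_bigr (fun y => f (y ^+ N))) //.
transitivity (\sum_(y | y != 0) \sum_(t | (t != 0) && (y ^+ N == t)) f t); last first.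
  apply: eq_bigr => y y0; rewrite (big_pred1 (y ^+ N)) // => t /=; rewrite [_ == t]eq_sym.
  by have [->|_] := eqVneq t (y ^+ N); rewrite ?andbF // expf_neq0.
rewrite (exchange_big_dep (fun t => t != 0)) /=; last by move=> ? ? _ /andP[].
rewrite big_mkcond [RHS]big_mkcond; apply: eq_bigr => t _.
have [->|t0] /= := eqVneq t 0; first by rewrite expr0n /= eq_sym oner_eq0.
have := sum_mchar_pow prim_G N (expr1n _ M) t0.
rewrite (eq_bigr (fun=> 1)) => [e|y /andP[y0 _]]; last by rewrite mchar_trivial y0.
have {}e : \sum_(y | (y != 0) && (y ^+ N == t)) 1 = (if t ^+ Q.+1 == 1 then N%:R else 0) :> algC.
  rewrite e (big_unity_roots (M := N)) //; last by move=> z /eqP.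
  transitivity (\sum_(w <- unity_roots N) w ^+ dlog G t).
    rewrite big_mkcond /= [LHS]big_seq [RHS]big_seq; apply: eq_bigr => w.
    rewrite mem_unity_roots // => /eqP wN; rewrite wN eqxx M_eq exprM wN expr1n eqxx /=.
    by rewrite /mchar (negPf t0).
  rewrite sum_unity_roots //; congr (if _ then _ else _).
  have [_ {2}<-] := dlogP prim_G t0.
  by rewrite -exprM -(prim_order_dvd prim_G) M_eq dvdn_pmul2r.
have -> : (if t ^+ Q.+1 == 1 then N%:R * f t else 0) = (if t ^+ Q.+1 == 1 then N%:R else 0) * f t.
  by case: ifP; rewrite ?mul0r.
by rewrite -e mulr_suml; apply: eq_bigr => y _; rewrite mul1r.
Qed.

Lemma two_neq0 : (2 : F) != 0.
Proof.
have pF := card_finPcharP card_F pr_p.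
rewrite -(dvdn_pcharf pF) gtnNdvd //; move: odd_p (prime_gt1 pr_p).
by case: p => [|[|[|]]].
Qed.

Lemma sum_card_sqrt (f a : F -> F) (h : F -> algC) :
  \sum_(P : F * F | P.2 ^+ 2 == a P.1) h P.1 = \sum_x h x * (1 + chi (a x)).
Proof.
rewrite -(pair_big_dep predT (fun x y => y ^+ 2 == a x) (fun x _ => h x)) /=.
apply: eq_bigr => x _; rewrite -card_sqrt ?prim_g ?oddF // sumr_const mulr_natr.
by congr (_ *+ _); apply: eq_card => y; rewrite !inE.
Qed.

(** x = t + 1/t has the solutions t = (x + y) / 2 with y^2 = x^2 - 4. *)
Lemma sum_split_torus (f : F -> algC) :
  \sum_(t | t != 0) f (t + t^-1) = \sum_x f x * (1 + chi (x ^+ 2 - 4)).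
Proof.
have n2 := two_neq0; have n4 : (4 : F) != 0.
  by rewrite (_ : 4 = 2 * 2) ?mulf_neq0 // -natrM.
rewrite -(sum_card_sqrt id (fun x => x ^+ 2 - 4)).
rewrite [RHS](reindex_onto (fun t : F => (t + t^-1, t - t^-1)) (fun P => (P.1 + P.2) / 2)) /=.
  apply: eq_bigl => t; have [->|t0] /= := eqVneq t 0.
    by rewrite invr0 subrr addr0 expr0n /= sub0r eq_sym oppr_eq0 (negPf n4).
  by symmetry; apply/andP; split; apply/eqP; field; rewrite ?n2 ?t0.
move=> [x y] /= /eqP xy.
have e : (x + y) * (x - y) = 4 by rewrite mulrC -subr_sqr xy opprB addrC subrK.
have xy0 : x + y != 0 by apply: contraNneq n4 => xy0; rewrite -e xy0 mul0r.
have -> : ((x + y) / 2)^-1 = (x - y) / 2.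
  apply: (mulfI xy0); rewrite invf_div mulrCA divff // mulr1 mulrA e.
  by rewrite (_ : 4 = 2 * 2) ?mulfK // -natrM.
by congr (_, _); field.
Qed.

(** As for the split torus, but with (x^2 - 4) / g, where g is not a square: t is
    (x + y0 z) / 2 with y0 a square root of g in E. *)
Lemma sum_nonsplit_torus (f : F -> algC) :
  \sum_(t | t ^+ Q.+1 == 1) f (tr t) = \sum_x f x * (1 - chi (x ^+ 2 - 4)).
Proof.
have n2 := two_neq0; have i2 : (2 : E) != 0 by rewrite -(fmorph_eq0 iota) rmorph_nat in n2.
have g0 : g != 0 by exact: prim_neq0 prim_g.
pose y0 := G ^+ (Q.+1)./2.
have y02 : y0 ^+ 2 = iota g.
  by rewrite -exprM muln2 even_halfK ?iota_g //= oddF.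
have y0n : y0 != 0 by rewrite -sqrf_eq0 y02 fmorph_eq0.
have y0Q : y0 ^+ Q = - y0.
  have : (y0 ^+ Q) ^+ 2 == y0 ^+ 2 by rewrite exprAC y02 frob_iota.
  rewrite eqf_sqr => /orP[|/eqP //]; have N0 := N_gt0'; have lt1Q := cardF_gt1.
  move=> /eqP fix0; have : y0 ^+ N = 1.
    by apply: (mulfI y0n); rewrite -exprS mulr1 prednK // ltnW.
  move/eqP; rewrite -exprM -(prim_order_dvd prim_G) M_eq [(_./2 * N)%N]mulnC dvdn_pmul2l // gtnNdvd //.
    by rewrite half_gt0 ltnS ltnW.
  by rewrite -divn2 ltn_Pdiv.
have chig : chi g = -1.
  by rewrite -[g]expr1 /chi mcharX ?expr1 ?signN ?prim_g ?oddF.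
transitivity (\sum_(P : F * F | P.2 ^+ 2 == (P.1 ^+ 2 - 4) / g) f P.1); last first.
  rewrite (sum_card_sqrt id (fun x => (x ^+ 2 - 4) / g)); apply: eq_bigr => x _.
  by rewrite chiM ?prim_g ?oddF // chiV ?prim_g ?oddF // chig mulrN1.
rewrite [RHS](reindex_onto (fun t : E => (tr t, descend ((t - t ^+ Q) / y0)))
   (fun P => (iota P.1 + y0 * iota P.2) / 2)) /=.
  apply: eq_bigl => t.
  have fz : ((t - t ^+ Q) / y0) ^+ Q = (t - t ^+ Q) / y0.
    by rewrite exprMn exprVn y0Q frobB frobK invrN mulrN -mulNr opprB.
  have -> : (iota (tr t) + y0 * iota (descend ((t - t ^+ Q) / y0))) / 2 = t.
    by rewrite descendK // trE; field; rewrite i2 y0n.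
  rewrite eqxx andbT.
  have y02n : y0 ^+ 2 != 0 by rewrite expf_neq0.
  rewrite -(inj_eq (fmorph_inj iota)) rmorphXn descendK // fmorph_div rmorphB rmorphXn.
  rewrite trE rmorph_nat -y02 expr_div_n (inj_eq (divIf y02n)) exprS.
  have -> : (t - t ^+ Q) ^+ 2 = (t + t ^+ Q) ^+ 2 - 4 * (t * t ^+ Q) by ring.
  have i4 : (4 : E) != 0 by rewrite (_ : 4 = 2 * 2) ?mulf_neq0 // -natrM.
  by rewrite (inj_eq (addrI _)) eqr_opp -[X in _ = (_ == X)]mulr1 (inj_eq (mulfI i4)).
move=> [x z] /= /eqP xz.
have tQ : ((iota x + y0 * iota z) / 2) ^+ Q = (iota x - y0 * iota z) / 2.
  rewrite -[2](rmorph_nat iota) -fmorphV exprMn frob_iota frobD exprMn y0Q !frob_iota.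
  by rewrite mulNr.
congr (_, _).
  by apply: (fmorph_inj iota); rewrite trE tQ; field.
rewrite tQ; apply: (fmorph_inj iota).
have -> : ((iota x + y0 * iota z) / 2 - (iota x - y0 * iota z) / 2) / y0 = iota z.
  by field; rewrite y0n.
by rewrite descendK ?frob_iota.
Qed.

(** Every element of F is t + 1/t for two values of t, which lie in F or in the
    norm-one group of E; the discriminant x^2 - 4 decides. *)
Lemma sum_tori (f : F -> algC) :
  2 * \sum_x f x = \sum_(t | t != 0) f (t + t^-1) + \sum_(t | t ^+ Q.+1 == 1) f (tr t).
Proof.
rewrite sum_split_torus sum_nonsplit_torus -big_split mulr_sumr.
by apply: eq_bigr => x _ /=; ring.
Qed.

End QuadExt.

(** * Chebyshev polynomials and the points of the curve *)

(** Stated for an arbitrary evaluation point, so that it serves both for the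
    fraction field that defines the polynomials and for finite fields. *)
Lemma chebyshev_step (K : fieldType) (x : K) (P Q : {poly int}) d : x != 0 ->
  (map_poly intr P).[x + x^-1] = x ^+ d + x ^- d ->
  (map_poly intr Q).[x + x^-1] = x ^+ d.+1 + x ^- d.+1 ->
  (map_poly intr ('X * Q - P)).[x + x^-1] = x ^+ d.+2 + x ^- d.+2.
Proof.
move=> x0 HP HQ.
rewrite rmorphB rmorphM /= map_polyX hornerD hornerN hornerM hornerX HP HQ.
have xd0 : x ^+ d != 0 by rewrite expf_neq0.
by rewrite !exprS; field; rewrite x0 xd0.
Qed.

Lemma chebyshev_base (K : fieldType) (x : K) :
  (map_poly intr (2%:P : {poly int})).[x + x^-1] = x ^+ 0 + x ^- 0 /\
  (map_poly intr ('X : {poly int})).[x + x^-1] = x ^+ 1 + x ^- 1.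
Proof.
by rewrite map_polyC map_polyX hornerC hornerX /= !expr0 invr1.
Qed.

Lemma chebyshev_rec d :
  [/\ chebyshev 0 = 2%:P, chebyshev 1 = 'X &
      chebyshev d.+2 = 'X * chebyshev d.+1 - chebyshev d].
Proof.
have X0 : fracX != 0 by rewrite /fracX tofrac_eq0 polyX_eq0.
have [e0 e1] := chebyshev_base fracX.
split; symmetry; apply: chebyshev_unique; apply/eqP => //.
exact: (chebyshev_step X0 (eqP (chebyshevP d)) (eqP (chebyshevP d.+1))).
Qed.

Lemma phi_rec (R : nzRingType) d :
  [/\ phi R 0 = 2%:P, phi R 1 = 'X & phi R d.+2 = 'X * phi R d.+1 - phi R d].
Proof.
have [e0 e1 e2] := chebyshev_rec d.
rewrite /phi e0 e1 e2; split; first by rewrite map_polyC /= rmorph_nat.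
  by rewrite map_polyX.
by rewrite rmorphB rmorphM /= map_polyX.
Qed.

Lemma size_phi (R : nzRingType) d : (size (phi R d) <= d.+1)%N.
Proof.
suff [] : (size (phi R d) <= d.+1)%N /\ (size (phi R d.+1) <= d.+2)%N by [].
elim: d => [|d [IH1 IH2]].
  have [-> -> _] := phi_rec R 0; split; first by rewrite size_polyC; case: eqP.
  by rewrite size_polyX.
split => //; have [_ _ ->] := phi_rec R d.
rewrite (leq_trans (size_polyD _ _)) // geq_max size_polyN.
apply/andP; split; last by rewrite (leq_trans IH1) // leqW.
by rewrite (leq_trans (size_polyMleq _ _)) // size_polyX.
Qed.

Lemma horner_phi (F : fieldType) d (t : F) : t != 0 ->
  (phi F d).[t + t^-1] = t ^+ d + t ^- d.
Proof.
move=> t0; suff [] : (phi F d).[t + t^-1] = t ^+ d + t ^- d /\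
  (phi F d.+1).[t + t^-1] = t ^+ d.+1 + t ^- d.+1 by [].
elim: d => [|d [IH1 IH2]].
  have [-> -> _] := phi_rec F 0; split; last by rewrite hornerX !expr1.
  by rewrite hornerC !expr0 invr1.
split => //; have [_ _ e] := chebyshev_rec d.
by rewrite /phi e; exact: chebyshev_step t0 IH1 IH2.
Qed.

Section PointCount.

Variables (F : finFieldType) (g : F) (d : nat).
Local Notation N := (#|F|.-1).
Hypothesis prim_g : N.-primitive_root g.
Hypothesis odd_card : odd #|F|.
Hypothesis odd_d : odd d.
Local Notation chi := (chi g).
Local Notation gen := (genusH d).
Local Notation f := (phi F d).

Lemma genusE : (2 * gen + 2 = d.+1)%N.
Proof. by rewrite /genusH; clear -odd_d; lia. Qed.

Lemma genus_double : (2 * gen = d.-1)%N.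
Proof. by rewrite /genusH; clear -odd_d; lia. Qed.

Lemma hyper_formZ c X Z : hyper_form gen f (c * X) (c * Z) = c ^+ d.+1 * hyper_form gen f X Z.
Proof.
rewrite /hyper_form genusE mulr_sumr; apply: eq_bigr => i _.
rewrite !exprMn -[X in c ^+ X * _](subnKC (_ : i <= d.+1)%N) ?exprD; last by rewrite -ltnS.
by ring.
Qed.

Lemma hyper_form1 x : hyper_form gen f x 1 = f.[x].
Proof.
rewrite /hyper_form genusE (@horner_coef_wide _ d.+2) ?(leq_trans (size_phi _ _)) //.
by apply: eq_bigr => i _; rewrite expr1n mulr1.
Qed.

Lemma hyper_form0 X : hyper_form gen f X 0 = 0.
Proof.
rewrite /hyper_form genusE big1 // => i _; rewrite expr0n subn_eq0.
have [le|_] := leqP d.+1 i; rewrite ?mulr0 //.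
by rewrite nth_default ?mul0r ?mul0r // (leq_trans (size_phi _ _)).
Qed.

Lemma weighted_eq_equiv : {in hyper_cone gen f & &, equivalence_rel (@weighted_eq F gen)}.
Proof.
move=> [[X1 Y1] Z1] [[X2 Y2] Z2] [[X3 Y3] Z3] _ _ _; split.
  by apply/existsP; exists 1; rewrite oner_neq0 expr1n !mul1r eqxx.
move=> /existsP[a /andP[a0 /eqP[-> -> ->]]]; apply/existsP/existsP => -[b /andP[b0 /eqP[-> -> ->]]].
  exists (b / a); rewrite mulf_neq0 ?invr_eq0 // expr_div_n !mulrA.
  by rewrite !divfK ?expf_neq0 // eqxx.
exists (b * a); rewrite mulf_neq0 // exprMn !mulrA eqxx //.
Qed.

Lemma card_class A : A \in hyper_points gen f -> #|A| = N.
Proof.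
move=> /imsetP[[[X Y] Z]]; rewrite inE => /andP[XZ0 /eqP eqY] ->.
pose h (c : F) := (c * X, c ^+ gen.+1 * Y, c * Z).
rewrite -(cardC1 (0 : F)) -(card_in_imset (f := h) (D := predC1 0)).
  apply: eq_card => -[[X' Y'] Z']; rewrite !inE; apply/andP/imsetP.
    by move=> [_ /existsP[c /andP[c0 /eqP e]]]; exists c.
  move=> [c]; rewrite inE => c0 [-> -> ->]; split; last by apply/existsP; exists c; rewrite eqxx c0.
  rewrite hyper_formZ -eqY exprMn -exprM muln2 doubleS -mul2n -addn2 genusE eqxx andbT.
  by apply: contraNneq XZ0 => -[/eqP + /eqP]; rewrite !mulf_eq0 (negPf c0) => /eqP-> /eqP->.
move=> a b a0 b0 [eX _ eZ]; apply/eqP; apply: contraNT XZ0 => ab.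
have ab0 : a - b != 0 by rewrite subr_eq0.
have X0 : X = 0 by apply: (mulfI ab0); rewrite mulr0 mulrBl eX subrr.
have Z0 : Z = 0 by apply: (mulfI ab0); rewrite mulr0 mulrBl eZ subrr.
by rewrite X0 Z0 eqxx.
Qed.

(** Points with Z = 0 form one class, as the form of even degree d + 1 has no term
    X^(d+1); the others are scaled to Z = 1. *)
Lemma card_cone : (#|hyper_cone gen f|)%:R = N%:R * (#|F|%:R + 1 + \sum_x chi f.[x]) :> algC.
Proof.
have cardY a : \sum_(Y | Y ^+ 2 == a) 1 = 1 + chi a.
  rewrite -card_sqrt // sumr_const; congr (_ *+ _).
  by apply: eq_card => y; rewrite !inE.
have NE : N%:R = \sum_(c : F | c != 0) 1 :> algC.
  by rewrite -[RHS]/(\sum_(c in predC1 0) 1) sumr_const cardC1.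
transitivity (\sum_(V : F * F | V != (0, 0)) (1 + chi (hyper_form gen f V.1 V.2))).
  rewrite -sum1_card natr_sum /=.
  rewrite (eq_bigr (fun=> 1)) //.
  under [RHS]eq_bigr => V _ do rewrite -cardY.
  rewrite [RHS]pair_big_dep (reindex (fun T : F * F * F => ((T.1.1, T.2), T.1.2))) /=; last first.
    by exists (fun T : F * F * F => ((T.1.1, T.2), T.1.2)) => -[[? ?] ?].
  by apply: eq_bigl => -[[X Y] Z]; rewrite inE.
rewrite (bigID (fun V : F * F => V.2 == 0)) /=.
have -> : \sum_(V : F * F | (V != (0, 0)) && (V.2 == 0)) (1 + chi (hyper_form gen f V.1 V.2)) = N%:R.
  rewrite NE (reindex_onto (fun X : F => (X, 0 : F)) (fun V => V.1)) /=.
    by apply: eq_big => X; rewrite ?hyper_form0 ?chi0 ?addr0 // !eqxx !andbT xpair_eqE eqxx andbT.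
  by move=> [X Z] /= /andP[_ /eqP->].
have -> : \sum_(V : F * F | (V != (0, 0)) && (V.2 != 0)) (1 + chi (hyper_form gen f V.1 V.2))
        = \sum_(P : F * F | P.2 != 0) (1 + chi f.[P.1]).
  rewrite [LHS](reindex_onto (fun P : F * F => (P.2 * P.1, P.2)) (fun V => (V.1 / V.2, V.2))) /=.
    apply: eq_big => -[x c] /=; have [->|c0] := eqVneq c 0; rewrite ?andbF //.
      by rewrite mulrC mulfK // eqxx xpair_eqE (negPf c0) andbF.
    have := hyper_formZ c x 1; rewrite mulr1 => -> _.
    rewrite hyper_form1 chiM // chiX //.
    by rewrite [X in _ ^+ X](_ : d.+1 = 2 * (d.+1)./2)%N ?exprM ?chi_sq ?expr1n ?mul1r //; lia.
  move=> [X Z] /= /andP[_ Z0]; congr (_, _); rewrite mulrC divfK //.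
rewrite -(pair_big_dep predT (fun _ c => c != 0) (fun x _ => 1 + chi f.[x])) /=.
under eq_bigr => x _.
  rewrite (_ : \sum_(j | j != 0) _ = N%:R * (1 + chi f.[x])); first over.
  by rewrite NE mulr_suml; apply: eq_bigr => *; rewrite mul1r.
have e1 : \sum_(x : F) 1 = #|F|%:R :> algC by rewrite sumr_const.
by rewrite -mulr_sumr big_split /= e1; ring.
Qed.

(** The classes of the cone under scaling all have N elements. *)
Lemma card_points : (#|pointsH d F|)%:R = #|F|%:R + 1 + \sum_x chi f.[x] :> algC.
Proof.
have := card_uniform_partition card_class (equivalence_partitionP weighted_eq_equiv).
move/(congr1 (fun n => n%:R : algC)); rewrite card_cone natrM mulrC => e.
have N0 : N%:R != 0 :> algC by rewrite pnatr_eq0 -lt0n N_gt0.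
by apply: (mulIf N0); rewrite e mulrC.
Qed.

End PointCount.

(** * Real Jacobi sums and their signs *)

(** Congruences modulo a prime l are written with an explicit quotient in the
    ring of algebraic integers. *)
Lemma Aint_frobenius2 l (a b : algC) : prime l -> a \in Aint -> b \in Aint ->
  exists2 c, c \in Aint & (a + b) ^+ l = a ^+ l + b ^+ l + l%:R * c.
Proof.
move=> pl Aa Ab; have l0 := prime_gt0 pl.
exists (\sum_(1 <= i < l) a ^+ (l - i) * b ^+ i *+ ('C(l, i) %/ l)).
  by rewrite rpred_sum // => i _; rewrite rpredMn // rpredM ?rpredX.
rewrite exprDn -(big_mkord xpredT (fun i => a ^+ (l - i) * b ^+ i *+ 'C(l, i))).
rewrite big_nat_recr // big_ltn //= subn0 subnn bin0 binn !expr0 mulr1 mul1r !mulr1n.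
rewrite addrAC; congr (_ + _).
rewrite mulr_sumr big_nat_cond [RHS]big_nat_cond; apply: eq_bigr => i.
rewrite andbT => /andP[i0 il]; rewrite mulr_natl -mulrnA divnK //.
by rewrite prime_dvd_bin // i0.
Qed.

Lemma Aint_frobenius (I : Type) (r : seq I) (F : I -> algC) l :
    prime l -> (forall i, F i \in Aint) ->
  exists2 c, c \in Aint & (\sum_(i <- r) F i) ^+ l = \sum_(i <- r) F i ^+ l + l%:R * c.
Proof.
move=> pl AF; elim: r => [|i r [c Ac IH]].
  by exists 0; rewrite ?rpred0 // !big_nil expr0n eqn0Ngt prime_gt0 // mulr0 addr0.
have As : \sum_(j <- r) F j \in Aint by rewrite rpred_sum.
have [c' Ac' e] := Aint_frobenius2 pl (AF i) As.
exists (c + c'); first exact: rpredD.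
by rewrite !big_cons e IH; ring.
Qed.

Section RealJacobi.

Variables (F : finFieldType) (g : F) (p n : nat).
Local Notation N := (#|F|.-1).
Local Notation q := (p ^ n)%N.
Hypothesis prim_g : N.-primitive_root g.
Hypotheses (pr_p : prime p) (p_mod4 : p = 3 %[mod 4]) (card_F : #|F| = (q ^ 2)%N).
Local Notation chi := (chi g).
Local Notation Jsum := (Jsum g).

Lemma p_odd : odd p. Proof. by clear -p_mod4; lia. Qed.
Lemma q_odd : odd q. Proof. by rewrite oddX p_odd orbT. Qed.
Lemma F_odd : odd #|F|. Proof. by rewrite card_F oddX q_odd. Qed.
Lemma pchar_F : p \in [pchar F].
Proof. by apply: (@card_finPcharP _ _ (n * 2)) => //; rewrite card_F expnM. Qed.

Lemma q_gt1 : (1 < q)%N.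
Proof. by have := finNzRing_gt1 F; rewrite card_F; case: (q) => [|[]]. Qed.

Lemma N_mod8 : (8 %| N)%N.
Proof.
rewrite card_F -subn1 -(exp1n 2) subn_sqr.
have := q_odd; have := q_gt1; move: (q) => r r1 ro.
have [k [-> k0]] : exists k, (r = k.*2.+1)%N /\ (0 < k)%N by exists r./2; clear -ro r1; lia.
rewrite subn1 addn1 /= -doubleS -!muln2 mulnACA (@dvdn_pmul2r 4 2) //.
by rewrite dvdn2 oddM /=; case: (odd k).
Qed.

(** 2 is in the field with q elements, and these are squares in F. *)
Lemma chi_two : chi 2 = 1.
Proof.
have n2 : (2 : F) != 0.
  rewrite -(dvdn_pcharf pchar_F) gtnNdvd //; move: p_odd (prime_gt1 pr_p).
  by case: (p) => [|[|[|]]].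
have q0 := ltnW q_gt1.
have fr : (2 : F) ^+ q = 2.
  elim: (n) => [|k IH]; first by rewrite expr1.
  by rewrite expnSr exprM IH -(pFrobenius_autE pchar_F) pFrobenius_aut_nat.
have e1 : (2 : F) ^+ q.-1 = 1.
  by apply: (mulfI n2); rewrite -exprS mulr1 prednK.
have [_] := dlogP prim_g n2; set a := dlog g 2 => ga.
rewrite -ga /chi mcharX ?signN ?F_odd //.
have : (N %| a * (N./2))%N.
  rewrite (prim_order_dvd prim_g) exprM ga.
  have -> : (N./2 = q.-1 * (q.+1)./2)%N.
    rewrite card_F -subn1 -(exp1n 2) subn_sqr subn1 addn1 -divn2 -muln_divA ?divn2 //.
    by rewrite dvdn2 /= q_odd.
  by rewrite exprM e1 expr1n.
have N0 := N_gt0 F; have e : (N./2 * 2 = N)%N.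
  by rewrite muln2 even_halfK //; have := N_mod8; lia.
rewrite -{1}e [(N./2 * 2)%N]mulnC dvdn_pmul2r; last by rewrite half_gt0; lia.
by rewrite dvdn2 -signr_odd => /negPf->.
Qed.

Lemma iN : ('i : algC) ^+ N = 1.
Proof.
have /dvdnP[k ->] := N_mod8.
by rewrite (_ : k * 8 = 2 * (2 * (k * 2)))%N ?exprM ?sqrCi ?sqrrN ?expr1n //; clear; lia.
Qed.

Lemma Jsum_real w : w ^+ N = 1 -> w != 1 -> w != -1 -> (Jsum w)^* = Jsum w ->
  Jsum w = q%:R \/ Jsum w = - q%:R.
Proof.
move=> wN w1 wm1 cw; have := Jsum_norm prim_g F_odd wN w1 wm1.
by rewrite normCK cw -expr2 card_F natrX => /eqP; rewrite eqf_sqr => /orP[] /eqP; [left|right].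
Qed.

Lemma exprCi_mod4 k : k = 3 %[mod 4] -> ('i : algC) ^+ k = - 'i.
Proof.
move=> e; rewrite (divn_eq k 4) e mulnC exprD exprM.
have -> : ('i : algC) ^+ 4 = 1 by rewrite -[4%N]/(2 * 2)%N exprM sqrCi sqrrN expr1n.
by rewrite expr1n mul1r exprS sqrCi mulrN1.
Qed.

(** p is 3 modulo 4, so Frobenius exchanges i and - i. *)
Lemma JsumNi : Jsum (- 'i) = Jsum 'i.
Proof.
by rewrite -(exprCi_mod4 p_mod4) -[in LHS](expn1 p) Jsum_frob ?F_odd ?pchar_F ?p_odd ?iN.
Qed.

(** J(i) is half of J(i) + J(-i), in which only the even powers of g survive.  The
    remaining terms are signs that are symmetric around the middle of the range,
    where the term is 0; the term at the origin is chi (2) = 1. *)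
Lemma Jsum_i_mod4 : exists z : int, Jsum 'i = (4 * z - 1)%:~R.
Proof.
have /dvdnP[k kN] := N_mod8; set h := (2 * k)%N.
have N0 := N_gt0 F.
pose f b : algC := (-1) ^+ b * chi (1 + g ^+ (2 * b)).
have Jf : Jsum 'i = \sum_(b < h.*2) f b.
  apply: (@mulfI _ 2); first by rewrite pnatr_eq0.
  have -> : 2 * Jsum 'i = Jsum 'i + Jsum (- 'i) by rewrite JsumNi mulr_natl mulr2n.
  have NiN : (- 'i : algC) ^+ N = 1 by rewrite -[- 'i]mulN1r exprMn iN signN ?F_odd ?mulr1.
  rewrite /Jsum -big_split /= (sum_prim prim_g) !mchar0 !mul0r addr0 add0r.
  under [LHS]eq_bigr => a _ do rewrite !mcharX ?iN //.
  rewrite (_ : N = (h.*2).*2)%N; last by rewrite kN /h; lia.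
  rewrite -(big_mkord xpredT (fun a => 'i ^+ a * chi (1 + g ^+ a) + (- 'i) ^+ a * chi (1 + g ^+ a))).
  have -> : forall (u : nat -> algC) c, \sum_(0 <= a < c.*2) u a = \sum_(b < c) (u b.*2 + u b.*2.+1).
    move=> u; elim=> [|c IH]; first by rewrite big_ord0 big_geq.
    by rewrite doubleS !big_nat_recr // IH big_ord_recr /= addrA.
  rewrite mulr_sumr; apply: eq_bigr => b _.
  rewrite -mul2n !(exprS _ (2 * b)) ![_ ^+ (2 * b)]exprM sqrrN sqrCi /f -exprM; ring.
pose w b : int := if odd (b + dlog g (1 + g ^+ (2 * b))) then 1 else 0.
have fpm b : (b < h)%N -> f b = 1 - 2 * (w b)%:~R.
  move=> bh; have nz : 1 + g ^+ (2 * b) != 0.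
    apply/eqP => /eqP; rewrite addrC addr_eq0 => /eqP gb.
    have /eqP : g ^+ (2 * b * 2) = 1 by rewrite exprM gb sqrrN expr1n.
    rewrite -(prim_order_dvd prim_g) => /dvdnP[c]; rewrite kN => e.
    have : g ^+ 0 = -1.
      rewrite -gb; congr (_ ^+ _); rewrite /h in bh.
      by case: c e => [|c] e; [lia|rewrite mulSn in e; lia].
    move/eqP; rewrite expr0 -subr_eq0 opprK.
    have := chi_two; rewrite -[2]/(1 + 1); case: eqP => // ->.
    by rewrite chi0 => /eqP; rewrite eq_sym oner_eq0.
  rewrite /f chi_sgn ?F_odd // -signr_odd -signr_addb -oddD /w.
  by case: odd; rewrite ?expr1 ?expr0; ring.
have fsym b : (b <= h.*2)%N -> f (h.*2 - b)%N = f b.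
  move=> bh; rewrite /f -!(signr_odd _ (h.*2 - b)) oddB // odd_double /= signr_odd; congr (_ * _).
  have -> : g ^+ (2 * (h.*2 - b)) = (g ^+ (2 * b))^-1.
    have g0 := prim_neq0 prim_g.
    apply: (mulIf (expf_neq0 (2 * b) g0)); rewrite mulVf ?expf_neq0 // -exprD.
    by rewrite -(prim_expr_order prim_g); congr (_ ^+ _); rewrite kN /h; lia.
  have gb0 : g ^+ (2 * b) != 0 by rewrite expf_neq0 // prim_neq0.
  have -> : 1 + (g ^+ (2 * b))^-1 = (1 + g ^+ (2 * b)) / g ^+ (2 * b) by field.
  rewrite chiM ?F_odd // chiV ?F_odd // [(2 * b)%N]mulnC exprM.
  by rewrite chi_sqr ?F_odd ?mulr1 // expf_neq0 // prim_neq0.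
have fh : f h = 0.
  have : (g ^+ (2 * h)) ^+ 2 = 1 ^+ 2.
    by rewrite -exprM expr1n -(prim_expr_order prim_g) kN; congr (_ ^+ _); rewrite /h; lia.
  move/eqP; rewrite eqf_sqr => /orP[|/eqP e]; last by rewrite /f e subrr chi0 mulr0.
  rewrite -(prim_order_dvd prim_g) gtnNdvd //; rewrite ?kN /h; lia.
have h0 : (0 < h)%N by rewrite /h; lia.
have f0 : f 0 = 1 by rewrite /f expr0 mul1r muln0 expr0 -[1 + 1]/(2 : F) chi_two.
have halves : \sum_(0 <= b < h.*2) f b = 1 + 2 * \sum_(1 <= b < h) f b.
  rewrite (big_cat_nat _ _ (n := h)) //=; last by lia.
  rewrite (big_ltn h0) f0 -addrA; congr (_ + _).
  rewrite [X in _ + X](_ : _ = \sum_(1 <= b < h) f b); first by ring.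
  rewrite big_ltn ?fh ?add0r; last by lia.
  rewrite big_nat_rev /= -[h.+1]add1n big_addn; have -> : (h.*2 - h = h)%N by lia.
  rewrite big_nat_cond [RHS]big_nat_cond; apply: eq_bigr => b; rewrite andbT => /andP[_ bh].
  by rewrite -(fsym b); [congr f; lia|lia].
rewrite Jf -(big_mkord xpredT f) halves.
have -> : \sum_(1 <= b < h) f b = (\sum_(1 <= b < h) (1 - 2 * w b))%:~R.
  rewrite rmorph_sum [LHS]big_nat_cond [RHS]big_nat_cond; apply: eq_bigr => b.
  by rewrite andbT => /andP[_ bh]; rewrite fpm // rmorphB rmorphM.
rewrite sumrB sumr_const_nat -mulr_sumr.
exists (k%:Z - \sum_(1 <= b < h) w b).
set W := \sum_(1 <= b < h) w b.
transitivity ((1 + 2 * (1 *+ (h - 1) - 2 * W))%:~R : algC); first by rewrite [RHS]intrD [X in _ = _ + X]intrM.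
by congr (_%:~R); rewrite natz /h; lia.
Qed.

Lemma Jsum_i_pm : Jsum 'i = q%:R \/ Jsum 'i = - q%:R.
Proof.
have i1 (e : algC) : e ^+ 2 = 1 -> ('i : algC) != e.
  by move=> e2; apply: contraTneq neg1_neq1 => ie; rewrite -sqrCi ie e2 eqxx.
apply: Jsum_real; rewrite ?iN ?i1 ?sqrrN ?expr1n //.
by rewrite Jsum_conj ?F_odd ?iN // invCi JsumNi.
Qed.

Lemma Jsum_i_sign : (Jsum 'i == q%:R) = (q == 3 %[mod 4]).
Proof.
have [z ez] := Jsum_i_mod4; have qo := q_odd; have q1 := q_gt1.
case: Jsum_i_pm => e; rewrite e; move: e; rewrite ez.
  rewrite eqxx -[q%:R]/((q%:Z)%:~R) => /intr_inj e; symmetry.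
  by move: (q) e qo => r e ro; lia.
rewrite -[q%:R]/((q%:Z)%:~R) -rmorphN => /intr_inj e.
rewrite (inj_eq intr_inj); move: (q) e q1 qo => r e r1 ro.
by apply/idP/idP; lia.
Qed.

(** Since J(w)^l is congruent to J(w^l) modulo l and q^l to q, opposite signs would
    make 2 q divisible by l. *)
Lemma Jsum_prime_power l w : prime l -> odd l -> ~~ (l %| q)%N -> w ^+ N = 1 ->
    Jsum w = q%:R \/ Jsum w = - q%:R ->
    Jsum (w ^+ l) = q%:R \/ Jsum (w ^+ l) = - q%:R ->
  Jsum (w ^+ l) = Jsum w.
Proof.
move=> pl ol lq wN Jw Jwl.
have [c Ac e] : exists2 c, c \in Aint & Jsum w ^+ l = Jsum (w ^+ l) + l%:R * c.
  have Amchar z s : z ^+ N = 1 -> mchar g z s \in Aint.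
    move=> zN; rewrite /mchar; case: ifP => _; rewrite ?rpred0 // rpredX //.
    by apply: (@Aint_unity_root N); rewrite ?N_gt0 //; apply/unity_rootP.
  have [s|c Ac ->] := @Aint_frobenius _ (index_enum F) (fun s => mchar g w s * chi (1 + s)) l pl.
    by rewrite rpredM ?Amchar ?signN ?F_odd.
  exists c => //; congr (_ + _); apply: eq_bigr => s _.
  rewrite exprMn -(prednK (prime_gt0 pl)) -mcharXl -chiX ?F_odd // prednK ?prime_gt0 //.
  by rewrite chi_odd ?F_odd.
have [c' Ac' e'] := @Aint_frobenius _ (iota 0 q) (fun=> 1) l pl (fun=> rpred1 _).
move: e'; under [in RHS]eq_bigr do rewrite expr1n.
rewrite big_const_seq count_predT size_iota iter_addr addr0 => e'.
have l0 : l%:R != 0 :> algC by rewrite pnatr_eq0 -lt0n prime_gt0.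
suff no c2 : c2 \in Aint -> 2 * q%:R = l%:R * c2 -> False.
  have nl x : (- x) ^+ l = - x ^+ l :> algC by rewrite exprNn -signr_odd ol mulN1r.
  case: Jw Jwl => [] Jw [] Jwl; rewrite Jw Jwl // in e *.
    case: (no (c - c')); rewrite ?rpredB //.
    apply: (@addIr _ (l%:R * c' - q%:R)); transitivity (q%:R + l%:R * c'); first by ring.
    by rewrite -e' e; ring.
  case: (no (- c - c')); rewrite ?rpredB ?rpredN //.
  apply: (@addIr _ (l%:R * c' - q%:R)); transitivity (q%:R + l%:R * c'); first by ring.
  by rewrite -e' -[LHS]opprK -nl e; ring.
move=> Ac2 e2; have : (l %| 2 * q)%N.
  have e3 : (2 * q)%:R = l%:R * c2 :> algC by rewrite natrM.
  rewrite -eqAmod0_nat eqAmod0 unfold_in /= (negPf l0) [X in X / _]e3.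
  by rewrite mulrC mulKf.
rewrite Euclid_dvdM // (negPf lq) orbF => /dvdn_leq; move: ol (prime_gt1 pl).
by case: (l) => [|[|[|k]]] // _ _ /(_ isT).
Qed.

End RealJacobi.

(** * The point count as a sum of Jacobi and Eisenstein sums *)

Lemma sum_unity_half (N : nat) : (0 < N)%N ->
  \sum_(w <- unity_roots (2 * N) | w ^+ N == -1) 1 = N%:R :> algC.
Proof.
move=> N0; have N20 : (0 < 2 * N)%N by rewrite muln_gt0.
have total M : \sum_(w <- unity_roots M) 1 = M%:R :> algC.
  by rewrite big_const_seq count_predT size_map size_iota iter_addr addr0.
have := total (2 * N)%N; rewrite (bigID (fun w => w ^+ N == 1)) /=.
rewrite (big_unity_roots (M := N)) //; last by move=> z /eqP.
have -> : \sum_(w <- unity_roots N | (w ^+ N == 1) && (w ^+ (2 * N) == 1)) 1 = N%:R :> algC.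
  rewrite -[RHS]total big_mkcond /= [LHS]big_seq [RHS]big_seq; apply: eq_bigr => w.
  by rewrite mem_unity_roots // => /eqP wN; rewrite mulnC exprM wN expr1n eqxx.
have -> : \sum_(w <- unity_roots (2 * N) | w ^+ N != 1) 1 =
          \sum_(w <- unity_roots (2 * N) | w ^+ N == -1) 1 :> algC.
  rewrite big_mkcond [RHS]big_mkcond [LHS]big_seq [RHS]big_seq; apply: eq_bigr => w.
  rewrite mem_unity_roots // mulnC exprM sqrf_eq1 => /orP[] /eqP ->.
    by rewrite eqxx eq_sym (negPf neg1_neq1).
  by rewrite eqxx neg1_neq1.
by rewrite natrM mulr_natl mulr2n => /addrI.
Qed.

(** Equality in the triangle inequality. *)
Lemma normC_sum_upper_seq (I : eqType) (r : seq I) (P : pred I) (f : I -> algC) (b : algC) :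
    (forall i, P i -> `|f i| <= b) ->
    \sum_(i <- r | P i) f i = \sum_(i <- r | P i) b ->
  forall i, i \in r -> P i -> f i = b.
Proof.
move=> fb; rewrite !(big_tnth _ _ r) => e i ir Pi.
have Pt j : P (tnth (in_tuple r) j) -> `|f (tnth (in_tuple r) j)| <= b by exact: fb.
have /tnthP[j ij] : i \in in_tuple r by [].
by rewrite ij; apply: (normC_sum_upper Pt e); rewrite -ij.
Qed.

Section Curve.

Variables (F E : finFieldType) (iota : {rmorphism F -> E}) (g : F) (G : E) (p n d : nat).
Local Notation Q := #|F|.
Local Notation N := (#|F|.-1).
Local Notation M := (#|E|.-1).
Local Notation q := (p ^ n)%N.
Hypothesis prim_G : M.-primitive_root G.
Hypothesis card_E : #|E| = (Q ^ 2)%N.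
Hypothesis iota_g : iota g = G ^+ Q.+1.
Hypotheses (pr_p : prime p) (p_mod4 : p = 3 %[mod 4]) (card_F : Q = (q ^ 2)%N).
Hypothesis odd_d : odd d.
Local Notation chi := (chi g).
Local Notation Jsum := (Jsum g).
Local Notation Esum := (Esum iota G).

Let card_F' : Q = (p ^ (n * 2))%N. Proof. by rewrite card_F expnM. Qed.
Let odd_p : odd p. Proof. exact: p_odd p_mod4. Qed.
Let pg : N.-primitive_root g. Proof. exact: (prim_g prim_G card_E iota_g). Qed.
Let oF : odd #|F|. Proof. exact: F_odd p_mod4 card_F. Qed.

(** The contribution of the root w to the point count; for w^2 different from -1
    at most one of the two sums is present. *)
Definition term (w : algC) : algC :=
  (if w ^+ N == 1 then Jsum w else 0) + (if w ^+ Q.+1 == -1 then Esum w else 0).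

Lemma M_gt0 : (0 < M)%N. Proof. exact: N_gt0. Qed.

Lemma sum_term k : odd k ->
  2 * \sum_x chi (phi F k).[x] = \sum_(w <- unity_roots (4 * k) | w ^+ (2 * k) == -1) term w.
Proof.
move=> ok; have N0 := N_gt0 F; have k0 : (0 < 4 * k)%N by case: k ok.
have w4 (w : algC) : w ^+ (2 * k) == -1 -> w ^+ (4 * k) = 1.
  by move=> /eqP e; rewrite -[4%N]/(2 * 2)%N -mulnA mulnC exprM e sqrrN expr1n.
rewrite (sum_tori prim_G card_E iota_g pr_p odd_p card_F').
rewrite big_split /=; congr (_ + _).
  under eq_bigr => t t0 do rewrite horner_phi //.
  by rewrite sum_chi_split // (big_unity_roots _ k0 N0 w4) big_mkcondr.
have phit (t : E) : t ^+ Q.+1 == 1 -> (phi F k).[tr iota t] = tr iota (t ^+ k).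
  move=> /eqP t1; have t0 : t != 0.
    by apply/eqP => t0; move/eqP: t1; rewrite t0 expr0n eq_sym oner_eq0.
  apply: (fmorph_inj iota); rewrite -horner_map /= !(trE prim_G card_E iota_g pr_p card_F').
  have tQ : t ^+ Q = t^-1 by apply: (mulfI t0); rewrite -exprS t1 divff.
  rewrite (_ : map_poly iota (phi F k) = phi E k); last first.
    by rewrite /phi -map_poly_comp; apply: eq_map_poly => z /=; rewrite rmorph_int.
  by rewrite [(t ^+ k) ^+ Q]exprAC tQ exprVn horner_phi.
under eq_bigr => t t1 do rewrite phit //.
rewrite (sum_chi_nonsplit prim_G card_E iota_g pr_p odd_p card_F' ok).
rewrite (big_unity_roots _ k0 M_gt0) => [|z /andP[/w4 //]].
rewrite -big_mkcondr; apply: eq_bigl => w; case: eqP => //= _; case: eqP => //= wQ.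
by rewrite (unityNM card_E odd_p card_F' wQ) eqxx.
Qed.

(** This is the point count for the polynomial phi_1 = X. *)
Lemma sum_term_i : \sum_(w <- unity_roots (4 * d) | w ^+ 2 == -1) term w = 0.
Proof.
have e : phi F 1 = 'X by have [] := phi_rec F 0.
have d0 : (0 < 4 * d)%N by case: d odd_d.
have w4 (w : algC) : w ^+ 2 == -1 -> w ^+ 4 = 1.
  by move=> /eqP w2; rewrite -[4%N]/(2 * 2)%N exprM w2 sqrrN expr1n.
have s0 : \sum_(x : F) chi x = 0.
  by rewrite sum_mchar ?signN // neg1_neq1.
transitivity (\sum_(w <- unity_roots (4 * 1) | w ^+ (2 * 1) == -1) term w).
  rewrite (big_unity_roots _ (isT : 0 < 4)%N d0 w4); apply: eq_bigl => w.
  case: eqP => //= w2; apply/eqP.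
  by rewrite exprM (w4 w) ?expr1n // w2.
rewrite -sum_term //; under eq_bigr do rewrite e hornerX.
by rewrite s0 mulr0.
Qed.

Lemma sum_phi_term :
  2 * \sum_x chi (phi F d).[x] =
  \sum_(w <- unity_roots (4 * d) | (w ^+ (2 * d) == -1) && (w ^+ 2 != -1)) term w.
Proof.
rewrite sum_term // (bigID (fun w => w ^+ 2 == -1)) /=.
rewrite [X in X + _](_ : _ = 0) ?add0r //.
rewrite -[RHS]sum_term_i; apply: eq_bigl => w.
have [w2|_] := eqVneq (w ^+ 2) (-1); rewrite ?andbT ?andbF //.
by rewrite exprM w2 -signr_odd odd_d eqxx.
Qed.

Lemma term_norm w : w ^+ 2 != -1 -> w ^+ (2 * d) = -1 -> `|term w| <= q%:R.
Proof.
move=> w2 wd; have q0 : 0 <= q%:R :> algC by rewrite ler0n.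
have sq x : `|x| ^+ 2 = Q%:R :> algC -> `|x| <= q%:R.
  rewrite card_F natrX => /eqP; rewrite eqrXn2 ?normr_ge0 // => /eqP->.
  exact: lexx.
have w1 : w != 1 by apply: contra_eqN wd => /eqP->; rewrite expr1n eq_sym neg1_neq1.
have wm1 : w != -1.
  by apply: contra_eqN wd => /eqP->; rewrite exprM sqrrN !expr1n eq_sym neg1_neq1.
rewrite /term; case: eqP => [wN|_]; case: eqP => [wQ|_].
- case/eqP: w2; have QN : Q.+1 = N.+2 by rewrite prednK // ltnW ?finNzRing_gt1.
  rewrite -wQ QN.
  by rewrite -[N.+2]/(2 + N)%N exprD wN mulr1.
- by rewrite addr0 sq // (Jsum_norm pg oF).
- by rewrite add0r sq // (Esum_norm prim_G card_E iota_g pr_p odd_p card_F').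
by rewrite addr0 normr0.
Qed.

Lemma count_terms :
  \sum_(w <- unity_roots (4 * d) | (w ^+ (2 * d) == -1) && (w ^+ 2 != -1)) q%:R
  = (2 * ((d - 1) * q))%:R :> algC.
Proof.
have d0 : (0 < d)%N by case: d odd_d.
have e1 := sum_unity_half (_ : 0 < 2 * d)%N; rewrite mulnA in e1.
have := e1 _; rewrite muln_gt0 d0 => /(_ isT); rewrite (bigID (fun w => w ^+ 2 == -1)) /=.
have -> : \sum_(w <- unity_roots (4 * d) | (w ^+ (2 * d) == -1) && (w ^+ 2 == -1)) 1 = 2 :> algC.
  rewrite -[RHS](@sum_unity_half 2) // [RHS](big_unity_roots (M := 4 * d)) ?muln_gt0 ?d0 //.
    rewrite big_mkcond [RHS]big_mkcond [LHS]big_seq [RHS]big_seq; apply: eq_bigr => w.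
    rewrite mem_unity_roots ?muln_gt0 ?d0 // => /eqP w4d.
    have [w2|_] := eqVneq (w ^+ 2) (-1); rewrite ?andbF //.
    rewrite exprM w2 -signr_odd odd_d eqxx /= (_ : w ^+ (2 * 2) = 1) ?eqxx //.
    by rewrite exprM w2 sqrrN expr1n.
  move=> z /eqP z2; rewrite -[4%N]/(2 * 2)%N -mulnA exprM z2 exprM sqrrN !expr1n //.
move=> e; rewrite (eq_bigr (fun=> q%:R * 1)) => [|w _]; last by rewrite mulr1.
rewrite -mulr_sumr (_ : \sum_(w <- _ | _) 1 = (2 * (d - 1))%:R); first by rewrite -natrM; congr _%:R; lia.
by apply: (@addrI _ 2); rewrite e -natrD; congr _%:R; lia.
Qed.

(** There are 2 (d - 1) terms, each at most q in absolute value, and maximality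
    requires the largest possible sum. *)
Lemma maximal_terms : maximalH d q F <->
  (forall w : algC, w ^+ (2 * d) = -1 -> w ^+ 2 != -1 -> term w = q%:R).
Proof.
have d0 : (0 < 4 * d)%N by case: d odd_d.
have pts := card_points pg oF odd_d; have gd := genus_double odd_d.
have eqS : maximalH d q F <-> 2 * \sum_x chi (phi F d).[x] = (2 * ((d - 1) * q))%:R.
  split=> [[_ e]|e].
    move: pts; rewrite e gd card_F 2!natrD => /addrI <-.
    by rewrite subn1 [RHS]natrM.
  split => //; apply/eqP; rewrite -(eqr_nat algC) pts gd card_F 2!natrD; apply/eqP.
  congr (_ + _); apply: (@mulfI _ 2); first by rewrite pnatr_eq0.
  by rewrite e subn1 [LHS]natrM.
rewrite eqS sum_phi_term -count_terms; split=> [e w wd w2|e].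
  apply: (normC_sum_upper_seq _ e) => [v /andP[/eqP vd v2]||]; first exact: term_norm.
    rewrite mem_unity_roots // -[4%N]/(2 * 2)%N -mulnA mulnC exprM wd sqrrN expr1n //.
  by rewrite wd eqxx.
by apply: eq_bigr => w /andP[/eqP wd w2]; exact: e.
Qed.

End Curve.

(** * Necessary and sufficient conditions in terms of Jacobi sums *)

Lemma sum_unity_half_expr (N a : nat) : (0 < N)%N ->
  \sum_(w <- unity_roots (2 * N) | w ^+ N == -1) w ^+ a =
  if (N %| a)%N then N%:R * (-1) ^+ (a %/ N) else 0 :> algC.
Proof.
move=> N0; case: ifP => [|Na].
  move=> /dvdnP[k ->]; rewrite mulnK // -sum_unity_half // mulr_suml.
  by apply: eq_bigr => w /eqP wN; rewrite mulnC exprM wN mul1r.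
have N20 : (0 < 2 * N)%N by rewrite muln_gt0.
have := sum_unity_roots a N20; rewrite ifF; last first.
  by apply: contraFF Na; apply: dvdn_trans; rewrite dvdn_mull.
rewrite (bigID (fun w => w ^+ N == -1)) /=.
have -> : \sum_(w <- unity_roots (2 * N) | w ^+ N != -1) w ^+ a = 0 :> algC; last by rewrite addr0.
rewrite -[RHS](_ : \sum_(w <- unity_roots N) w ^+ a = _); last by rewrite sum_unity_roots // Na.
transitivity (\sum_(w <- unity_roots (2 * N) | w ^+ N == 1) w ^+ a : algC).
  rewrite big_mkcond [RHS]big_mkcond [LHS]big_seq [RHS]big_seq; apply: eq_bigr => w.
  rewrite mem_unity_roots // mulnC exprM sqrf_eq1 => /orP[] /eqP ->.
    by rewrite eqxx eq_sym neg1_neq1.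
  by rewrite eqxx (negPf neg1_neq1).
rewrite (big_unity_roots (M := N)) //; last by move=> z /eqP.
rewrite big_mkcond /= [LHS]big_seq [RHS]big_seq; apply: eq_bigr => w.
by rewrite mem_unity_roots // => /eqP wN; rewrite mulnC exprM wN expr1n eqxx.
Qed.

Section NonSplit.

Variables (F E : finFieldType) (iota : {rmorphism F -> E}) (g : F) (G : E) (p n d : nat).
Local Notation Q := #|F|.
Local Notation N := (#|F|.-1).
Local Notation M := (#|E|.-1).
Local Notation q := (p ^ n)%N.
Hypothesis prim_G : M.-primitive_root G.
Hypothesis card_E : #|E| = (Q ^ 2)%N.
Hypothesis iota_g : iota g = G ^+ Q.+1.
Hypotheses (pr_p : prime p) (p_mod4 : p = 3 %[mod 4]) (card_F : Q = (q ^ 2)%N).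
Hypotheses (odd_d : odd d) (d_gt1 : (1 < d)%N).
Local Notation chi := (chi g).
Local Notation Esum := (Esum iota G).
Local Notation mcharE := (mchar G).
Local Notation tr := (tr iota).

Let card_F' : Q = (p ^ (n * 2))%N. Proof. by rewrite card_F expnM. Qed.
Let odd_p : odd p. Proof. exact: p_odd p_mod4. Qed.
Let pg : N.-primitive_root g. Proof. exact: (prim_g prim_G card_E iota_g). Qed.

Lemma pchar_E2 : p \in [pchar E].
Proof. exact: pchar_E card_E pr_p card_F'. Qed.

Lemma tr_frobp x : tr (x ^+ p) = tr x ^+ p.
Proof.
have trE := trE prim_G card_E iota_g pr_p card_F'.
apply: (fmorph_inj iota); rewrite rmorphXn !trE exprAC.
by rewrite exprDn_pchar // pnatE ?pchar_E2.
Qed.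

(** As for Jacobi sums, Frobenius exchanges i and - i. *)
Lemma EsumNi : Esum (- 'i) = Esum 'i.
Proof.
have iM : ('i : algC) ^+ M = 1.
  by rewrite (M_eq card_E) exprM (iN p_mod4 card_F) expr1n.
rewrite -(exprCi_mod4 p_mod4).
have inj : injective (fun x : E => x ^+ p) by move=> x y /(fmorph_inj (pFrobenius_aut pchar_E2)).
have inF : injective (fun x : F => x ^+ p).
  by move=> x y /(fmorph_inj (pFrobenius_aut (pchar_F pr_p card_F))).
rewrite [RHS](reindex_inj inj) /=; apply: eq_big => x.
  by rewrite tr_frobp -{2}(expr1n F p) (inj_eq inF).
by move=> _; rewrite -(prednK (prime_gt0 pr_p)) mcharXl mcharXn.
Qed.

Hypothesis div_Q1 : (2 * d %| Q.+1)%N.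

Variable b : nat.
Hypothesis odd_b : odd b.
Hypothesis b_trace0 : ~~ (2 * d %| Q.+1./2 + b)%N.

(* A class of units modulo 2 d-th powers, shifted by b so as to avoid the elements
   of trace 0, which all have logarithm (Q + 1) / 2 modulo Q + 1. *)
Let X := [pred x : E | (x != 0) && (2 * d %| dlog G x + b)%N].

Let dvd_M : (2 * d %| M)%N.
Proof. by rewrite (M_eq card_E) dvdn_mull. Qed.
Let d2_gt0 : (0 < 2 * d)%N. Proof. by rewrite muln_gt0 /= ltnW. Qed.

Lemma mem_classE x : x != 0 ->
  X x = (mcharE (prim_rootC (2 * d)) x * prim_rootC (2 * d) ^+ b == 1).
Proof.
move=> x0; rewrite /X /= x0 /= /mchar (negPf x0) -exprD.
by rewrite (prim_order_dvd (prim_rootCP d2_gt0)).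
Qed.

(** The units of F are (Q + 1)-th powers in E, hence 2 d-th powers. *)
Lemma class_scale c x : c != 0 -> X (iota c * x) = X x.
Proof.
move=> c0; have ic0 : iota c != 0 by rewrite fmorph_eq0.
have [->|x0] := eqVneq x 0; first by rewrite mulr0.
have prim := prim_rootCP d2_gt0.
have wM : prim_rootC (2 * d) ^+ M = 1 by apply/eqP; rewrite -(prim_order_dvd prim).
have wQ : prim_rootC (2 * d) ^+ Q.+1 = 1 by apply/eqP; rewrite -(prim_order_dvd prim).
rewrite !mem_classE ?mulf_neq0 // mcharM // (mchar_iota prim_G card_E iota_g) // wQ.
by rewrite mchar_trivial c0 mul1r.
Qed.

Lemma class_tr_neq0 x : X x -> tr x != 0.
Proof.
move=> /andP[x0 Xx]; apply: contra b_trace0 => /eqP /(congr1 iota).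
rewrite (trE prim_G card_E iota_g pr_p card_F') rmorph0 => /eqP.
have [_ xG] := dlogP prim_G x0.
set a := dlog G x in Xx xG.
rewrite addrC addr_eq0 => /eqP xQ.
have e1 : x ^+ N = -1.
  apply: (mulfI x0); rewrite -exprS prednK ?xQ ?mulrN1 //.
  exact: ltnW (finNzRing_gt1 F).
have oF : odd Q by exact: F_odd p_mod4 card_F.
have [h hE hQ] : exists2 h, h = Q.+1./2 & (h * 2 = Q.+1)%N.
  by exists Q.+1./2; rewrite // muln2 even_halfK //= oF.
rewrite -hE.
have N0 := N_gt0 F.
have [c ac] : exists c, a = (c * h)%N.
  have : x ^+ (N * 2) = 1 by rewrite exprM e1 sqrrN expr1n.
  move/eqP; rewrite -xG -exprM -(prim_order_dvd prim_G) (M_eq card_E).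
  rewrite mulnCA dvdn_pmul2l // => /dvdnP[c e].
  by exists c; apply/eqP; rewrite -(eqn_pmul2r (isT : 0 < 2)%N) -mulnA hQ e.
have oc : odd c.
  apply: contraT => ec; move/eqP: e1; rewrite -xG -exprM ac.
  have -> : (c * h * N = c./2 * M)%N.
    rewrite (M_eq card_E) -hQ; have := even_halfK ec; move: (c./2) => k <-; rewrite -muln2; ring.
  rewrite [(c./2 * M)%N]mulnC exprM (prim_expr_order prim_G) expr1n.
  rewrite -subr_eq0 opprK -[1 + 1]/(2 : E) -(rmorph_nat iota 2) fmorph_eq0.
  by rewrite (negPf (two_neq0 pr_p odd_p card_F')).
have eq_a : (a + b = h + b + Q.+1 * c./2)%N.
  rewrite -hQ ac; have := odd_double_half c; rewrite oc -[nat_of_bool true]/1%N; move: (c./2) => k <-.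
  by rewrite -muln2; ring.
by move: Xx; rewrite eq_a dvdn_addl // dvdn_mulr.
Qed.

(** Scaling by F* shows that the class has N times as many elements as its slice of
    trace 1. *)
Lemma card_class_tr1 : (#|[pred x | X x && (tr x == 1%R)]| * (2 * d) = Q.+1)%N.
Proof.
have N0 := N_gt0 F; have M0 := N_gt0 E.
set k := #|_|; have eM : (\sum_(x | X x) 1) * (2 * d)%:R = M%:R :> algC.
  rewrite /X big_mkcondr /= (sum_nz_prim prim_G) mulr_suml.
  transitivity (\sum_(a < M) \sum_(w <- unity_roots (2 * d)) w ^+ (a + b)).
    apply: eq_bigr => a _; rewrite sum_unity_roots //.
    have [ltM _] := dlogP prim_G (expf_neq0 a (prim_neq0 prim_G)).
    have := dlogX prim_G a; rewrite !modn_small // => ->.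
    by case: ifP => _; rewrite ?mul1r ?mul0r.
  rewrite exchange_big /= (bigD1_seq 1) ?uniq_unity_roots ?mem_unity_roots ?expr1n //=.
  under eq_bigr do rewrite expr1n.
  rewrite sumr_const card_ord big_seq_cond big1 ?addr0 // => w /andP[].
  rewrite mem_unity_roots // => /eqP wd w1; under eq_bigr do rewrite exprD.
  by rewrite -mulr_suml sum_expr_unity ?mul0r //; have /dvdnP[c ->] := dvd_M; rewrite mulnC exprM wd expr1n.
have e : \sum_(x | X x) 1 = (N * k)%:R :> algC.
  transitivity (\sum_(c : F | c != 0) \sum_(x | X x && (tr x == 1)) 1 : algC); last first.
    rewrite sumr_const sumr_const -mulrnA mulnC; congr (_ *+ (_ * _)).
    by rewrite -(cardC1 (0 : F)).
  transitivity (\sum_(x | X x) \sum_(c | (c != 0) && (tr x == c)) 1 : algC).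
    apply: eq_bigr => x /class_tr_neq0 t0; rewrite (big_pred1 (tr x)) // => c /=.
    by rewrite [tr x == c]eq_sym; have [->|_] := eqVneq c (tr x); rewrite ?t0 ?andbF.
  rewrite (exchange_big_dep (fun c => c != 0)) /=; last by move=> ? ? _ /andP[].
  apply: eq_bigr => c c0; have ic0 : iota c != 0 by rewrite fmorph_eq0.
  rewrite (reindex_inj (h := fun x => iota c * x)) /=; last by move=> x y /(mulfI ic0).
  apply: eq_bigl => x; rewrite -[_ && (2 * d %| _)%N]/(X (iota c * x)) class_scale // c0.
  by rewrite (trZ prim_G card_E iota_g pr_p card_F') -{2}[c]mulr1 (inj_eq (mulfI c0)).
move/eqP: eM; rewrite e -natrM eqr_nat (M_eq card_E) -mulnA eqn_pmul2l // => /eqP.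
by [].
Qed.

Lemma sum_unity_quartic (f : algC -> algC) k : (0 < k)%N ->
  \sum_(w <- unity_roots (4 * k) | w ^+ 2 == -1) f w = f 'i + f (- 'i).
Proof.
move=> k0; have k40 : (0 < 4 * k)%N by rewrite muln_gt0.
transitivity (\sum_(w <- [:: 'i; - 'i]) f w); last by rewrite !big_cons big_nil addr0.
rewrite -big_filter; apply: perm_big; apply: uniq_perm.
- by rewrite filter_uniq ?uniq_unity_roots.
- by rewrite /= inE andbT -addr_eq0 -mulr2n mulrn_eq0 /= neq0Ci.
move=> w; rewrite mem_filter mem_unity_roots // -sqrCi eqf_sqr !inE andb_idr // => w2.
suff w2' : w ^+ 2 = -1 by rewrite -[4%N]/(2 * 2)%N -mulnA exprM w2' exprM sqrrN !expr1n.
by case/orP: w2 => /eqP ->; rewrite ?sqrrN sqrCi.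
Qed.

(** If the Eisenstein sums were all q, then their sum against w^b would vanish for
    odd b, the terms at i and - i cancelling.  By
    orthogonality this sum is 2 d times a sum of signs over the slice of trace 1,
    so that the slice has an even number of elements; but this number, times
    2 d, is Q + 1, which is 2 modulo 8. *)
Lemma Esum_not_constant :
  ~ (forall w : algC, w ^+ (2 * d) = -1 -> w ^+ 2 != -1 -> Esum w = q%:R).
Proof.
move=> EsumE; have d0 : (0 < d)%N by exact: ltnW.
have nb : (2 * d %| b)%N = false.
  by apply/negP => /(dvdn_trans (dvdn_mulr d (dvdnn 2))); rewrite dvdn2 odd_b.
have s0 : \sum_(w <- unity_roots (4 * d) | w ^+ (2 * d) == -1) Esum w * w ^+ b = 0.
  transitivity (\sum_(w <- unity_roots (4 * d) | w ^+ (2 * d) == -1) q%:R * w ^+ b +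
     \sum_(w <- unity_roots (4 * d) | (w ^+ (2 * d) == -1) && (w ^+ 2 == -1)) (Esum w - q%:R) * w ^+ b).
    rewrite [X in _ + X]big_mkcondr -big_split /=; apply: eq_bigr => w /eqP wd.
    by case: eqVneq => [_|w2]; [ring|rewrite EsumE // addr0].
  rewrite -mulr_sumr -[4%N]/(2 * 2)%N -mulnA sum_unity_half_expr // nb mulr0 add0r.
  rewrite (eq_bigl (fun w => w ^+ 2 == -1)) => [|w]; last first.
    by have [w2|_] := eqVneq (w ^+ 2) (-1); rewrite ?andbF // exprM w2 -signr_odd odd_d eqxx.
  rewrite mulnA sum_unity_quartic // EsumNi exprNn -signr_odd odd_b; ring.
have : \sum_(x | (tr x == 1) && X x) (-1) ^+ ((dlog G x + b) %/ (2 * d)) = 0 :> algC.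
  have NR : (2 * d)%:R != 0 :> algC by rewrite pnatr_eq0 -lt0n.
  apply: (mulfI NR); rewrite mulr0 -[RHS]s0 mulr_sumr /Esum.
  under [RHS]eq_bigr do rewrite mulr_suml.
  rewrite [RHS]exchange_big /= big_mkcondr; apply: eq_bigr => x tx.
  have x0 : x != 0.
    apply: contraTneq tx => ->; rewrite -(inj_eq (fmorph_inj iota)).
    rewrite (trE prim_G card_E iota_g pr_p card_F') rmorph1 expr0n.
    by rewrite eqn0Ngt (ltnW (finNzRing_gt1 F)) add0r eq_sym oner_eq0.
  under [RHS]eq_bigr do rewrite /mchar (negPf x0) -exprD.
  by rewrite -[4%N]/(2 * 2)%N -mulnA sum_unity_half_expr // x0 /=; case: ifP.
pose e x := odd ((dlog G x + b) %/ (2 * d)).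
rewrite (eq_bigr (fun x => 1 - 2 * (e x)%:R)) => [|x _]; last first.
  by rewrite -signr_odd -/(e x); case: (e x) => /=; rewrite ?expr0 ?expr1 ?mulr0 ?mulr1 ?subr0 //; ring.
rewrite sumrB -mulr_sumr -natr_sum sumr_const => /eqP; rewrite subr_eq0 -natrM eqr_nat.
have cc : (#|[pred x | (tr x == 1%R) && X x]| * (2 * d) = Q.+1)%N.
  by rewrite -card_class_tr1; congr (_ * _)%N; apply: eq_card => x; rewrite !inE andbC.
move=> /eqP k_even; move: cc; rewrite (k_even : #|[pred x | (tr x == 1) && X x]| = _).
have := N_mod8 p_mod4 card_F; have := finNzRing_gt1 F.
case: (#|F|) => // Q' _ /= /dvdnP[c ->]; move: (\sum_(_ | _) _)%N => z.
by clear; nia.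
Qed.

End NonSplit.

Section Conditions.

Variables (F E : finFieldType) (iota : {rmorphism F -> E}) (g : F) (G : E) (p n d : nat).
Local Notation Q := #|F|.
Local Notation N := (#|F|.-1).
Local Notation M := (#|E|.-1).
Local Notation q := (p ^ n)%N.
Hypothesis prim_G : M.-primitive_root G.
Hypothesis card_E : #|E| = (Q ^ 2)%N.
Hypothesis iota_g : iota g = G ^+ Q.+1.
Hypotheses (pr_p : prime p) (p_mod4 : p = 3 %[mod 4]) (card_F : Q = (q ^ 2)%N).
Hypotheses (odd_d : odd d) (d_gt1 : (1 < d)%N) (p_d : ~~ (p %| d)%N).
Local Notation Jsum := (Jsum g).
Local Notation Esum := (Esum iota G).
Local Notation term := (term iota g G).

Let pg : N.-primitive_root g. Proof. exact: (prim_g prim_G card_E iota_g). Qed.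
Let oF : odd #|F|. Proof. exact: F_odd p_mod4 card_F. Qed.
Let d0 : (0 < d)%N. Proof. exact: ltnW. Qed.

(* The root from which all the others are obtained by taking powers. *)
Let xi := prim_rootC (4 * d).

Lemma prim_xi : (4 * d).-primitive_root xi.
Proof. by apply: prim_rootCP; rewrite muln_gt0. Qed.

Lemma xi_half : xi ^+ (2 * d) = -1.
Proof.
have : xi ^+ (2 * d) ^+ 2 == 1.
  by rewrite -exprM mulnAC (prim_expr_order prim_xi).
rewrite sqrf_eq1 => /orP[|/eqP //].
rewrite -(prim_order_dvd prim_xi) => /dvdn_leq; rewrite leq_pmul2r //.
by rewrite muln_gt0 d0 => /(_ isT).
Qed.

Lemma xi_sqr_odd k : ~~ (d %| k)%N -> xi ^+ k ^+ 2 != -1.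
Proof.
apply: contra => /eqP e; have /eqP : xi ^+ (k * 4) = 1.
  by rewrite -[4%N]/(2 * 2)%N mulnA exprM exprM e sqrrN expr1n.
by rewrite -(prim_order_dvd prim_xi) mulnC dvdn_pmul2r.
Qed.

Lemma half_root (w : algC) : w ^+ (2 * d) = -1 -> exists k, w = xi ^+ k.
Proof.
move=> wd; have w4 : w ^+ (4 * d) = 1.
  by rewrite -[4%N]/(2 * 2)%N -mulnA mulnC exprM wd sqrrN expr1n.
by have [k ->] := prim_rootP prim_xi w4; exists k.
Qed.

Lemma half_root_order (w : algC) c : w ^+ (2 * d) = -1 -> w ^+ (c * (4 * d)) = 1.
Proof.
move=> wd; have -> : (c * (4 * d) = 2 * d * (2 * c))%N by ring.
by rewrite exprM wd exprM sqrrN !expr1n.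
Qed.

Lemma half_root_odd (w : algC) k : odd k -> w ^+ (2 * d) = -1 -> w ^+ k ^+ (2 * d) = -1.
Proof. by move=> ok wd; rewrite exprAC wd -signr_odd ok. Qed.

(** Remove the odd primes of k one by one. *)
Lemma Jsum_pow_dvd k w : (forall v, v ^+ (2 * d) = -1 -> Jsum v = q%:R \/ Jsum v = - q%:R) ->
  (4 * d %| N)%N -> (k %| d)%N -> w ^+ (2 * d) = -1 -> Jsum (w ^+ k) = Jsum w.
Proof.
move=> Jpm dN; elim/ltn_ind: k w => k IH w kd wd.
have [k1|k1] := leqP k 1.
  case: k kd k1 {IH} => [|[|//]]; last by rewrite expr1.
  by rewrite dvd0n => /eqP d00; move: d_gt1; rewrite d00.
have pl := pdiv_prime k1; have lk := pdiv_dvd k; set l := pdiv k in pl lk.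
have ld : (l %| d)%N := dvdn_trans lk kd.
have ol : odd l := dvdn_odd ld odd_d.
have [k' ek] := dvdnP lk.
have k'k : (k' < k)%N by rewrite ek ltn_Pmulr ?prime_gt1 //; case: (k') ek k1 => // ->.
rewrite ek exprM.
have wk' : w ^+ k' ^+ (2 * d) = -1.
  apply: half_root_odd wd; apply: dvdn_odd odd_d.
  by apply: dvdn_trans kd; rewrite ek dvdn_mulr.
rewrite (Jsum_prime_power pg p_mod4 card_F pl ol) //; last 2 first.
- exact: Jpm.
- by apply: Jpm; apply: half_root_odd.
- by rewrite IH // (dvdn_trans _ kd) // ek dvdn_mulr.
- rewrite Euclid_dvdX // negb_and; apply/orP; left; rewrite dvdn_prime2 //.
  by apply: contraNneq p_d => <-.
have /dvdnP[c ->] := dN.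
exact: half_root_order.
Qed.

Lemma root_expr_d (w : algC) : w ^+ (2 * d) = -1 -> Jsum (w ^+ d) = Jsum 'i.
Proof.
rewrite mulnC exprM => /eqP; rewrite -sqrCi eqf_sqr => /orP[] /eqP -> //.
exact: (JsumNi pg pr_p p_mod4 card_F).
Qed.

(** A primitive root xi has a nonzero term, so it belongs to the Jacobi or to the
    Eisenstein type, and the other roots, being odd powers of xi, are of the same
    type. *)
Lemma maximal_necessary : maximalH d q F ->
  [/\ (4 * d %| N)%N, q = 3 %[mod 4] & forall w, w ^+ (2 * d) = -1 -> Jsum w = q%:R].
Proof.
move=> /(maximal_terms prim_G card_E iota_g pr_p p_mod4 card_F odd_d) termE.
have q0 : q%:R != 0 :> algC.
  by rewrite pnatr_eq0 -lt0n expn_gt0 prime_gt0.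
have xi2 : xi ^+ 2 != -1.
  by rewrite -[xi]expr1 xi_sqr_odd // dvdn1 neq_ltn d_gt1 orbT.
have disj (w : algC) : w ^+ 2 != -1 -> w ^+ N = 1 -> w ^+ Q.+1 <> -1.
  move=> w2 wN wQ; case/eqP: w2.
  have QN : Q.+1 = N.+2 by rewrite prednK // ltnW ?finNzRing_gt1.
  by rewrite -wQ QN -[N.+2]/(2 + N)%N exprD wN mulr1.
have xi_split : xi ^+ N = 1 \/ xi ^+ Q.+1 = -1.
  have := termE xi xi_half xi2; rewrite /term.
  case: eqP => [|_]; first by left.
  case: eqP => [|_]; first by right.
  by rewrite addr0 => e; rewrite -e eqxx in q0.
case: xi_split => [xiN|xiQ].
  have dN : (4 * d %| N)%N by rewrite (prim_order_dvd prim_xi) xiN.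
  have rootN (w : algC) : w ^+ (2 * d) = -1 -> w ^+ N = 1.
    by move=> /half_root[k ->]; rewrite exprAC xiN expr1n.
  have JE (w : algC) : w ^+ (2 * d) = -1 -> w ^+ 2 != -1 -> Jsum w = q%:R.
    move=> wd w2; have wN := rootN w wd; have := termE w wd w2; rewrite /term wN eqxx.
    by rewrite (introF eqP (disj w w2 wN)) addr0.
  (* i is xi^d up to sign, and is reached from a root that is not of order 4 *)
  have Ji : Jsum 'i = q%:R.
    pose l := pdiv d; have pl : prime l := pdiv_prime d_gt1.
    have [k ek] := dvdnP (pdiv_dvd d); rewrite -/l in ek.
    have ol : odd l by apply: dvdn_odd odd_d; exact: pdiv_dvd.
    have ok : odd k by move: odd_d; rewrite ek oddM => /andP[].
    have k_lt : (k < d)%N.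
      by rewrite [X in (_ < X)%N]ek ltn_Pmulr ?prime_gt1 //; case: (k) ok.
    have wd := half_root_odd ok xi_half; set w := xi ^+ k in wd.
    have w2 : w ^+ 2 != -1.
      by apply: xi_sqr_odd; rewrite gtnNdvd //; case: (k) ok.
    have Jw := JE w wd w2.
    have Jl : Jsum (w ^+ l) = Jsum 'i by rewrite /w -exprM -ek root_expr_d ?xi_half.
    rewrite -Jl (Jsum_prime_power pg p_mod4 card_F pl ol) ?Jl ?Jw ?rootN //; last 2 first.
    - by left.
    - exact: Jsum_i_pm pg pr_p p_mod4 card_F.
    rewrite Euclid_dvdX // negb_and; apply/orP; left; rewrite dvdn_prime2 //.
    by apply: contraNneq p_d => <-; exact: pdiv_dvd.
  split=> // [|w wd].
    by apply/eqP; rewrite -(Jsum_i_sign pg pr_p p_mod4 card_F) Ji.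
  have [w2|] := eqVneq (w ^+ 2) (-1); last exact: JE.
  move/eqP: w2; rewrite -sqrCi eqf_sqr => /orP[] /eqP -> //.
  by rewrite (JsumNi pg pr_p p_mod4 card_F).
exfalso.
have rootQ (w : algC) : w ^+ (2 * d) = -1 -> w ^+ Q.+1 = -1.
  move=> wd; have [k ek] := half_root wd; rewrite ek in wd *.
  by rewrite exprAC xiQ -[RHS]wd exprAC xi_half.
have EsumE (w : algC) : w ^+ (2 * d) = -1 -> w ^+ 2 != -1 -> Esum w = q%:R.
  move=> wd w2; have := termE w wd w2; rewrite /term (rootQ w wd) eqxx.
  case: eqP => [/(disj w w2)[]|_]; first exact: rootQ.
  by rewrite add0r.
have div_Q1 : (2 * d %| Q.+1)%N.
  have : xi ^+ (Q.+1 * 2) = 1 by rewrite exprM xiQ sqrrN expr1n.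
  by move/eqP; rewrite -(prim_order_dvd prim_xi) -[4%N]/(2 * 2)%N mulnAC dvdn_pmul2r.
have absurd b : odd b -> ~~ (2 * d %| Q.+1./2 + b)%N -> False.
  move=> ob bt; exact: (Esum_not_constant prim_G card_E iota_g pr_p p_mod4 card_F odd_d d_gt1 div_Q1 ob bt EsumE).
have [b1|] := boolP (2 * d %| Q.+1./2 + 1)%N; last exact: absurd.
apply: (@absurd 3) => //; rewrite -[3%N]/(1 + 2)%N addnA dvdn_addr //.
by rewrite gtnNdvd //; clear -d_gt1; lia.
Qed.

(** The congruence on q makes v^q equal to 1/v or to - v, and in both cases the
    Frobenius invariance of J identifies J(v) with its conjugate. *)
Lemma maximal_sufficient : (4 * d %| q + 1)%N \/ (q = 1 + 2 * d %[mod 4 * d])%N ->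
  (4 * d %| N)%N -> q = 3 %[mod 4] -> maximalH d q F.
Proof.
move=> qd dN q3; apply/(maximal_terms prim_G card_E iota_g pr_p p_mod4 card_F odd_d) => w wd w2.
have rootN (v : algC) : v ^+ (2 * d) = -1 -> v ^+ N = 1.
  move=> vd; have /dvdnP[c ->] := dN.
  exact: half_root_order.
have Jpm (v : algC) : v ^+ (2 * d) = -1 -> Jsum v = q%:R \/ Jsum v = - q%:R.
  move=> vd; have vN := rootN v vd.
  have v4 : v ^+ (4 * d) = 1 by rewrite -[4%N]/(2 * 2)%N -mulnA mulnC exprM vd sqrrN expr1n.
  apply: (Jsum_real pg p_mod4 card_F) => //.
  - by apply: contra_eqN vd => /eqP->; rewrite expr1n eq_sym neg1_neq1.
  - by apply: contra_eqN vd => /eqP->; rewrite exprM sqrrN !expr1n eq_sym neg1_neq1.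
  rewrite Jsum_conj // -[RHS](Jsum_frob pg oF n (pchar_F pr_p card_F) (p_odd p_mod4) vN).
  case: qd => [/dvdnP[c e]|e].
    congr (Jsum _); have v0 : v != 0.
      by apply: contra_eqN vd => /eqP->; rewrite expr0n muln_eq0 /= eqn0Ngt d0 eq_sym oppr_eq0 oner_eq0.
    by apply: (mulfI v0); rewrite divff // -exprS -addn1 e mulnC exprM v4 expr1n.
  have -> : v ^+ q = - v.
    by rewrite -(expr_mod _ v4) e expr_mod // exprD expr1 vd mulrN1.
  have NvN : (- v) ^+ N = 1 by rewrite -mulN1r exprMn signN // vN mulr1.
  by rewrite -(Jsum_inv pg oF NvN) invrN opprK.
have wN := rootN w wd.
rewrite /term wN eqxx ifF ?addr0; last first.
  apply/eqP => wQ; case/eqP: w2.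
  have QN : Q.+1 = N.+2 by rewrite prednK // ltnW ?finNzRing_gt1.
  by rewrite -wQ QN -[N.+2]/(2 + N)%N exprD wN mulr1.
rewrite -(Jsum_pow_dvd Jpm dN (dvdnn d) wd) root_expr_d //.
by apply/eqP; rewrite (Jsum_i_sign pg pr_p p_mod4 card_F) q3.
Qed.

End Conditions.

(** * The p-adic valuation of some binomial coefficients *)

Section BinomialValuations.

Local Close Scope ring_scope.
Local Open Scope nat_scope.

(** Legendre's formula, one digit at a time. *)
Lemma logn_fact_digit p m r : prime p -> (r < p)%N ->
  logn p (p * m + r)`! = (m + logn p m`!)%N.
Proof.
move=> pp rp; have p0 := prime_gt0 pp; have p1 := prime_gt1 pp.
have ext x B : (x < B)%N -> logn p x`! = (\sum_(1 <= k < B) x %/ p ^ k)%N.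
  move=> xB; have tail : (\sum_(x.+1 <= k < B) x %/ p ^ k = 0)%N.
    rewrite big_nat_cond big1 // => k; rewrite andbT => /andP[xk _].
    by rewrite divn_small // (ltn_trans xk) // ltn_expl.
  by rewrite logn_fact // (@big_cat_nat _ _ _ x.+1 1 B) //= tail addn0.
set x := (p * m + r)%N; have mx : (m <= x)%N.
  by rewrite /x (leq_trans (leq_pmull m p0)) ?leq_addr.
rewrite (ext x x.+2) // (ext m x.+1) // big_ltn //.
have xp : (x %/ p = m)%N by rewrite /x mulnC divnMDl // divn_small ?addn0.
rewrite expn1 xp big_add1 /=; congr (_ + _)%N; apply: eq_bigr => k _.
by rewrite expnS divnMA xp.
Qed.

Lemma modn_add_leq a b m : ((a + b) %% m <= a %% m + b %% m)%N.
Proof. by rewrite -modnDm leq_mod. Qed.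

Lemma leq_sum_shift (u : nat -> nat) c : u c = u 0%N ->
  (\sum_(t < c) u t.+1 = \sum_(t < c) u t)%N.
Proof.
move=> uc; apply/eqP; rewrite -(eqn_add2l (u 0%N)).
by rewrite -(big_ord_recl c (fun t => u t)) big_ord_recr /= uc addnC.
Qed.

Section BinomialValuation.

Variables (p n d e : nat).
Hypotheses (pr_p : prime p) (odd_p : odd p) (n_gt0 : (0 < n)%N).
Local Notation Q := (p ^ (n * 2))%N.
Local Notation N := (Q.-1).
Hypothesis N_eq : N = (4 * d * e)%N.

Let p1 : (1 < p)%N := prime_gt1 pr_p.
Let Q0 : (0 < Q)%N. Proof. by rewrite expn_gt0 prime_gt0. Qed.
Let N0 : (0 < N)%N. Proof. by rewrite -ltnS prednK // -{1}(expn0 p) ltn_exp2l // muln_gt0 n_gt0. Qed.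
Let QN : Q = 1 %[mod N].
Proof. by have := modnDl 1 N; rewrite addn1 prednK. Qed.

(** (p - 1) sigma (i) / N is the sum of the 2 n base p digits of i reduced modulo
    N = p^(2n) - 1. *)
Definition sigma (i : nat) : nat := (\sum_(t < n * 2) (p ^ t * i) %% N)%N.

Lemma sigma_add i k : (sigma (i + k) <= sigma i + sigma k)%N.
Proof. by rewrite /sigma -big_split leq_sum // => t _ /=; rewrite mulnDr modn_add_leq. Qed.

Lemma sigma_pmul i : sigma (p * i) = sigma i.
Proof.
rewrite /sigma -(@leq_sum_shift (fun t => (p ^ t * i) %% N)%N); last first.
  by rewrite expn0 -modnMml QN modnMml.
by apply: eq_bigr => t _; rewrite expnSr mulnA.
Qed.

Lemma geom_p c : (p.-1 * \sum_(t < c) p ^ t = p ^ c - 1)%N.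
Proof. by rewrite -predn_exp -subn1. Qed.

(** By Legendre, i - (p - 1) v(i!) is the sum of the base p digits of i.  Reducing
    modulo N can only decrease it, as sigma is subadditive and invariant under
    multiplication by p. *)
Lemma sigma_legendre i : (p.-1 * sigma i + N * (p.-1 * logn p i`!) <= N * i)%N.
Proof.
elim/ltn_ind: i => i IH; pose m := (i %/ p)%N; pose r := (i %% p)%N.
have iE : i = (p * m + r)%N by rewrite mulnC -divn_eq.
rewrite iE.
have rp : (r < p)%N by rewrite ltn_mod prime_gt0.
rewrite logn_fact_digit //.
have sr : (p.-1 * sigma r <= N * r)%N.
  apply: (@leq_trans (p.-1 * \sum_(t < n * 2) p ^ t * r)).
    by rewrite leq_mul2l leq_sum ?orbT // => t _; rewrite leq_mod.
  by rewrite -big_distrl /= mulnA geom_p subn1.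
have sm : (p.-1 * sigma m + N * (p.-1 * logn p m`!) <= N * m)%N.
  case: (posnP m) => [->|m0].
    by rewrite muln0 /sigma big1 ?muln0 ?logn1 ?muln0 // => t _; rewrite muln0 mod0n.
  apply: IH; rewrite ltn_Pdiv // lt0n; apply: contraTneq m0 => i0.
  by rewrite /m i0 div0n.
have := sigma_add (p * m) r; rewrite sigma_pmul => sadd.
have pS : p = p.-1.+1 by rewrite prednK // prime_gt0.
have : (p.-1 * sigma (p * m + r) <= p.-1 * sigma m + p.-1 * sigma r)%N.
  by rewrite -mulnDr leq_mul2l sadd orbT.
move=> sadd'; rewrite [X in (_ <= X)%N](_ : _ = N * m + N * (p.-1 * m) + N * r)%N; last first.
  by rewrite mulnDr; congr (_ + _)%N; rewrite -mulnDr -mulSn -pS.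
rewrite !mulnDr; move: sadd' sr sm; clear; lia.
Qed.

Lemma logn_half c : (p.-1 * logn p ((p ^ c)./2)`! + c * p./2 = (p ^ c)./2)%N.
Proof.
elim: c => [|c IH]; first by rewrite expn0 logn1 muln0.
have oc : odd (p ^ c) by rewrite oddX odd_p orbT.
have -> : ((p ^ c.+1)./2 = p * (p ^ c)./2 + p./2)%N.
  have e1 := odd_double_half p; have e2 := odd_double_half (p ^ c)%N; rewrite odd_p oc in e1 e2.
  rewrite expnS; move: (p ^ c)%N (p ^ c)./2 e2 => P P2 <-; move: p./2 e1 => h e1.
  have -> : (p * (true + P2.*2) = true + (p * P2 + h).*2)%N by rewrite -e1 -!muln2 /=; nia.
  by rewrite half_bit_double.
rewrite logn_fact_digit //; last first.
  by rewrite -divn2 ltn_Pdiv // prime_gt0.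
move: IH; move: (p ^ c)./2 => y IH.
have pe : (p * y = p.-1 * y + y)%N by rewrite addnC -mulSn prednK ?prime_gt0.
by rewrite pe mulnDr mulSn; move: IH; clear; lia.
Qed.

Lemma logn_pexp_half K c : (p.-1 * logn p (p ^ K * (p ^ c)./2)`! + c * p./2 = p ^ K * (p ^ c)./2)%N.
Proof.
elim: K => [|K IH]; first by rewrite expn0 !mul1n logn_half.
rewrite expnS -mulnA -{1}[(p * (_ * _))%N]addn0 logn_fact_digit ?prime_gt0 //.
move: IH; move: (p ^ K * _)%N => y IH.
have pe : (p * y = p.-1 * y + y)%N by rewrite addnC -mulSn prednK ?prime_gt0.
by rewrite pe mulnDr; move: IH; clear; lia.
Qed.

Variables (K j i : nat).
Local Notation N' := (p ^ (n * 2 * K) * Q./2)%N.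
Hypotheses (odd_j : odd j) (le_iN : (i <= N')%N) (dvd_i : (N %| e * j + i)%N).

(** The residues of p^t i and of p^t (N' - i) are e (4 d - y) and e (2 d + y), the
    latter reduced modulo 4 d e, where y is p^t j modulo 4 d. *)
Lemma sigma_pair t :
  ((p ^ t * i) %% N + (p ^ t * (N' - i)) %% N =
   2 * d * e + N * ((p ^ t * j) %% (4 * d) < 2 * d))%N.
Proof.
have d0 : (0 < 4 * d)%N by move: N0; rewrite N_eq; case: d.
have e0 : (0 < e)%N by move: N0; rewrite N_eq; case: e => //; rewrite muln0.
set y := ((p ^ t * j) %% (4 * d))%N; have y4 : (y < 4 * d)%N by rewrite ltn_mod.
have oy : odd y.
  have := odd_mod (p ^ t * j) (_ : odd (4 * d) = false); rewrite oddM /= => /(_ erefl) ->.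
  by rewrite oddM oddX odd_p orbT.
have y0 : (0 < y)%N by case: (y) oy.
have ydef : exists c, (p ^ t * j = c * (4 * d) + y)%N.
  by exists ((p ^ t * j) %/ (4 * d))%N; rewrite -divn_eq.
have ot : odd (p ^ t) by rewrite oddX odd_p orbT.
have [c1 hc1] := ydef.
have [c2 hc2] := dvdnP dvd_i.
have ptE : exists h, (p ^ t = h * 2 + 1)%N.
  by exists (p ^ t)./2; rewrite muln2 addn1 -add1n -{1}(odd_double_half (p ^ t)) ot.
have [h hh] := ptE.
have QK : exists c3, (p ^ (n * 2 * K) = c3 * N + 1)%N.
  have : (N %| p ^ (n * 2 * K) - 1)%N by rewrite [(p ^ (n * 2 * K))%N]expnM subn1 dvdn_pred_predX.
  move=> /dvdnP[c3 e3]; exists c3; rewrite -e3 subnK // expn_gt0 prime_gt0 //.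
have [c3 hc3] := QK.
have Qh : (Q./2 = 2 * d * e)%N.
  have oQ : odd Q by rewrite oddX odd_p orbT.
  have := odd_double_half Q; rewrite oQ -muln2 => eQ.
  have := N_eq; rewrite -eQ /=; clear; lia.
have ehi : (p ^ t * i = e * (4 * d - y) %[mod N])%N.
  apply/eqP; rewrite -(eqn_modDr (e * (c1 * (4 * d) + y))) -hc1.
  have -> : (p ^ t * i + e * (p ^ t * j) = p ^ t * c2 * N)%N.
    by rewrite -mulnA -hc2; ring.
  have -> : (e * (4 * d - y) + e * (p ^ t * j) = (c1 + 1) * N)%N.
    by rewrite hc1 -mulnDr addnCA subnK ?(ltnW y4) // N_eq; ring.
  by rewrite !modnMl.
have ehi' : (p ^ t * (N' - i) = e * (2 * d + y) %[mod N])%N.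
  apply/eqP; rewrite -(eqn_modDr (p ^ t * i)) -mulnDr subnK //.
  rewrite -modnDmr ehi modnDmr -mulnDr.
  have -> : (2 * d + y + (4 * d - y) = 2 * d + 4 * d)%N by clear -y4; lia.
  have -> : (e * (2 * d + 4 * d) = 1 * N + e * (2 * d))%N by rewrite N_eq; ring.
  rewrite modnMDl hc3 Qh hh.
  have -> : ((h * 2 + 1) * ((c3 * N + 1) * (2 * d * e)) =
            (h + (h * 2 + 1) * c3 * (2 * d * e)) * N + e * (2 * d))%N by rewrite N_eq; ring.
  by rewrite modnMDl.
rewrite ehi ehi' modn_small; last by rewrite N_eq mulnC ltn_pmul2r //; clear -y0 y4; lia.
case: (ltnP y (2 * d)) => yd.
  rewrite modn_small; last by rewrite N_eq mulnC ltn_pmul2r //; clear -yd; lia.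
  by rewrite N_eq muln1 -mulnDr; clear -yd; nia.
have {}yd : (2 * d < y)%N.
  by rewrite ltn_neqAle yd andbT; apply: contraTneq oy => <-; rewrite oddM.
have -> : (e * (2 * d + y) = 1 * N + e * (y - 2 * d))%N by rewrite N_eq; clear -yd; nia.
rewrite modnMDl modn_small; last by rewrite N_eq mulnC ltn_pmul2r //; clear -yd y4; lia.
by rewrite muln0 addn0 -mulnDr; clear -yd y4; nia.
Qed.

(** Kummer: up to the factor p - 1, the valuation is the excess of the digit sums of
    i and N' - i over that of N', and it is the y in the lower half that create an
    excess. *)
Lemma logn_bin_lower :
  (\sum_(t < n * 2) ((p ^ t * j) %% (4 * d) < 2 * d) <= logn p 'C(N', i))%N.
Proof.
have sum_pair : (sigma i + sigma (N' - i) = n * N + N * \sum_(t < n * 2) ((p ^ t * j) %% (4 * d) < 2 * d))%N.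
  rewrite /sigma -big_split /=; under eq_bigr do rewrite sigma_pair.
  rewrite big_split /= sum_nat_const card_ord -big_distrr /= N_eq.
  by congr (_ + _)%N; ring.
have P0 : (0 < p.-1)%N by rewrite -subn1 subn_gt0.
rewrite -(leq_pmul2l N0) -(leq_add2l (n * N)) -sum_pair -(leq_pmul2l P0).
have binE : (logn p N'`! = logn p 'C(N', i) + (logn p i`! + logn p (N' - i)`!))%N.
  by rewrite -(bin_fact le_iN) !lognM ?muln_gt0 ?bin_gt0 ?fact_gt0.
have li := sigma_legendre i; have li' := sigma_legendre (N' - i).
have := logn_pexp_half (n * 2 * K) (n * 2).
have ph : (2 * p./2 = p.-1)%N.
  by have := odd_double_half p; rewrite odd_p; clear; lia.
have nh : (n * 2 * p./2 = n * p.-1)%N by rewrite -mulnA ph.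
rewrite nh binE => lN.
have : (N * (p.-1 * logn p i`!) + N * (p.-1 * logn p (N' - i)`!) +
   (p.-1 * (sigma i + sigma (N' - i))) <= N * N')%N.
  by rewrite -[X in (_ <= N * X)%N](subnK le_iN) [(N * (_ + _))%N]mulnDr; clear -li li'; lia.
move: (sigma i + sigma (N' - i))%N lN => S.
move: (logn p i`!) (logn p (N' - i)`!) (logn p 'C(N', i)) => a b c.
move: (p.-1) (N) (N')%N => P R X <-.
by clear; nia.
Qed.

End BinomialValuation.

End BinomialValuations.

(** * An unramified model: integer polynomials modulo a lifted minimal polynomial *)

Section PadicModel.

Variables (F : finFieldType) (g : F) (p : nat).
Hypothesis pF : p \in [pchar F].

Definition ev : {poly int} -> F := horner_eval g \o map_poly intr.
HB.instance Definition _ := GRing.RMorphism.copy ev (horner_eval g \o map_poly intr).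

Lemma evX : ev 'X = g. Proof. by rewrite /ev /= /horner_eval map_polyX hornerX. Qed.
Lemma evC z : ev z%:P = z%:~R. Proof. by rewrite /ev /= /horner_eval map_polyC hornerC. Qed.
Lemma ev_p : ev p%:R = 0. Proof. by rewrite rmorph_nat pcharf0. Qed.

(** Z[X] / f, for f a monic lift of the minimal polynomial of the generator g,
    replaces the ring of integers of the unramified extension of Q_p with residue
    field F; as only congruences modulo powers of p are used, no completion is
    needed. *)
Definition pideal (f : {poly int}) (k : nat) (A : {poly int}) : Prop :=
  exists U V, A = p%:R ^+ k * U + f * V.

Lemma pideal_gen f A : pideal f 1 (p%:R * A).
Proof. by exists A, 0; rewrite expr1 mulr0 addr0. Qed.

(** A monic polynomial of least degree with root g: the remainder of any other
    polynomial with root g must vanish modulo p, since otherwise it could be made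
    monic modulo p. *)
Lemma lifted_minpoly_exists : exists f, [/\ f \is monic, ev f = 0 &
  forall h, ev h = 0 -> pideal f 1 h].
Proof.
suff H m : forall f : {poly int}, (size f <= m)%N -> f \is monic -> ev f = 0 ->
    exists f, [/\ f \is monic, ev f = 0 & forall h, ev h = 0 -> pideal f 1 h].
  apply: (H _ ('X^(#|F|) - 'X) (leqnn _)); last first.
    by rewrite rmorphB rmorphXn /= evX expf_card subrr.
  by rewrite monicE lead_coefDl ?lead_coefXn // size_polyN size_polyX size_polyXn ltnS finNzRing_gt1.
elim: m => [|m IH] f sf mf evf.
  by move: (monic_neq0 mf); rewrite -size_poly_leq0 sf.
have [[h [evh hf]]|nh] := boolp.EM (exists h, ev h = 0 /\ ~ pideal f 1 h); last first.
  exists f; split=> // h evh; apply: boolp.contrapT => hf.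
  by apply: nh; exists h.
have pp := pcharf_prime pF; have p0 : p%:Z != 0 by rewrite -lt0n prime_gt0.
pose r := Pdiv.Ring.rmodp h f; have eh := Pdiv.RingMonic.rdivp_eq mf h; rewrite -/r in eh.
have evr : ev r = 0 by move: evh; rewrite eh rmorphD rmorphM /= evf mulr0 add0r.
have sr : (size r < size f)%N by rewrite Pdiv.Ring.ltn_rmodpN0 // monic_neq0.
pose r1 := \poly_(i < size r) (r`_i %% p)%Z; pose r2 := \poly_(i < size r) (r`_i %/ p)%Z.
have er : r = r1 + p%:R * r2.
  apply/polyP => i; rewrite coefD mulr_natl coefMn !coef_poly; case: ltnP => [_|le].
    by rewrite [LHS](divz_eq _ p) addrC pmulrn -mulrzr intz.
  by rewrite mul0rn addr0 nth_default.
have r10 : r1 != 0.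
  apply/eqP => r10; apply: hf; rewrite eh er r10 add0r.
  by exists r2, (Pdiv.Ring.rdivp h f); rewrite expr1 addrC [f * _]mulrC.
have evr1 : ev r1 = 0 by move: evr; rewrite er rmorphD rmorphM /= ev_p mul0r addr0.
have s1 : (size r1 <= size r)%N := size_poly _ _.
pose l := lead_coef r1; have sz1 : (0 < size r1)%N by rewrite size_poly_gt0.
have lE : exists i, l = (r`_i %% p)%Z.
  exists (size r1).-1; rewrite /l /lead_coef coef_poly ifT //.
  by rewrite prednK.
have cop : coprimez l p.
  have [i li] := lE; have l0 : l != 0 by rewrite lead_coef_eq0.
  have : (0 <= l < p%:Z) by rewrite li modz_ge0 // ltz_pmod // ltz_nat prime_gt0.
  case: (l) l0 => [a|a]; last by rewrite andbC.
  move=> a0; rewrite lez_nat ltz_nat /= => ap.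
  rewrite coprimezE /= coprime_sym prime_coprime //.
  by rewrite gtnNdvd // lt0n.
have [u [v uv]] := Bezoutz l p.
have {}uv : u * l + v * p = 1 by rewrite uv; exact/eqP.
pose f' := u *: r1 + (v * p) *: 'X^((size r1).-1).
have cf' : f'`_(size r1).-1 = 1 by rewrite coefD !coefZ coefXn eqxx mulr1 -/(lead_coef r1) uv.
have sf' : size f' = size r1.
  apply/eqP; rewrite eqn_leq; apply/andP; split.
    rewrite (leq_trans (size_polyD _ _)) // geq_max !(leq_trans (size_scale_leq _ _)) //.
    by rewrite size_polyXn prednK.
  by rewrite -[size r1]prednK // ltnNge; apply/negP => /leq_sizeP/(_ _ (leqnn _)); rewrite cf'.
apply: (IH f').
- by rewrite sf' -ltnS (leq_trans _ sf) // (leq_ltn_trans s1).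
- by rewrite monicE /lead_coef sf' cf'.
rewrite rmorphD -!mul_polyC !rmorphM /= !evC evr1 mulr0 add0r.
by rewrite -[(p : int)%:~R]/(p%:R) pcharf0 // mulr0 mul0r.
Qed.

Variable f : {poly int}.
Hypotheses (monic_f : f \is monic) (ev_f : ev f = 0)
  (ker_ev : forall h, ev h = 0 -> pideal f 1 h).
Local Notation I := (pideal f).

Lemma pideal0 k : I k 0. Proof. by exists 0, 0; rewrite !mulr0 addr0. Qed.
Lemma pidealD k A B : I k A -> I k B -> I k (A + B).
Proof. by move=> [U [V ->]] [U' [V' ->]]; exists (U + U'), (V + V'); ring. Qed.
Lemma pidealN k A : I k A -> I k (- A).
Proof. by move=> [U [V ->]]; exists (- U), (- V); ring. Qed.
Lemma pidealM k A B : I k A -> I k (B * A).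
Proof. by move=> [U [V ->]]; exists (B * U), (B * V); ring. Qed.
Lemma pideal_mul k l A B : I k A -> I l B -> I (k + l) (A * B).
Proof.
move=> [U [V ->]] [U' [V' ->]]; rewrite /pideal exprD.
exists (U * U'), (p%:R ^+ k * U * V' + V * (p%:R ^+ l * U' + f * V')); ring.
Qed.
Lemma pidealW k l A : (k <= l)%N -> I l A -> I k A.
Proof.
move=> kl [U [V ->]]; exists (p%:R ^+ (l - k) * U), V.
by rewrite mulrA -exprD subnKC.
Qed.
Lemma pideal_f k : I k f. Proof. by exists 0, 1; ring. Qed.

Lemma ev_pideal k A : (0 < k)%N -> I k A -> ev A = 0.
Proof.
case: k => // k _ [U [V ->]].
by rewrite rmorphD !rmorphM /= ev_f mul0r addr0 rmorphXn /= ev_p expr0n mul0r.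
Qed.

Definition pcong k A B := I k (A - B).

Lemma pcong_refl k A : pcong k A A. Proof. by rewrite /pcong subrr; exact: pideal0. Qed.
Lemma pcong_sym k A B : pcong k A B -> pcong k B A.
Proof. by move/pidealN; rewrite opprB. Qed.
Lemma pcong_trans k B A C : pcong k A B -> pcong k B C -> pcong k A C.
Proof. by move=> h1 h2; have := pidealD h1 h2; rewrite addrA subrK. Qed.
Lemma pcongD k A B A' B' : pcong k A A' -> pcong k B B' -> pcong k (A + B) (A' + B').
Proof. by move=> h1 h2; rewrite /pcong opprD addrACA; exact: pidealD. Qed.
Lemma pcongM k A B A' B' : pcong k A A' -> pcong k B B' -> pcong k (A * B) (A' * B').
Proof.
move=> h1 h2; rewrite /pcong (_ : _ - _ = B * (A - A') + A' * (B - B')); last by ring.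
by apply: pidealD; apply: pidealM.
Qed.
Lemma pcongX k A A' m : pcong k A A' -> pcong k (A ^+ m) (A' ^+ m).
Proof.
move=> h; elim: m => [|m IH]; first exact: pcong_refl.
by rewrite !exprS; exact: pcongM.
Qed.
Lemma pcong_sum k (T : Type) (r : seq T) (P : pred T) (A B : T -> {poly int}) :
  (forall i, P i -> pcong k (A i) (B i)) ->
  pcong k (\sum_(i <- r | P i) A i) (\sum_(i <- r | P i) B i).
Proof.
move=> h; elim/big_rec2: _ => [|i x y Pi]; first exact: pcong_refl.
by apply: pcongD; exact: h.
Qed.

(** The quotient of A^p - B^p by A - B is congruent to p B^(p-1) modulo (p, f), so
    it lies in this ideal. *)
Lemma pcong_frob k A B : (0 < k)%N -> pcong k A B -> pcong k.+1 (A ^+ p) (B ^+ p).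
Proof.
move=> k0 h; rewrite /pcong subrXX -addn1; apply: pideal_mul => //.
have h1 : pcong 1 A B by exact: pidealW h.
have : pcong 1 (\sum_(i < p) A ^+ (p.-1 - i) * B ^+ i) (\sum_(i < p) B ^+ (p.-1)).
  apply: pcong_sum => i _; have le : (i <= p.-1)%N by rewrite -ltnS (ltn_predK (ltn_ord i)).
  rewrite -[X in pcong _ _ (_ ^+ X)](subnK le) exprD.
  by apply: pcongM; [exact: pcongX|exact: pcong_refl].
rewrite sumr_const card_ord -mulr_natl => e.
have := pidealD e (pideal_gen f (B ^+ p.-1)); rewrite subrK => {}e.
exact: e.
Qed.

(** Modulo p^(m+1) and f, the power A^(p^m) only depends on the value of A: it
    approximates a Teichmueller lift. *)
Lemma pcong_frobn m A B : ev A = ev B -> pcong m.+1 (A ^+ (p ^ m)) (B ^+ (p ^ m)).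
Proof.
move=> e; elim: m => [|m IH].
  by rewrite !expr1; apply: ker_ev; rewrite rmorphB /= e subrr.
by rewrite expnSr !exprM; exact: pcong_frob.
Qed.

(** f is monic, so it is not a zero divisor modulo p. *)
Lemma pideal_torsion k A : I k.+1 (p%:R * A) -> I k A.
Proof.
have pp := pcharf_prime pF; have p0 : p%:R != 0 :> {poly int}.
  by rewrite -polyC_natr polyC_eq0 pnatr_eq0 -lt0n prime_gt0.
move=> [U [V e]]; suff [V' eV] : exists V', V = p%:R * V'.
  exists U, V'; apply: (mulfI p0); rewrite e eV exprS; ring.
have pFp := pchar_Fp pp.
pose red : {poly int} -> {poly 'F_p} := map_poly intr.
have redp : red p%:R = 0 by rewrite /red rmorph_nat -polyC_natr pcharf0.
have /eqP : red (f * V) = 0.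
  move/eqP: e; rewrite -subr_eq0 => /eqP e.
  have -> : f * V = p%:R * (A - p%:R ^+ k * U) by rewrite mulrBr; apply/eqP; rewrite eq_sym -subr_eq0 -e exprS; apply/eqP; ring.
  by rewrite /red rmorphM /= -/red redp mul0r.
rewrite /red rmorphM mulf_eq0 => /orP[/eqP rf|/eqP rV].
  have : red f \is monic by exact: monic_map.
  by rewrite (rf : red f = 0) monicE lead_coef0 eq_sym oner_eq0.
exists (\poly_(i < size V) (V`_i %/ p)%Z); apply/polyP => i.
rewrite mulr_natl coefMn coef_poly; case: ltnP => [_|le]; last by rewrite mul0rn nth_default.
have : (red V)`_i = 0 by rewrite (rV : red V = 0) coef0.
rewrite coef_map /= => /eqP; rewrite -(dvdz_pcharf pFp) => /dvdzP[c ->].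
have pz : p%:Z != 0 by rewrite -lt0n prime_gt0.
by rewrite (mulzK _ pz) -mulr_natr natz.
Qed.

Lemma pideal_int k (z : int) : I k z%:P -> (p%:Z ^+ k %| z)%Z.
Proof.
elim: k z => [|k IH] z h; first by rewrite expr0 dvd1z.
have /eqP := ev_pideal (ltn0Sn k) h; rewrite evC -(dvdz_pcharf pF) => /dvdzP[c e].
rewrite e mulrC exprS dvdz_mul // IH //; apply: pideal_torsion.
by rewrite -polyC_natr -polyCM natz mulrC -e.
Qed.

(** Elements with a nonzero value in F are units of the model; cancellation is
    proved by removing one power of p at a time. *)
Lemma pideal_cancel k u A : ev u != 0 -> I k (u * A) -> I k A.
Proof.
move=> u0; elim: k A => [|k IH] A h; first by exists A, 0; rewrite expr0; ring.
have /eqP := ev_pideal (ltn0Sn k) h; rewrite rmorphM mulf_eq0 (negPf u0) => /eqP evA.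
have [A' [V e]] := ker_ev evA; rewrite expr1 in e.
have : I k.+1 (p%:R * (u * A')).
  have -> : p%:R * (u * A') = u * A + - (u * V * f) by rewrite e; ring.
  by apply: pidealD => //; apply: pidealN; apply: pidealM; exact: pideal_f.
move=> /pideal_torsion/IH [U' [V' e']]; rewrite e e'.
by exists U', (p%:R * V' + V); rewrite exprS; ring.
Qed.

End PadicModel.

(** * Stickelberger's valuation of the Jacobi sums *)

Section Stickelberger.

Variables (F : finFieldType) (g : F) (p n d e : nat).
Local Notation N := (#|F|.-1).
Local Notation q := (p ^ n)%N.
Hypothesis prim_g : N.-primitive_root g.
Hypotheses (pr_p : prime p) (odd_p : odd p) (n_gt0 : (0 < n)%N).
Hypothesis card_F : #|F| = (p ^ (n * 2))%N.
Hypothesis N_eq : N = (4 * d * e)%N.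
Hypothesis JsumE : forall w : algC, w ^+ (2 * d) = -1 -> Jsum g w = q%:R.

Let oF : odd #|F|. Proof. by rewrite card_F oddX odd_p orbT. Qed.
Let pF : p \in [pchar F]. Proof. exact: card_finPcharP card_F pr_p. Qed.
Let N0 : (0 < N)%N := N_gt0 F.
Let d0 : (0 < d)%N. Proof. by move: N0; rewrite N_eq; case: (d). Qed.
Let e0 : (0 < e)%N. Proof. by move: N0; rewrite N_eq; case: (e) => //; rewrite muln0. Qed.

Definition chiZ (y : F) : int := if y == 0 then 0 else (-1) ^+ dlog g y.

Lemma chiZE y : chi g y = (chiZ y)%:~R.
Proof. by rewrite /chi /mchar /chiZ; case: eqP => // _; rewrite rmorphXn rmorphN. Qed.

(** J(w) - q as a polynomial in w. *)
Definition Jpoly : {poly int} := \sum_(a < N) (chiZ (1 + g ^+ a))%:P * 'X^a - q%:R%:P.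

(** All the 2 d complex roots of X^(2d) + 1 are roots, and the remainder has too
    small a degree to have so many. *)
Lemma Jpoly_dvd : exists U, Jpoly = U * ('X^(2 * d) + 1).
Proof.
have d20 : (0 < 2 * d)%N by rewrite muln_gt0.
have mh : 'X^(2 * d) + 1 \is @monic int by rewrite monicXnaddC.
pose r := Pdiv.Ring.rmodp Jpoly ('X^(2 * d) + 1).
have eD := Pdiv.RingMonic.rdivp_eq mh Jpoly; rewrite -/r in eD.
have sr : (size r <= 2 * d)%N.
  by rewrite -ltnS -(size_XnaddC (1 : int) d20) Pdiv.Ring.ltn_rmodpN0 // monic_neq0.
exists (Pdiv.Ring.rdivp Jpoly ('X^(2 * d) + 1)); rewrite {1}eD.
suff -> : r = 0 by rewrite addr0.
pose rC : {poly algC} := map_poly intr r.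
have sC : size rC = size r by rewrite size_map_inj_poly //; exact: intr_inj.
pose s := [seq w <- unity_roots (2 * (2 * d)) | w ^+ (2 * d) == -1].
have size_s : size s = (2 * d)%N.
  have := sum_unity_half d20; rewrite -(natr_sum _ _ _ (fun=> 1%N)) sum1_count.
  by move/eqP; rewrite eqr_nat size_filter => /eqP.
have rC0 : rC = 0.
  apply/eqP; apply: contraTT isT => rn0.
  have : (size s < size rC)%N.
    apply: max_poly_roots => //; last by rewrite filter_uniq // uniq_unity_roots.
    apply/allP => w; rewrite mem_filter => /andP[/eqP wd _].
    have wN : w ^+ N = 1.
      have -> : (N = 2 * d * (2 * e))%N by rewrite N_eq; ring.
      by rewrite exprM wd exprM sqrrN !expr1n.
    have : (map_poly intr Jpoly).[w] = 0.
      rewrite rmorphB rmorph_sum /= hornerD hornerN horner_sum map_polyC hornerC /=.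
      rewrite rmorph_nat -(JsumE wd) /Jsum (sum_prim prim_g) mchar0 mul0r add0r.
      apply/eqP; rewrite subr_eq0; apply/eqP; apply: eq_bigr => a _.
      by rewrite rmorphM /= map_polyC map_polyXn hornerM hornerC hornerXn mcharX // chiZE mulrC.
    rewrite eD rmorphD rmorphM /= hornerD hornerM rmorphD /= map_polyXn rmorph1 hornerD hornerXn hornerC.
    by rewrite wd addNr mulr0 add0r => rw; apply/rootP.
  by rewrite sC size_s ltnNge sr.
by apply/eqP; rewrite -size_poly_eq0 -sC rC0 size_poly0.
Qed.

Variables (j : nat).
Hypothesis odd_j : odd j.

(** Let T be an approximate Teichmueller lift of g modulo p^(n+1).  Substituting
    z = T^(e j) for w in the identity J(w) = q, and replacing chi (1 + g^a) by
    the power N' of its lift, which is (1 + T^a)^N', the binomial theorem and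
    orthogonality express q modulo p^(n+1) as N times a sum of binomial
    coefficients.  If the count c were larger than n they would all be divisible
    by p^(n+1), and so would be q = p^n. *)
Lemma count_lower_half : (\sum_(t < n * 2) ((p ^ t * j) %% (4 * d) < 2 * d) <= n)%N.
Proof.
rewrite leqNgt; apply/negP; set c := (\sum_(t < _) _)%N => n_lt_c.
have [f [mf evf kerf]] := lifted_minpoly_exists g pF.
pose m0 := (n * 2 * n.+1)%N; pose R := (p ^ m0)%N.
have Rpos : (0 < R)%N by rewrite expn_gt0 prime_gt0.
have le_k : (n.+1 <= m0.+1)%N.
  by rewrite ltnS /m0 -mulnA leq_pmulr // muln_gt0.
pose T : {poly int} := 'X^R.
have frob A B : ev g A = ev g B -> pcong p f n.+1 (A ^+ R) (B ^+ R).
  by move=> h; apply: pidealW le_k _; exact: (pcong_frobn kerf m0 h).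
have evT : ev g T = g.
  rewrite rmorphXn /= evX /R /m0 expnM -card_F.
  by elim: (n.+1) => [|k IH]; rewrite ?expr1 // expnSr exprM IH expf_card.
have g2 : g ^+ (2 * d * e) = -1.
  have : (g ^+ (2 * d * e)) ^+ 2 == 1.
    rewrite -exprM (_ : 2 * d * e * 2 = N)%N ?(prim_expr_order prim_g) //.
    by rewrite N_eq; ring.
  rewrite sqrf_eq1 => /orP[|/eqP //]; rewrite -(prim_order_dvd prim_g) => /dvdn_leq.
  rewrite !muln_gt0 d0 e0 N_eq /= -!mulnA leq_pmul2r ?muln_gt0 ?d0 ?e0 //.
  by move=> /(_ isT).
have T2 : pcong p f n.+1 (T ^+ (2 * d * e)) (-1).
  have := frob ('X^(2 * d * e)) (-1); rewrite rmorphXn /= evX rmorphN1 g2 => /(_ erefl).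
  by rewrite exprAC -signr_odd oddX odd_p orbT expr1.
have chiT A y : ev g A = y -> pcong p f n.+1 ((A ^+ R) ^+ (2 * d * e)) (chiZ y)%:P.
  move=> evA; have [y0|y0] := eqVneq y 0.
    rewrite y0 /chiZ eqxx; have : ev g A = ev g 0 by rewrite rmorph0 evA.
    move/frob => /(pcongX (2 * d * e)).
    have z0 : (0 : {poly int}) ^+ R = 0 by rewrite expr0n eqn0Ngt Rpos.
    have z1 : (0 : {poly int}) ^+ (2 * d * e) = 0.
      by rewrite expr0n eqn0Ngt !muln_gt0 d0 e0.
    by rewrite z0 z1.
  have [_ yb] := dlogP prim_g y0.
  have : ev g A = ev g ('X^(dlog g y)) by rewrite rmorphXn /= evX yb evA.
  move/frob => /(pcongX (2 * d * e)) h; apply: pcong_trans h _.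
  rewrite /chiZ (negPf y0) rmorphXn rmorphN1.
  have -> : ('X^(dlog g y) ^+ R) ^+ (2 * d * e) = (T ^+ (2 * d * e)) ^+ dlog g y.
    by rewrite /T -!exprM; congr (_ ^+ _); ring.
  exact: (pcongX (dlog g y) T2).
have sumT b : pcong p f n.+1 (\sum_(a < N) T ^+ (a * b)) (if (N %| b)%N then N%:R else 0).
  have TN : pcong p f n.+1 (T ^+ N) 1.
    have := frob ('X^N) 1; rewrite rmorphXn rmorph1 /= evX prim_expr_order // => /(_ erefl).
    by rewrite exprAC expr1n.
  case: ifP => [/dvdnP[b' ->]|nb].
    rewrite -[N in N%:R]card_ord -sumr_const; apply: pcong_sum => a _.
    have := pcongX (a * b') TN; rewrite expr1n -exprM.
    by rewrite (_ : N * (a * b') = a * (b' * N))%N //; ring.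
  rewrite /pcong subr0; apply: (pideal_cancel pF mf evf kerf (u := T ^+ b - 1)).
    rewrite rmorphB rmorphXn rmorph1 /= evT subr_eq0 -(prim_order_dvd prim_g).
    by rewrite nb.
  under eq_bigr do rewrite mulnC exprM.
  rewrite -subrX1 -exprM mulnC exprM.
  by have := pcongX b TN; rewrite expr1n.
pose z := T ^+ (e * j).
have z2 : pcong p f n.+1 (z ^+ (2 * d)) (-1).
  rewrite -exprM (_ : e * j * (2 * d) = 2 * d * e * j)%N; last by ring.
  rewrite exprM; have := pcongX j T2.
  by rewrite -[(-1) ^+ j]signr_odd odd_j.
have sumz : pcong p f n.+1 (\sum_(a < N) (chiZ (1 + g ^+ a))%:P * z ^+ a) q%:R%:P.
  have [U eU] := Jpoly_dvd; have := congr1 (fun P => P \Po z) eU.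
  rewrite /Jpoly comp_polyB comp_polyM comp_polyD comp_polyC comp_Xn_poly -polyC1 comp_polyC polyC1.
  rewrite raddf_sum /= => eS; rewrite /pcong.
  have -> : \sum_(a < N) (chiZ (1 + g ^+ a))%:P * z ^+ a =
            \sum_(a < N) ((chiZ (1 + g ^+ a))%:P * 'X^a \Po z).
    by apply: eq_bigr => a _; rewrite comp_polyM comp_polyC comp_Xn_poly.
  rewrite eS; apply: pidealM.
  by move: z2; rewrite /pcong opprK.
pose N' := (R * (2 * d * e))%N.
pose Z : int := \sum_(i < N'.+1) if (N %| e * j + i)%N then ('C(N', i) * N)%:R else 0.
have qZ : pcong p f n.+1 q%:R%:P Z%:P.
  apply: pcong_trans (pcong_sym sumz) _.
  have step1 : pcong p f n.+1 (\sum_(a < N) (chiZ (1 + g ^+ a))%:P * z ^+ a)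
                 (\sum_(a < N) (1 + T ^+ a) ^+ N' * z ^+ a).
    apply: pcong_sum => a _; apply: pcongM; last exact: pcong_refl.
    apply: pcong_sym; rewrite exprM; apply: chiT.
    by rewrite rmorphD rmorphXn rmorph1 /= evT.
  apply: pcong_trans step1 _.
  have -> : \sum_(a < N) (1 + T ^+ a) ^+ N' * z ^+ a =
      \sum_(i < N'.+1) 'C(N', i)%:R * \sum_(a < N) T ^+ (a * (e * j + i)).
    under [RHS]eq_bigr do rewrite mulr_sumr.
    rewrite [RHS]exchange_big /=; apply: eq_bigr => a _.
    rewrite exprDn mulr_suml; apply: eq_bigr => i _.
    rewrite expr1n mul1r -mulr_natl -mulrA -!exprM -exprD; congr (_ * _ ^+ _).
    by ring.
  have -> : Z%:P = \sum_(i < N'.+1) 'C(N', i)%:R * (if (N %| e * j + i)%N then N%:R else 0).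
    rewrite raddf_sum; apply: eq_bigr => i _; case: ifP => _ /=; last by rewrite mulr0 polyC0.
    by rewrite polyC_natr natrM.
  by apply: pcong_sum => i _; apply: pcongM; [exact: pcong_refl|exact: sumT].
have dvdqZ : (p%:Z ^+ n.+1 %| q%:R - Z)%Z.
  by apply: (pideal_int pF mf evf); move: qZ; rewrite /pcong -polyCB.
have dvdZ : (p%:Z ^+ n.+1 %| Z)%Z.
  apply: rpred_sum => i _; case: ifP => [di|_]; last exact: dvdz0.
  rewrite dvdzE abszX natz !absz_nat dvdn_mulr //.
  have N_eq' : ((p ^ (n * 2)).-1 = 4 * d * e)%N by rewrite -card_F N_eq.
  have half : ((p ^ (n * 2))./2 = 2 * d * e)%N.
    have := odd_double_half (p ^ (n * 2))%N; rewrite oddX odd_p orbT.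
    by move=> e1; move: N_eq'; rewrite -{1}e1; clear; nia.
  have le_i : (i <= p ^ (n * 2 * n.+1) * (p ^ (n * 2))./2)%N by rewrite half -ltnS.
  have di' : ((p ^ (n * 2)).-1 %| e * j + i)%N by rewrite -card_F.
  have := logn_bin_lower pr_p odd_p n_gt0 N_eq' odd_j le_i di'.
  rewrite half -/R -/N' -/c => /(leq_trans n_lt_c) lower.
  by rewrite pfactor_dvdn // bin_gt0 -ltnS.
have : (p%:Z ^+ n.+1 %| q%:R)%Z by rewrite -[q%:R](subrK Z) rpredD.
by rewrite dvdzE abszX natz !absz_nat dvdn_Pexp2l ?prime_gt1 // ltnn.
Qed.

End Stickelberger.

Section SineTable.

Import Rdefinitions Rtrigo_def Rtrigo1 Rstruct.
Local Delimit Scope nat_scope with N.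

Local Notation R := Rdefinitions.R.
Local Open Scope ring_scope.

Lemma sin_seriesE T (x : R) :
  sin_series T x = \sum_(k < T) sin (Rmult (2 * k + 1)%N%:R x) / (2 * k + 1)%N%:R.
Proof.
elim: T => [|T IH] /=; first by rewrite big_ord0.
rewrite IH big_ord_recr /= RplusE; congr (_ + _).
have -> : (2 * Raxioms.INR T + 1)%R = (2 * T + 1)%N%:R :> R.
  by rewrite RplusE RmultE INRE natrD natrM.
by rewrite RdivE !RmultE.
Qed.

(** The values of sine and cosine at the multiples of pi / (2 d), reduced to
    the properties that the Fourier analysis modulo 4 d uses. *)
Lemma sine_table (d : nat) : (0 < d)%N ->
  exists (A : archiRealFieldType) (s c : nat -> A),
  [/\ forall m n, s (m + n)%N = s m * c n + c m * s n,
      forall m n, c (m + n)%N = c m * c n - s m * s n,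
      [/\ s 0%N = 0, c 0%N = 1, s d = 1 & c d = 0],
      forall m, (0 < m <= d)%N -> 0 < s m &
      forall m, (0 < m <= d)%N -> exists C : A, forall T, (0 < T)%N ->
        `|\sum_(k < T) s (m * (2 * k + 1))%N / (2 * k + 1)%N%:R
          - \sum_(k < T) s (d * (2 * k + 1))%N / (2 * k + 1)%N%:R| <= C / T%:R].
Proof.
move=> d0; pose t : R := (PI / 2)%R / d%:R.
have dn0 : d%:R != 0 :> R by rewrite pnatr_eq0 -lt0n.
have td : d%:R * t = (PI / 2)%R by rewrite /t mulrC divfK.
have t0 : 0 < t.
  apply: divr_gt0; last by rewrite ltr0n.
  by apply/RltP; exact: PI2_RGT_0.
pose f (m : nat) : R := m%:R * t.
have fD m n : f (m + n)%N = f m + f n by rewrite /f natrD mulrDl.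
exists R, (fun m => sin (f m)), (fun m => cos (f m)).
split.
- by move=> m n; rewrite fD sinD.
- by move=> m n; rewrite fD cosD.
- by rewrite /f !mul0r td; split; [exact: sin_0|exact: cos_0|exact: sin_PI2|exact: cos_PI2].
- move=> m /andP[m0 md]; apply/RltP; apply: sin_gt_0; apply/RltP.
    by rewrite mulr_gt0 ?ltr0n.
  apply: (@le_lt_trans _ _ (PI / 2)%R); last by apply/RltP; exact: PI2_Rlt_PI.
  by rewrite -td /f ler_pM2r ?ler_nat.
- move=> m /andP[m0 md].
  have [|C HC] := @sin_series_bound (f m).
    split; first by apply/RltP; rewrite mulr_gt0 ?ltr0n.
    by apply/RleP; rewrite -td /f ler_pM2r ?ler_nat.
  exists C => T T0; have Tn0 : T <> 0%N by case: (T) T0.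
  have /RleP := HC T Tn0; rewrite RabsE RminusE !sin_seriesE -td RdivE -/(f d) INRE.
  have E u : \sum_(k < T) sin (Rmult (2 * k + 1)%N%:R (f u)) / (2 * k + 1)%N%:R
     = \sum_(k < T) sin (f (u * (2 * k + 1))%N) / (2 * k + 1)%N%:R :> R.
    by apply: eq_bigr => k _; rewrite RmultE /f mulrA -natrM mulnC.
  by rewrite !E.
Qed.

End SineTable.

Lemma periodic_mod (T : Type) (M : nat) (f : nat -> T) :
  (forall m, f (m + M)%N = f m) -> forall m, f (m %% M)%N = f m.
Proof.
move=> fM m; rewrite [in RHS](divn_eq m M) addnC.
move: (m %% M)%N (m %/ M)%N => r; elim=> [|k IH]; rewrite ?mul0n ?addn0 //.
by rewrite mulSnr addnA fM.
Qed.

Section PeriodicSums.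

Variables (V : nmodType) (M : nat) (f : nat -> V).
Hypothesis M_gt0 : (0 < M)%N.
Hypothesis f_mod : forall x, f (x %% M)%N = f x.

Lemma periodic_reindex (h : nat -> nat) :
  (forall a b, h a = h b %[mod M] -> a = b %[mod M]) ->
  \sum_(a < M) f (h a) = \sum_(a < M) f a.
Proof.
move=> h_inj.
rewrite [RHS](reindex_inj (h := fun a : 'I_M => Ordinal (ltn_pmod (h a) M_gt0))).
  by apply: eq_bigr => a _ /=; rewrite f_mod.
move=> a b /(congr1 val) /= /h_inj; rewrite !modn_small // => ab.
exact: val_inj.
Qed.

Lemma periodic_reindexD k : \sum_(a < M) f (a + k)%N = \sum_(a < M) f a.
Proof. by apply: (periodic_reindex (h := addn^~ k)) => a b /eqP; rewrite eqn_modDr => /eqP. Qed.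

Lemma periodic_reindexM k : coprime k M ->
  \sum_(a < M) f (k * a)%N = \sum_(a < M) f a.
Proof.
move=> kM; apply: (periodic_reindex (h := muln k)) => a b /eqP.
have [ab|ab] := leqP b a.
  rewrite eqn_mod_dvd ?leq_mul2l ?ab ?orbT // -mulnBr Gauss_dvdr 1?coprime_sym //.
  by rewrite -eqn_mod_dvd // => /eqP.
rewrite eq_sym eqn_mod_dvd ?leq_mul2l ?(ltnW ab) ?orbT // -mulnBr Gauss_dvdr 1?coprime_sym //.
by rewrite -eqn_mod_dvd 1?ltnW // => /eqP.
Qed.

End PeriodicSums.

(** * Odd periodic functions and their harmonic sums *)

Section SineTransform.

Variables (d : nat) (A : archiRealFieldType) (s c : nat -> A).
Hypothesis d_gt0 : (0 < d)%N.
Hypothesis sD : forall m n, s (m + n)%N = s m * c n + c m * s n.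
Hypothesis cD : forall m n, c (m + n)%N = c m * c n - s m * s n.
Hypothesis s0 : s 0%N = 0.
Hypothesis c0 : c 0%N = 1.
Hypothesis s_d : s d = 1.
Hypothesis c_d : c d = 0.
Hypothesis s_gt0 : forall m, (0 < m <= d)%N -> 0 < s m.
Local Notation M := (4 * d)%N.

Let M_gt0 : (0 < M)%N. Proof. by rewrite muln_gt0. Qed.

Lemma s_2d : s (2 * d) = 0.
Proof. by rewrite mul2n -addnn sD s_d c_d !mulr0 mul0r addr0. Qed.
Lemma c_2d : c (2 * d) = -1.
Proof. by rewrite mul2n -addnn cD s_d c_d mulr0 mulr1 sub0r. Qed.
Lemma sD2d m : s (m + 2 * d) = - s m.
Proof. by rewrite sD s_2d c_2d mulr0 addr0 mulrN1. Qed.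
Lemma cD2d m : c (m + 2 * d) = - c m.
Proof. by rewrite cD s_2d c_2d mulr0 subr0 mulrN1. Qed.
Lemma sD_odd m k : s (m + 2 * d * k) = (-1) ^+ k * s m.
Proof.
elim: k => [|k IH]; first by rewrite muln0 addn0 mul1r.
by rewrite mulnS addnCA addnC sD2d IH exprS mulN1r mulNr.
Qed.
Lemma sDM m : s (m + M) = s m.
Proof. have -> : (m + M = m + 2 * d * 2)%N by clear; lia.
by rewrite sD_odd sqrrN expr1n mul1r. Qed.
Lemma cDM m : c (m + M) = c m.
Proof. have -> : (m + M = m + 2 * d + 2 * d)%N by clear; lia.
by rewrite !cD2d opprK. Qed.

Lemma s_mod m : s (m %% M) = s m. Proof. exact: periodic_mod sDM m. Qed.
Lemma c_mod m : c (m %% M) = c m. Proof. exact: periodic_mod cDM m. Qed.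

(** The norm c^2 + s^2 is multiplicative along m, and it is 1 at m = d. *)
Lemma c2s2 m : c m ^+ 2 + s m ^+ 2 = 1.
Proof.
pose nm k := c k ^+ 2 + s k ^+ 2.
have nmX k : nm k = nm 1%N ^+ k.
  elim: k => [|k IH]; first by rewrite /nm s0 c0 expr0; ring.
  by rewrite exprS -IH /nm -[k.+1]add1n cD sD; ring.
have nm1 : nm 1%N = 1.
  have nm_ge0 : 0 <= nm 1%N by rewrite addr_ge0 ?sqr_ge0.
  have : nm d = 1 by rewrite /nm s_d c_d; ring.
  by rewrite nmX => /eqP; rewrite pexpr_eq1 // => /eqP.
by rewrite -/(nm m) nmX nm1 expr1n.
Qed.

(** The reflection of angles that add up to an odd multiple of pi. *)
Lemma s_reflect x y k : (x + y = 2 * d * (2 * k + 1))%N -> s y = s x.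
Proof.
move=> xy; have e1 : s (x + y)%N = 0 by rewrite xy -[X in s X]add0n sD_odd s0 mulr0.
have e2 : c (x + y)%N = -1.
  have : c (x + y)%N ^+ 2 + s (x + y)%N ^+ 2 = 1 := c2s2 _.
  rewrite xy (_ : 2 * d * (2 * k + 1) = k * M + 2 * d)%N; last by clear; lia.
  by rewrite -c_mod modnMDl c_mod c_2d.
have e3 := c2s2 x.
rewrite sD in e1; rewrite cD in e2.
rewrite -[s y]mulr1 -e3.
have -> : s y * (c x ^+ 2 + s x ^+ 2) = c x * (s x * c y + c x * s y)
   - s x * (c x * c y - s x * s y) by ring.
by rewrite e1 e2; ring.
Qed.

Lemma s_lower m : (0 < m < 2 * d)%N -> 0 < s m.
Proof.
move=> /andP[m0 m2]; have [md|md] := leqP m d; first by rewrite s_gt0 ?m0.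
rewrite (@s_reflect (2 * d - m) m 0); first by apply: s_gt0; lia.
lia.
Qed.

(** The table has exact period 4 d: this rests on the positivity of the sine on
    the lower half of the circle. *)
Lemma c_neq1 m : ~~ (M %| m)%N -> c m != 1.
Proof.
move=> Mm; rewrite -c_mod; have := ltn_pmod m M_gt0.
have : (0 < m %% M)%N by rewrite lt0n.
move: (m %% M)%N => {Mm} m m0 mM; apply/eqP => c1.
have sm0 : s m = 0.
  by have := c2s2 m; rewrite c1 expr1n => /eqP; rewrite -subr_eq0 addrAC subrr add0r sqrf_eq0 => /eqP.
have [m2|m2] := ltnP m (2 * d).
  by have := s_lower (introT andP (conj m0 m2)); rewrite sm0 ltxx.
have [/eqP|mn] := eqVneq m (2 * d)%N.
  by move=> /eqP me; move: c1; rewrite me c_2d => /eqP; rewrite eq_sym -subr_eq0 opprK (pnatr_eq0 A 2).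
have : 0 < s (m - 2 * d) by apply: s_lower; lia.
by rewrite -oppr_lt0 -sD2d subnK // sm0 ltxx.
Qed.

(** Orthogonality: shifting the index by one rotates the vector of the cosine and
    sine sums, so it is 0 unless the rotation is trivial. *)
Lemma sum_c m : \sum_(j < M) c (j * m) = if (M %| m)%N then M%:R else 0.
Proof.
case: ifP => [/dvdnP[k ->]|/negbT Mm].
  rewrite (eq_bigr (fun=> 1)) ?sumr_const ?card_ord // => j _.
  by rewrite mulnA -c_mod modnMl c0.
have c1 := c_neq1 Mm.
pose S := \sum_(j < M) c (j * m); pose S' := \sum_(j < M) s (j * m).
have cP x : c ((x %% M) * m) = c (x * m) by rewrite -c_mod modnMml c_mod.
have sP x : s ((x %% M) * m) = s (x * m) by rewrite -s_mod modnMml s_mod.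
have e1 : S = S * c m - S' * s m.
  rewrite -{1}/S -[LHS](periodic_reindexD (f := fun j => c (j * m)) M_gt0 cP 1).
  rewrite !mulr_suml -sumrB; apply: eq_bigr => j _.
  by rewrite mulnDl mul1n cD.
have e2 : S' = S * s m + S' * c m.
  rewrite -{1}/S' -[LHS](periodic_reindexD (f := fun j => s (j * m)) M_gt0 sP 1).
  rewrite !mulr_suml -big_split /=; apply: eq_bigr => j _.
  by rewrite mulnDl mul1n sD addrC.
have e : S * ((1 - c m) ^+ 2 + s m ^+ 2) = 0.
  have e1' : S * (1 - c m) = - (S' * s m) by rewrite {1}mulrBr mulr1 {1}e1; ring.
  have e2' : S' * (1 - c m) = S * s m by rewrite {1}mulrBr mulr1 {1}e2; ring.
  rewrite mulrDr expr2 mulrA e1'.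
  have -> : - (S' * s m) * (1 - c m) = - (S' * (1 - c m)) * s m by ring.
  by rewrite e2'; ring.
move/eqP: e; rewrite mulf_eq0 => /orP[/eqP //|].
rewrite paddr_eq0 ?sqr_ge0 // sqrf_eq0 subr_eq0 eq_sym => /andP[/eqP e].
by rewrite e eqxx in c1.
Qed.

Variables (g : nat -> A).
Hypothesis gDM : forall x, g (x + M)%N = g x.
Hypothesis gD2d : forall x, g (x + 2 * d)%N = - g x.
Hypothesis g_opp : forall x, (x <= M)%N -> g (M - x)%N = - g x.

Let g_mod x : g (x %% M) = g x. Proof. exact: periodic_mod gDM x. Qed.

Definition sine_transform (j : nat) : A := \sum_(a < M) g a * s (j * a).
Local Notation gh := sine_transform.

Let gs_mod j x : g (x %% M) * s (j * (x %% M)) = g x * s (j * x).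
Proof. by rewrite g_mod -s_mod modnMmr s_mod. Qed.

(** The anti-periodicity of g for the half period kills the even frequencies. *)
Lemma sine_transform_even j : ~~ odd j -> gh j = 0.
Proof.
move=> ev_j; have e : gh j = - gh j.
  rewrite -{1}[gh j](periodic_reindexD (f := fun a => g a * s (j * a)) M_gt0 (gs_mod j) (2 * d)).
  rewrite -sumrN; apply: eq_bigr => a _.
  by rewrite gD2d mulnDr [(j * (2 * d))%N]mulnC sD_odd -signr_odd (negPf ev_j) mul1r mulNr.
have /eqP : gh j *+ 2 = 0 by rewrite mulr2n {1}e addNr.
by rewrite mulrn_eq0 /= => /eqP.
Qed.

Lemma sine_transformM p : coprime p M -> (forall x, g (p * x)%N = g x) ->
  forall j, gh (p * j) = gh j.
Proof.
move=> pM gp j; rewrite -[RHS](periodic_reindexM (f := fun a => g a * s (j * a)) M_gt0 (gs_mod j) pM).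
by apply: eq_bigr => a _; rewrite gp mulnCA mulnA.
Qed.

(** (M - 1) m stands for - m, which natural numbers lack. *)
Lemma opposite_angle m : s (M.-1 * m) = - s m /\ c (M.-1 * m) = c m.
Proof.
have h : s (M.-1 * m + m) = 0.
  by rewrite -[X in (_ + X)%N]mul1n -mulnDl addn1 prednK // -s_mod modnMr s0.
have h' : c (M.-1 * m + m) = 1.
  by rewrite -[X in (_ + X)%N]mul1n -mulnDl addn1 prednK // -c_mod modnMr c0.
have e := c2s2 m; rewrite sD in h; rewrite cD in h'.
rewrite -[s (_ * _)%N]mulr1 -[c (M.-1 * _)]mulr1 -e.
set u := s (_ * _)%N in h h' *; set v := c (M.-1 * _) in h h' *; split.
  have -> : u * (c m ^+ 2 + s m ^+ 2) = c m * (u * c m + v * s m) - s m * (v * c m - u * s m) by ring.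
  by rewrite h h'; ring.
have -> : v * (c m ^+ 2 + s m ^+ 2) = c m * (v * c m - u * s m) + s m * (u * c m + v * s m) by ring.
by rewrite h h'; ring.
Qed.

(** An odd function is the inverse transform of its sine transform; the product
    of two sines is half a difference of cosines, and the two resulting delta
    functions, at x and - x, add up as g is odd. *)
Lemma sine_inversion x : \sum_(j < M) gh j * s (j * x) = M%:R * g x.
Proof.
wlog xM : x / (x < M)%N.
  move=> H; rewrite -g_mod -(H _ (ltn_pmod x M_gt0)).
  by apply: eq_bigr => j _; rewrite -[s (_ * x)]s_mod -modnMmr s_mod.
have two0 : 2%:R != 0 :> A by rewrite pnatr_eq0.
apply: (mulfI two0).
transitivity (\sum_(a < M) g a * (\sum_(j < M) c (j * (a + M.-1 * x)) - \sum_(j < M) c (j * (a + x)))).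
  rewrite mulr_sumr; under [RHS]eq_bigr do rewrite -sumrB mulr_sumr.
  rewrite [RHS]exchange_big; apply: eq_bigr => j _ /=.
  rewrite mulr_suml mulr_sumr; apply: eq_bigr => a _.
  by rewrite !mulnDr !cD [(j * (M.-1 * x))%N]mulnCA !(opposite_angle _).1 !(opposite_angle _).2; ring.
under eq_bigr do rewrite !sum_c mulrBr.
rewrite sumrB (bigD1 (Ordinal xM)) //= big1 => [|a]; last first.
  move=> ax; rewrite ifF ?mulr0 //; apply: contraNF ax => Ma.
  apply/eqP/val_inj => /=.
  have : (a + M.-1 * x + x == x %[mod M])%N by rewrite -(modnDml _ x) (eqP Ma).
  rewrite -addnA -[X in (_ + (_ + X))%N]mul1n -mulnDl addn1 prednK //.
  by rewrite [(M * x)%N]mulnC addnC modnMDl !modn_small // => /eqP.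
rewrite ifT; last first.
  by rewrite -[X in (X + _)%N]mul1n -mulnDl add1n prednK // dvdn_mulr.
have x'M : ((M - x) %% M < M)%N by rewrite ltn_pmod.
rewrite (bigD1 (Ordinal x'M)) //= big1 => [|a]; last first.
  move=> ax; rewrite ifF ?mulr0 //; apply: contraNF ax => Ma.
  apply/eqP/val_inj => /=; rewrite -[LHS](modn_small (ltn_ord a)).
  by apply/eqP; rewrite -(eqn_modDr x) subnK 1?ltnW // modnn.
rewrite ifT; last by rewrite /dvdn modnDml subnK ?modnn // ltnW.
rewrite g_mod g_opp 1?ltnW //; ring.
Qed.

Definition half_sign (j : nat) : A :=
  if odd j then if (j %% M < 2 * d)%N then 1 else -1 else 0.
Local Notation eps := half_sign.

Definition sine_series (T j : nat) : A :=
  \sum_(k < T) s (j * (2 * k + 1))%N / (2 * k + 1)%N%:R.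

Hypothesis s_bound : forall m, (0 < m <= d)%N -> exists C : A, forall T, (0 < T)%N ->
  `|sine_series T m - sine_series T d| <= C / T%:R.

(** The partial sums at the odd multiples j of pi / (2 d) converge to pi / 4 or
    - pi / 4 according to the half of the circle in which j lies. *)
Lemma sine_series_half j : (j < M)%N -> odd j ->
  exists C : A, forall T, (0 < T)%N ->
  `|sine_series T j - eps j * sine_series T d| <= C / T%:R.
Proof.
have lower i : (0 < i < 2 * d)%N -> exists C : A, forall T, (0 < T)%N ->
    `|sine_series T i - sine_series T d| <= C / T%:R.
  move=> /andP[i0 i2]; have [id|di] := leqP i d; first by apply: s_bound; rewrite i0.
  have [|C HC] := @s_bound (2 * d - i); first by clear -i2 di; lia.
  exists C => T T0; rewrite (_ : sine_series T i = sine_series T (2 * d - i)) ?HC //.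
  apply: eq_bigr => k _; congr (_ / _); apply: (@s_reflect _ _ k).
  by rewrite -mulnDl subnK // ltnW.
move=> jM odd_j; have jn : j != (2 * d)%N by apply: contraTneq odd_j => ->; rewrite oddM.
have j0 : (0 < j)%N by case: (j) odd_j.
rewrite /eps odd_j modn_small //; case: ltnP => j2.
  have [|C HC] := lower j; first by rewrite j0.
  by exists C => T T0; rewrite mul1r HC.
have [|C HC] := lower (j - 2 * d)%N; first by clear -j2 jM jn; lia.
exists C => T T0; rewrite mulN1r opprK -normrN opprD.
rewrite (_ : - sine_series T j = sine_series T (j - 2 * d)) ?HC //.
rewrite /sine_series -sumrN; apply: eq_bigr => k _; rewrite -mulNr; congr (_ / _).
rewrite -{1}(subnK j2) mulnDl sD_odd -signr_odd oddD oddM /= expr1.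
by rewrite mulN1r opprK.
Qed.

Variables (p n : nat).
Hypotheses (p_M : coprime p M) (n_gt0 : (0 < n)%N).
Hypothesis g_p : forall x, g (p * x)%N = g x.
Hypothesis balanced : forall j, odd j ->
  (\sum_(t < n * 2) ((p ^ t * j) %% M < 2 * d))%N = n.

Lemma half_sign_balanced j : \sum_(t < n * 2) eps (p ^ t * j) = 0.
Proof.
have odd_p : odd p.
  have : coprime p 2 by apply: coprime_dvdr p_M; exact: dvdn_mulr.
  by rewrite coprimen2.
have oddE t : odd (p ^ t * j) = odd j by rewrite oddM oddX odd_p orbT.
rewrite /eps; under eq_bigr do rewrite oddE.
have [oj|_] := boolP (odd j); last by rewrite big1.
rewrite (eq_bigr (fun t : 'I_(n * 2) => (2 * ((p ^ t * j) %% M < 2 * d))%N%:R - 1)).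
  rewrite sumrB sumr_const card_ord -natr_sum -big_distrr balanced //=.
  by rewrite mulnC subrr.
by move=> t _; case: (_ < _)%N; rewrite ?muln1 ?muln0; ring.
Qed.

(** Averaging over the powers of p, which do not change the transform. *)
Lemma sine_transform_half : \sum_(j < M) gh j * eps j = 0.
Proof.
have eps_mod j : gh (j %% M) * eps (j %% M) = gh j * eps j.
  congr (_ * _).
    by apply: eq_bigr => a _; rewrite -[s (j * a)]s_mod -modnMml s_mod.
  by rewrite /eps modn_mod; congr (if _ then _ else _); rewrite odd_mod // oddM.
have gh_p t j : gh (p ^ t * j) = gh j.
  by elim: t => [|t IH]; rewrite ?mul1n // expnS -mulnA sine_transformM.
apply/eqP; have n2 : (n * 2 != 0)%N by rewrite -lt0n muln_gt0 n_gt0.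
have : (\sum_(j < M) gh j * eps j) *+ (n * 2) = 0.
  rewrite -[X in _ *+ X]card_ord -sumr_const.
  transitivity (\sum_(t < n * 2) \sum_(j < M) gh j * eps (p ^ t * j)).
    apply: eq_bigr => t _.
    rewrite -(periodic_reindexM M_gt0 eps_mod (coprimeXl t p_M)).
    by apply: eq_bigr => j _; rewrite gh_p.
  rewrite exchange_big big1 //= => j _; by rewrite -mulr_sumr half_sign_balanced mulr0.
by move/eqP; rewrite mulrn_eq0 (negPf n2).
Qed.

(** By inversion the harmonic sum of g is a combination of sine sums.  Each of
    them is the sum at d up to a sign and O(1 / T), and the signs cancel. *)
Lemma harmonic_bound_field : exists C : A, forall T, (0 < T)%N ->
  `|\sum_(k < T) g (2 * k + 1)%N / (2 * k + 1)%N%:R| <= C / T%:R.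
Proof.
have /fin_all_exists[C HC] (j : 'I_M) : exists C : A, odd j -> forall T, (0 < T)%N ->
    `|sine_series T j - eps j * sine_series T d| <= C / T%:R.
  have [oj|] := boolP (odd j); last by exists 0.
  by have [C HC] := sine_series_half (ltn_ord j) oj; exists C.
exists (M%:R^-1 * \sum_(j < M) `|gh j| * C j) => T T0.
have Mn0 : M%:R != 0 :> A by rewrite pnatr_eq0 -lt0n.
have -> : \sum_(k < T) g (2 * k + 1)%N / (2 * k + 1)%N%:R
  = M%:R^-1 * \sum_(j < M) gh j * (sine_series T j - eps j * sine_series T d).
  under [in RHS]eq_bigr do rewrite mulrBr mulrA.
  rewrite sumrB -mulr_suml sine_transform_half mul0r subr0.
  under [in RHS]eq_bigr do rewrite mulr_sumr.
  rewrite exchange_big mulr_sumr; apply: eq_bigr => k _.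
  under [in RHS]eq_bigr do rewrite mulrA.
  by rewrite -mulr_suml sine_inversion !mulrA mulVf // mul1r.
rewrite normrM ger0_norm ?invr_ge0 ?ler0n // -mulrA ler_wpM2l ?invr_ge0 ?ler0n //.
rewrite mulr_suml; apply: (le_trans (ler_norm_sum _ _ _)); apply: ler_sum => j _.
rewrite normrM -mulrA.
have [oj|/sine_transform_even ->] := boolP (odd j); last by rewrite normr0 !mul0r.
by rewrite ler_wpM2l // HC.
Qed.

End SineTransform.

(** The sum of the series of g (m) / m is proportional to the pairing of the sine
    transform with the sign of the half circle.  The transform is constant on the
    orbits of p, and on each orbit the signs cancel; so the sum is 0, and only the
    error of the partial sums remains. *)
Theorem harmonic_bound (d p n : nat) (g : nat -> int) :
    (0 < d)%N -> (0 < n)%N -> coprime p (4 * d) ->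
    (forall x, g (x + 2 * d)%N = - g x) ->
    (forall x, (x <= 4 * d)%N -> g (4 * d - x)%N = - g x) ->
    (forall x, g (p * x)%N = g x) ->
    (forall j, odd j -> (\sum_(t < n * 2) ((p ^ t * j) %% (4 * d) < 2 * d))%N = n) ->
  exists C : nat, forall T, (0 < T)%N ->
    `|\sum_(k < T) (g (2 * k + 1)%N)%:~R / (2 * k + 1)%N%:R : rat| <= C%:R / T%:R.
Proof.
move=> d0 n0 pM g2d gN gp bal.
have [A [s [c [sD cD [s0 c0 sd cd] s_gt0 s_bound]]]] := sine_table d0.
have gM x : g (x + 4 * d)%N = g x.
  by rewrite (_ : x + 4 * d = x + 2 * d + 2 * d)%N ?g2d ?opprK //; clear; lia.
have [C HC] := @harmonic_bound_field d A s c d0 sD cD s0 c0 sd cd s_gt0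
  (fun x => (g x)%:~R) (fun x => congr1 _ (gM x)) (fun x => etrans (congr1 _ (g2d x)) (rmorphN _ _))
  (fun x xM => etrans (congr1 _ (gN x xM)) (rmorphN _ _)) s_bound p n pM n0
  (fun x => congr1 _ (gp x)) bal.
exists (Num.trunc `|C|).+1 => T T0.
rewrite -(ler_rat A) ratr_norm rmorph_sum /= fmorph_div /= !ratr_nat.
rewrite (eq_bigr (fun k : 'I_T => (g (2 * k + 1)%N)%:~R / (2 * k + 1)%N%:R : A)); last first.
  by move=> k _; rewrite fmorph_div /= ratr_int ratr_nat.
apply: (le_trans (HC T T0)); rewrite ler_wpM2r ?invr_ge0 ?ler0n //.
by apply: (le_trans (ler_norm _)); apply/ltW/truncnS_gt.
Qed.

(** * Summation by parts *)

Section SummationByParts.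

Variables (R : numDomainType) (a b : nat -> R).

Lemma abel_summation X : \sum_(i < X.+1) a i * b i =
  (\sum_(i < X.+1) a i) * b X + \sum_(i < X) (\sum_(j < i.+1) a j) * (b i - b i.+1).
Proof.
elim: X => [|X IH]; first by rewrite !big_ord_recr !big_ord0 /= !add0r addr0.
rewrite [LHS]big_ord_recr IH [X in _ = _ + X]big_ord_recr /=.
have aS : \sum_(i < X.+2) a i = \sum_(i < X.+1) a i + a X.+1 by rewrite big_ord_recr.
by rewrite aS; ring.
Qed.

Lemma abel_bound K X : (forall n, `|\sum_(i < n) a i| <= K) ->
  (forall n, b n.+1 <= b n) -> (forall n, 0 <= b n) ->
  `|\sum_(i < X) a i * b i| <= K * b 0%N.
Proof.
move=> aK b_decr b_ge0; have K0 : 0 <= K := le_trans (normr_ge0 _) (aK 0%N).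
case: X => [|X]; first by rewrite big_ord0 normr0 mulr_ge0.
rewrite abel_summation (le_trans (ler_normD _ _)) //.
have -> : b 0%N = b X + \sum_(i < X) (b i - b i.+1).
  elim: X => [|X IH]; first by rewrite big_ord0 addr0.
  by rewrite big_ord_recr IH /=; ring.
rewrite mulrDr lerD //; first by rewrite normrM (ger0_norm (b_ge0 X)) ler_wpM2r.
rewrite mulr_sumr (le_trans (ler_norm_sum _ _ _)) // ler_sum // => i _.
have bi : 0 <= b i - b i.+1 by rewrite subr_ge0.
by rewrite normrM (ger0_norm bi) ler_wpM2r.
Qed.

End SummationByParts.

(** Full periods contribute nothing. *)
Lemma periodic_sum_bound (R : numDomainType) (M : nat) (f : nat -> R) n :
  (0 < M)%N -> (forall x, f (x + M)%N = f x) -> (forall x, `|f x| <= 1) ->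
  \sum_(i < M) f i = 0 -> `|\sum_(i < n) f i| <= M%:R.
Proof.
move=> M0 fM f1 fs; elim/ltn_ind: n => n IH; have [nM|Mn] := ltnP n M.
  rewrite (le_trans (ler_norm_sum _ _ _)) // (le_trans (ler_sum _ (fun (i : 'I_n) _ => f1 i))) //.
  by rewrite sumr_const card_ord ler_nat ltnW.
rewrite -(subnKC Mn) big_split_ord /= fs add0r.
rewrite (eq_bigr (fun i : 'I__ => f i)) => [|i _]; last by rewrite addnC fM.
by apply: IH; rewrite ltn_subrL M0 (leq_trans M0).
Qed.

(** * Real characters *)

Section LambertTerms.

Variables (t : rat).
Hypotheses (t_gt0 : 0 < t) (t_lt1 : t < 1).

Let t0 : 0 <= t := ltW t_gt0.
Let t1 : t <= 1 := ltW t_lt1.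

(** In the product of the two geometric sums, pair the exponents (i, j) with
    (a - 1 - i, a - j): the two exponents of a pair add up to 2 a - 1, so the mean
    of the two powers is at least t^a. *)
Lemma geom_pair a : (a * a.+1)%N%:R * t ^+ a <=
  (\sum_(i < a) t ^+ i) * (\sum_(i < a.+1) t ^+ i).
Proof.
have pair (i : 'I_a) (j : 'I_a.+1) :
    2 * t ^+ a <= t ^+ (i + j) + t ^+ (rev_ord i + rev_ord j).
  have [z hz] : exists z, (z < a)%N /\ ((i + j = a.-1 - z /\ rev_ord i + rev_ord j = a + z)%N
     \/ (i + j = a + z /\ rev_ord i + rev_ord j = a.-1 - z)%N).
    have := ltn_ord i; have := ltn_ord j; rewrite /= => ja ia.
    have [h|h] := leqP a (i + j); first by exists (i + j - a)%N; clear -ia ja h; lia.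
    by exists (a.-1 - (i + j))%N; clear -ia ja h; lia.
  have {hz} [za hz] := hz.
  have key : 2 * t ^+ a <= t ^+ (a.-1 - z) + t ^+ (a + z).
    have e1 : t ^+ (a - z) <= t ^+ (a.-1 - z) by apply: ler_wiXn2l => //; clear; lia.
    have e2 : t ^+ a = t ^+ (a - z) * t ^+ z by rewrite -exprD subnK // ltnW.
    have e3 : t ^+ (a + z) = t ^+ (a - z) * t ^+ z * t ^+ z by rewrite exprD e2.
    have := mulr_ge0 (exprn_ge0 (a - z) t0) (sqr_ge0 (1 - t ^+ z)).
    by rewrite e3 e2; move: e1; nra.
  by case: hz => -[-> ->] //; rewrite addrC.
rewrite -(ler_pM2l (ltr0n rat 2)).
have -> : 2%:R * ((\sum_(i < a) t ^+ i) * (\sum_(i < a.+1) t ^+ i)) =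
   \sum_(i < a) \sum_(j < a.+1) (t ^+ (i + j) + t ^+ (rev_ord i + rev_ord j)).
  under [RHS]eq_bigr do rewrite big_split /=.
  rewrite big_split /= mulr_natl mulr2n big_distrlr /=; congr (_ + _).
    by apply: eq_bigr => i _; apply: eq_bigr => j _; rewrite exprD.
  rewrite [RHS](reindex_inj rev_ord_inj); apply: eq_bigr => i _.
  rewrite [RHS](reindex_inj rev_ord_inj); apply: eq_bigr => j _.
  by rewrite -exprD; congr (_ ^+ _); have := ltn_ord i; have := ltn_ord j; rewrite /=; lia.
apply: le_trans (ler_sum _ (fun i _ => ler_sum _ (fun j _ => pair i j))).
by rewrite !sumr_const !card_ord -mulrnA -[X in _ <= X]mulr_natl [in X in _ <= X]mulnC mulrCA.
Qed.

Lemma geom_ge a : a%:R * t ^+ a <= \sum_(i < a) t ^+ i.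
Proof.
rewrite -[a in a%:R]card_ord mulr_natl -sumr_const ler_sum // => i _.
by rewrite ler_wiXn2l // ltnW.
Qed.

Lemma geom_sum a : 1 - t ^+ a = (1 - t) * \sum_(i < a) t ^+ i.
Proof. by rewrite -opprB subrX1 -mulNr opprB. Qed.

Definition lambert (a : nat) : rat := t ^+ a / (1 - t ^+ a).

(** Monsky's observation: the difference of the two decreasing sequences
    1 / (a (1 - t)) and t^a / (1 - t^a) is itself decreasing. *)
Definition lambert_gap (a : nat) : rat := (a%:R * (1 - t))^-1 - lambert a.

Let onet : 0 < 1 - t. Proof. by rewrite subr_gt0. Qed.

Let geom_gt0 a : 0 < \sum_(i < a.+1) t ^+ i.
Proof.
rewrite big_ord_recl expr0 ltr_pwDl // sumr_ge0 // => i _; exact: exprn_ge0.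
Qed.

Lemma lambert_gap_ge0 a : 0 <= lambert_gap a.+1.
Proof.
rewrite /lambert_gap /lambert geom_sum; have := geom_ge a.+1; have := geom_gt0 a.
move: (\sum_(i < _) _) (t ^+ _) => u v u0.
have a0 : 0 < a.+1%:R :> rat by rewrite ltr0n.
move: (a.+1%:R) a0 => b b0 h.
have -> : (b * (1 - t))^-1 - v / ((1 - t) * u) = (u - b * v) / (b * (1 - t) * u).
  by field; rewrite !gt_eqF.
by rewrite divr_ge0 ?subr_ge0 // ltW // !mulr_gt0.
Qed.

(** The difference of two consecutive terms has the sign of the inequality of
    geom_pair. *)
Lemma lambert_gap_decr a : lambert_gap a.+2 <= lambert_gap a.+1.
Proof.
rewrite /lambert_gap /lambert !geom_sum; have := geom_pair a.+1.
have := geom_gt0 a; have := geom_gt0 a.+1; rewrite (big_ord_recr a.+1) /=.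
have gs := geom_sum a.+1; move: (\sum_(i < _) _) gs => u; rewrite [t ^+ a.+2]exprS.
have := exprn_ge0 a.+1 t0; move: (t ^+ _) => v v0 gs.
have a0 : 0 < a.+1%:R :> rat by rewrite ltr0n.
rewrite natrM -[a.+2%:R]natr1; move: (a.+1%:R) a0 => b b0 u1 u0 h.
have b1 : 0 < b + 1 by apply: addr_gt0.
rewrite -subr_ge0.
have hu : u + v - t * u = 1 by rewrite -[u]mul1r mulrA addrAC -mulrBl mulr1 -gs subrK.
have -> : (b * (1 - t))^-1 - v / ((1 - t) * u) - (((b + 1) * (1 - t))^-1 - t * v / ((1 - t) * (u + v)))
   = (u * (u + v) - b * (b + 1) * v * (u + v - t * u)) / (b * (b + 1) * (1 - t) * u * (u + v)).
  by field; rewrite !gt_eqF.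
by rewrite hu mulr1 divr_ge0 ?subr_ge0 // ltW // !mulr_gt0.
Qed.

End LambertTerms.

Lemma bernoulli (R : realDomainType) (h : R) n : -1 <= h -> 1 + n%:R * h <= (1 + h) ^+ n.
Proof.
move=> h1; have h0 : 0 <= 1 + h by rewrite -lerBlDl sub0r.
elim: n => [|n IH]; first by rewrite mul0r addr0 expr0.
apply: le_trans (_ : (1 + n%:R * h) * (1 + h) <= _); last first.
  by rewrite exprSr ler_wpM2r.
have := mulr_ge0 (ler0n R n) (sqr_ge0 h); rewrite -natr1; nra.
Qed.

Section RealCharacter.

Variables (x : nat -> int) (M C : nat).
Hypothesis x1 : x 1%N = 1.
Hypothesis xM : forall a b, x (a * b)%N = x a * x b.
Hypothesis x_val : forall a, [\/ x a = 0, x a = 1 | x a = -1].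

(** Coefficients of the product of the zeta function and of the L-series. *)
Definition divsum n : int := \sum_(a <- divisors n) x a.

Let coprime_divsum q n : prime q -> (0 < n)%N ->
  \sum_(a <- divisors (q * n) | ~~ (q %| a)%N) x a = \sum_(a <- divisors n | ~~ (q %| a)%N) x a.
Proof.
move=> pr_q n0; have qn0 : (0 < q * n)%N by rewrite muln_gt0 prime_gt0.
rewrite -big_filter -[RHS]big_filter; apply: perm_big; apply: uniq_perm; rewrite ?filter_uniq ?divisors_uniq //.
move=> a; rewrite !mem_filter -!dvdn_divisors //; case qa: (q %| a)%N => //=.
by rewrite Gauss_dvdr // coprime_sym prime_coprime // qa.
Qed.

Lemma divsum_prime q n : prime q -> (0 < n)%N ->
  divsum (q * n) = \sum_(a <- divisors n | ~~ (q %| a)%N) x a + x q * divsum n.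
Proof.
move=> pr_q n0; have qn0 : (0 < q * n)%N by rewrite muln_gt0 prime_gt0.
rewrite /divsum (bigID (fun a => q %| a)%N) /= addrC coprime_divsum //; congr (_ + _).
rewrite mulr_sumr; under [RHS]eq_bigr do rewrite -xM.
rewrite -(big_map (muln q) xpredT x) -big_filter; apply: perm_big.
have q_inj : injective (muln q).
  by move=> a b /eqP; rewrite eqn_pmul2l ?prime_gt0 // => /eqP.
apply: uniq_perm; rewrite ?filter_uniq ?map_inj_uniq ?divisors_uniq // => a.
rewrite mem_filter -dvdn_divisors //; apply/andP/mapP => [[/dvdnP[b ->]]|[b bn ->]].
  rewrite mulnC dvdn_pmul2l ?prime_gt0 // => bn; exists b => //.
  by rewrite -dvdn_divisors.
by rewrite dvdn_mulr // dvdn_pmul2l ?prime_gt0 // dvdn_divisors.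
Qed.

(** Multiplicativity, in the form needed to split off one prime at a time. *)
Lemma divsum_pexp q e m : prime q -> (0 < m)%N -> ~~ (q %| m)%N ->
  divsum (q ^ e * m) = (\sum_(i < e.+1) x q ^+ i) * divsum m.
Proof.
move=> pr_q m0 qm.
have base : \sum_(a <- divisors m | ~~ (q %| a)%N) x a = divsum m.
  rewrite /divsum big_seq_cond [RHS]big_seq; apply: eq_bigl => a.
  rewrite -dvdn_divisors //; case am: (a %| m)%N => //=.
  by apply: contra qm => /dvdn_trans->.
have step k : \sum_(a <- divisors (q ^ k * m) | ~~ (q %| a)%N) x a = divsum m.
  elim: k => [|k IH]; first by rewrite mul1n.
  by rewrite expnS -mulnA coprime_divsum // muln_gt0 expn_gt0 prime_gt0.
elim: e => [|e IH]; first by rewrite mul1n big_ord_recl big_ord0 addr0 mul1r.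
have qm0 : (0 < q ^ e * m)%N by rewrite muln_gt0 expn_gt0 prime_gt0.
rewrite expnS -mulnA (divsum_prime pr_q qm0) step IH.
rewrite [in RHS]big_ord_recl expr0 mulrDl mul1r; congr (_ + _).
rewrite mulrA; congr (_ * _); rewrite mulr_sumr.
by apply: eq_bigr => i _; rewrite exprS.
Qed.

Lemma geom_sign q e : 0 <= \sum_(i < e.+1) x q ^+ i /\
  (~~ odd e -> 1 <= \sum_(i < e.+1) x q ^+ i).
Proof.
case: (x_val q) => ->.
- rewrite big_ord_recl big1 ?addr0 // => i _; by rewrite exprS mul0r.
- under eq_bigr do rewrite expr1n.
  by rewrite sumr_const card_ord; split => //; rewrite natz.
- have -> : \sum_(i < e.+1) (-1) ^+ i = (~~ odd e)%:R :> int.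
    by elim: e => [|e IH]; rewrite big_ord_recr ?big_ord0 //= IH -signr_odd /=; case: odd.
  by case: odd.
Qed.

(** By multiplicativity only prime powers matter, and for these the sum is a
    geometric sum of ratio 0, 1 or -1. *)
Lemma divsum_ge n : (0 < n)%N ->
  0 <= divsum n /\ ((exists k, n = (k ^ 2)%N) -> 1 <= divsum n).
Proof.
elim/ltn_ind: n => n IH n0; have [n1|n1] := leqP n 1.
  have -> : n = 1%N by apply/eqP; rewrite eqn_leq n1.
  by rewrite /divsum /= big_cons big_nil x1.
pose q := pdiv n; have pr_q : prime q := pdiv_prime n1.
have [m qm en] := pfactor_coprime pr_q n0.
rewrite prime_coprime // in qm; pose e := logn q n; rewrite -/e mulnC in en.
have m0 : (0 < m)%N by move: n0; rewrite en muln_gt0 => /andP[].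
have e0 : (0 < e)%N by rewrite logn_gt0 mem_primes pr_q n0 pdiv_dvd.
have mn : (m < n)%N by rewrite en ltn_Pmull // -{1}(expn0 q) ltn_exp2l ?prime_gt1.
have [m_ge0 m_sq] := IH m mn m0; have [g_ge0 g_sq] := geom_sign q e.
rewrite en divsum_pexp //; split; first exact: mulr_ge0.
case=> k ek; have k0 : (0 < k)%N by case: (k) ek => // /eqP; rewrite -en eqn0Ngt n0.
have ev : (e = 2 * logn q k)%N by rewrite /e en ek lognX.
rewrite -[1]mulr1 ler_pM ?g_sq ?m_sq //; first by rewrite ev oddM.
have [k' _ kE] := pfactor_coprime pr_q k0; exists k'.
have : (q ^ e * m = q ^ e * k' ^ 2)%N by rewrite ek kE expnMn -expnM ev [(logn q k * 2)%N]mulnC mulnC.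
by move/eqP; rewrite eqn_pmul2l ?expn_gt0 ?prime_gt0 // => /eqP.
Qed.

Lemma divsumE X n : (n < X)%N ->
  divsum n.+1 = \sum_(a < X) \sum_(b < X) (if (a.+1 * b.+1 == n.+1)%N then x a.+1 else 0).
Proof.
move=> nX; have -> : divsum n.+1 = \sum_(1 <= a < X.+1 | (a %| n.+1)%N) x a.
  rewrite /divsum -[RHS]big_filter; apply: perm_big; apply: uniq_perm.
  - exact: divisors_uniq.
  - by rewrite filter_uniq // iota_uniq.
  move=> a; rewrite mem_filter mem_index_iota -dvdn_divisors //; case an: (_ %| _)%N => //=.
  by rewrite (dvdn_gt0 _ an) // ltnS (leq_trans (dvdn_leq _ an)).
rewrite big_add1 /= big_mkord big_mkcond; apply: eq_bigr => a _; case: ifP => [/dvdnP[b eb]|an].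
  have b0 : (0 < b)%N by case: (b) eb.
  have bX : (b.-1 < X)%N.
    by rewrite prednK // (leq_trans _ nX) // eb leq_pmulr.
  rewrite (bigD1 (Ordinal bX)) //= prednK // {1}mulnC -eb eqxx big1 ?addr0 // => i ib.
  case: eqP => // /eqP; rewrite eb mulnC eqn_pmul2r // => /eqP ei.
  by case/eqP: ib; apply: val_inj; rewrite /= -ei.
rewrite big1 // => b _; case: eqP => // ab.
by rewrite -ab dvdn_mulr in an.
Qed.

Hypothesis M_gt0 : (0 < M)%N.
Hypothesis x_per : forall a, x (a + M)%N = x a.
Hypothesis x_sum : \sum_(a < M) x a = 0.
Hypothesis x_harm : forall T, (0 < T)%N ->
  `|\sum_(a < T) (x a.+1)%:~R / a.+1%:R : rat| <= C%:R / T%:R.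

Let normx a : `|(x a)%:~R : rat| <= 1.
Proof. by case: (x_val a) => ->. Qed.

Section Cutoff.

Variables (t : rat) (X : nat).
Hypotheses (t_gt0 : 0 < t) (t_lt1 : t < 1) (X_gt0 : (0 < X)%N).

Let onet : 0 < 1 - t. Proof. by rewrite subr_gt0. Qed.

(** Summation by parts against the decreasing gap costs at most M, and the rest is
    the harmonic sum. *)
Lemma lambert_series_upper :
  \sum_(a < X) (x a.+1)%:~R * lambert t a.+1 <= M%:R + C%:R / (X%:R * (1 - t)).
Proof.
have per_sum n : `|\sum_(a < n) (x a.+1)%:~R : rat| <= M%:R.
  apply: (periodic_sum_bound (f := fun a => (x a.+1)%:~R)) => // [a|].
    by rewrite -addSn x_per.
  have xper : forall a, (x (a %% M)%N) = x a := periodic_mod x_per.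
  rewrite -rmorph_sum /=; under eq_bigr do rewrite -addn1.
  by rewrite (periodic_reindexD M_gt0 xper) x_sum.
have gap := @abel_bound _ (fun a => (x a.+1)%:~R) (fun a => lambert_gap t a.+1) M%:R X
  per_sum (lambert_gap_decr t_gt0 t_lt1) (lambert_gap_ge0 t_gt0 t_lt1).
have gap1 : lambert_gap t 1 = 1.
  by rewrite /lambert_gap /lambert; field; rewrite gt_eqF.
rewrite gap1 mulr1 in gap.
have -> : \sum_(a < X) (x a.+1)%:~R * lambert t a.+1 =
   (\sum_(a < X) (x a.+1)%:~R / a.+1%:R) / (1 - t) - \sum_(a < X) (x a.+1)%:~R * lambert_gap t a.+1.
  rewrite mulr_suml -sumrB; apply: eq_bigr => a _.
  by rewrite /lambert_gap invfM; ring.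
rewrite addrC lerD //; first by rewrite (le_trans (ler_norm _)) ?normrN.
rewrite invfM mulrA ler_wpM2r ?invr_ge0 ?(ltW onet) //.
exact: le_trans (ler_norm _) (x_harm X_gt0).
Qed.

(** Expanding t^a / (1 - t^a) in powers up to t^(a X), the coefficient of t^m for
    m <= X is divsum m; the error terms are those with exponent above X and the
    tails of the geometric series. *)
Lemma lambert_series_lower (r : nat) : (r ^ 2 <= X)%N ->
  r%:R * t ^+ (r ^ 2) - (X ^ 2)%N%:R * t ^+ X - X%:R * t ^+ X / (1 - t) <=
  \sum_(a < X) (x a.+1)%:~R * lambert t a.+1.
Proof.
move=> rX; have t0 : 0 <= t := ltW t_gt0; have t1 : t <= 1 := ltW t_lt1.
have lamE a : lambert t a.+1 = \sum_(b < X) t ^+ (a.+1 * b.+1) + t ^+ (a.+1 * X) * lambert t a.+1.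
  pose y := t ^+ a.+1; have n0 : 1 - y != 0 by rewrite subr_eq0 eq_sym lt_eqF // exprn_ilt1.
  have -> : \sum_(b < X) t ^+ (a.+1 * b.+1) = y * \sum_(b < X) y ^+ b.
    by rewrite mulr_sumr; apply: eq_bigr => b _; rewrite -exprM -exprD mulnS.
  rewrite exprM /lambert -/y.
  have -> : \sum_(b < X) y ^+ b = (1 - y ^+ X) / (1 - y).
    by apply: (mulfI n0); rewrite -geom_sum mulrC divfK.
  by field.
have lam_ub a : 0 <= lambert t a.+1 <= (1 - t)^-1.
  have ta : t ^+ a.+1 <= t by rewrite exprS ler_piMr // exprn_ile1.
  have h : 0 < 1 - t ^+ a.+1 by rewrite subr_gt0 (le_lt_trans ta).
  rewrite /lambert divr_ge0 ?exprn_ge0 ?(ltW h) //= ler_pdivrMr //.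
  rewrite mulrC ler_pdivlMr //; have := exprn_ge0 a.+1 t0; move: ta t_gt0; nra.
have mainE : \sum_(a < X) \sum_(b < X) (x a.+1)%:~R * t ^+ (a.+1 * b.+1) =
    \sum_(n < X) (divsum n.+1)%:~R * t ^+ n.+1 +
    \sum_(a < X) \sum_(b < X) (if (X < a.+1 * b.+1)%N then (x a.+1)%:~R * t ^+ (a.+1 * b.+1) else 0).
  have -> : \sum_(n < X) (divsum n.+1)%:~R * t ^+ n.+1 =
    \sum_(a < X) \sum_(b < X) \sum_(n < X)
      (if (a.+1 * b.+1 == n.+1)%N then (x a.+1)%:~R * t ^+ n.+1 else 0).
    under [RHS]eq_bigr do rewrite exchange_big /=.
    rewrite [RHS]exchange_big /=; apply: eq_bigr => n _.
    rewrite (divsumE (ltn_ord n)) rmorph_sum mulr_suml; apply: eq_bigr => a _.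
    rewrite rmorph_sum mulr_suml; apply: eq_bigr => b _.
    by case: ifP; rewrite //= mul0r.
  rewrite -big_split; apply: eq_bigr => a _; rewrite -big_split; apply: eq_bigr => b _ /=.
  have [abX|abX] := ltnP; last first.
    have [k ek] : exists k, (a.+1 * b.+1 = k.+1)%N by exists (a.+1 * b.+1).-1; rewrite prednK.
    rewrite ek in abX *; rewrite (bigD1 (Ordinal abX)) //= eqxx big1 ?addr0 // => i ni.
    by case: eqP => // -[e]; case/eqP: ni; apply: val_inj.
  rewrite big1 ?add0r // => i _; case: eqP => // e.
  by move: abX; rewrite e ltnNge ltn_ord.
have -> : \sum_(a < X) (x a.+1)%:~R * lambert t a.+1 =
    \sum_(a < X) \sum_(b < X) (x a.+1)%:~R * t ^+ (a.+1 * b.+1) +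
    \sum_(a < X) (x a.+1)%:~R * (t ^+ (a.+1 * X) * lambert t a.+1).
  rewrite -big_split; apply: eq_bigr => a _ /=.
  by rewrite {1}lamE mulrDr mulr_sumr.
rewrite mainE.
have tail1 : - (X%:R * t ^+ X / (1 - t)) <=
    \sum_(a < X) (x a.+1)%:~R * (t ^+ (a.+1 * X) * lambert t a.+1).
  rewrite -mulrA mulr_natl -[X in _ *+ X]card_ord -sumr_const -sumrN; apply: ler_sum => a _.
  rewrite lerNl (le_trans (ler_norm _)) // normrN normrM.
  have /andP[l0 l1] := lam_ub a.
  rewrite (ger0_norm (mulr_ge0 (exprn_ge0 _ t0) l0)).
  apply: (le_trans (ler_wpM2r (mulr_ge0 (exprn_ge0 _ t0) l0) (normx _))).
  rewrite mul1r ler_pM ?exprn_ge0 // ler_wiXn2l //; exact: leq_pmull.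
have tail2 : - ((X ^ 2)%N%:R * t ^+ X) <=
    \sum_(a < X) \sum_(b < X) (if (X < a.+1 * b.+1)%N then (x a.+1)%:~R * t ^+ (a.+1 * b.+1) else 0).
  rewrite mulr_natl -mulnn mulrnA -[X in _ *+ X]card_ord -sumr_const -sumrN.
  apply: ler_sum => a _; rewrite -[X in _ *+ X]card_ord -sumr_const -sumrN.
  apply: ler_sum => b _; rewrite lerNl; case: ltnP => abX; last by rewrite oppr0 exprn_ge0.
  rewrite (le_trans (ler_norm _)) // normrN normrM (ger0_norm (exprn_ge0 _ t0)).
  apply: (le_trans (ler_wpM2r (exprn_ge0 _ t0) (normx _))).
  by rewrite mul1r ler_wiXn2l // ltnW.
have squares : r%:R * t ^+ (r ^ 2) <= \sum_(n < X) (divsum n.+1)%:~R * t ^+ n.+1.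
  have indic n : ((\sum_(k < r) (k.+1 ^ 2 == n.+1))%N%:R : rat) <= (divsum n.+1)%:~R.
    have [/existsP[k /eqP kn]|/existsPn nk] := boolP [exists k : 'I_r, (k.+1 ^ 2 == n.+1)%N].
      rewrite (bigD1 k) //= kn eqxx big1 => [|i ik]; last first.
        case: eqP => //; rewrite -kn => /eqP; rewrite eqn_exp2r // => /eqP[ei].
        by case/eqP: ik; exact: val_inj.
      have [_ h] := divsum_ge (ltn0Sn n).
      by rewrite addn0 ler1z h //; exists k.+1.
    rewrite big1 => [|k _]; last by rewrite (negPf (nk k)).
    by rewrite ler0z; case: (divsum_ge (ltn0Sn n)).
  apply: le_trans (ler_sum _ (fun (n : 'I_X) _ => ler_wpM2r (exprn_ge0 n.+1 t0) (indic n))).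
  under eq_bigr do rewrite natr_sum mulr_suml.
  rewrite exchange_big /= mulr_natl -[X in _ *+ X]card_ord -sumr_const.
  apply: ler_sum => k _.
  have kX : (k.+1 ^ 2 <= X)%N by rewrite (leq_trans _ rX) // leq_exp2r.
  have [l el] : exists l, (k.+1 ^ 2 = l.+1)%N by exists (k.+1 ^ 2).-1; rewrite prednK ?expn_gt0.
  rewrite el in kX; rewrite (bigD1 (Ordinal kX)) //= -!el eqxx mul1r -[leLHS]addr0 lerD //.
    by rewrite ler_wiXn2l // leq_exp2r.
  by apply: sumr_ge0 => i _; rewrite mulr_ge0 ?ler0n ?exprn_ge0.
exact: lerD (lerD squares tail2) tail1.
Qed.

End Cutoff.

(** With t = 1 - 1 / (2 r^2) the Lambert series is at least about r / 2, as its
    coefficients at the squares are at least 1; but it is bounded if the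
    harmonic sums tend to 0 fast enough. *)
Theorem real_character_absurd : False.
Proof.
pose r := (2 * M + 7)%N; pose D := (2 * r ^ 2)%N.
have D0 : (0 < D)%N by rewrite /D /r; clear; nia.
have D0' : 0 < D%:R :> rat by rewrite ltr0n.
have D1' : 1 < D%:R :> rat by rewrite ltr1n /D /r; clear; nia.
(* t^Y <= D / Y by Bernoulli, so that X = 3 Y makes X^2 t^X at most 9 D^3 / Y *)
pose Y := (9 * D ^ 3 * C.+1)%N; pose X := (3 * Y)%N.
have Y0 : (0 < Y)%N by rewrite /Y muln_gt0 muln_gt0 expn_gt0 D0.
have Y0' : 0 < Y%:R :> rat by rewrite ltr0n.
have X0 : (0 < X)%N by rewrite muln_gt0.
pose t : rat := 1 - D%:R^-1.
have tE : 1 - t = D%:R^-1 by rewrite /t opprB addrC subrK.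
have t0 : 0 < t by rewrite subr_gt0 invf_lt1.
have t1 : t < 1 by rewrite -subr_gt0 tE invr_gt0.
have rX : (r ^ 2 <= X)%N by rewrite /X /Y /D; clear; nia.
have up := lambert_series_upper t0 t1 X0.
have low := lambert_series_lower t0 t1 rX.
have half : 1 / 2 <= t ^+ (r ^ 2).
  apply: le_trans (bernoulli (r ^ 2) _); last by rewrite lerN2 invf_le1 ?ltW.
  have -> : D%:R = 2 * (r ^ 2)%N%:R :> rat by rewrite /D natrM.
  have r20 : (r ^ 2)%N%:R != 0 :> rat by rewrite pnatr_eq0 expn_eq0 /r addnS.
  move: (_%:R) r20 => u u0.
  by rewrite le_eqVlt; apply/orP; left; apply/eqP; field.
have tY : t ^+ Y <= D%:R / Y%:R.
  have i0 : 0 < D%:R^-1 :> rat by rewrite invr_gt0.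
  have h1 : t ^+ Y * (1 + D%:R^-1) ^+ Y <= 1.
    rewrite -exprMn exprn_ile1 // /t; last by have := sqr_ge0 (D%:R^-1 : rat); lra.
    by rewrite mulr_ge0 ?(ltW t0) // addr_ge0 // ltW.
  have h2 : Y%:R / D%:R <= (1 + D%:R^-1) ^+ Y :> rat.
    apply: (le_trans _ (@bernoulli rat D%:R^-1 Y _)); last by move: i0; lra.
    by rewrite lerDr.
  rewrite -[D%:R / _]invf_div -[leRHS]mul1r ler_pdivlMr ?divr_gt0 //.
  by apply: le_trans h1; rewrite ler_wpM2l ?exprn_ge0 // ltW.
have tX : t ^+ X <= (D%:R / Y%:R) ^+ 3.
  by rewrite /X mulnC exprM lerXn2r // ?nnegrE ?exprn_ge0 ?divr_ge0 ?ler0n // ltW.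
have Yge : (9 * D ^ 3)%N%:R <= Y%:R :> rat by rewrite ler_nat /Y leq_pmulr.
have err : (X ^ 2)%N%:R * t ^+ X <= 1.
  apply: le_trans (ler_wpM2l (ler0n _ _) tX) _.
  have -> : (X ^ 2)%N%:R * (D%:R / Y%:R) ^+ 3 = (9 * D ^ 3)%N%:R / Y%:R :> rat.
    rewrite natrX /X [(3 * Y)%:R]natrM [(9 * _)%:R]natrM natrX.
    by move: Y%:R Y0' D%:R => y y0 u; field; rewrite gt_eqF.
  by rewrite ler_pdivrMr // mul1r.
have D3 : (D <= D ^ 3)%N by rewrite -{1}(expn1 D) leq_pexp2l.
have aux u v c : (u <= v)%N -> (u <= 3 * (9 * v * c.+1))%N && (c * u <= 3 * (9 * v * c.+1))%N.
  by move=> uv; apply/andP; split; move: uv; clear; nia.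
have DX : D%:R <= X%:R :> rat by rewrite ler_nat; have /andP[] := aux _ _ C D3.
have err2 : X%:R * t ^+ X / (1 - t) <= 1.
  apply: le_trans err; rewrite tE invrK mulrAC ler_wpM2r ?exprn_ge0 ?(ltW t0) //.
  by rewrite -mulnn natrM ler_wpM2l ?ler0n.
have errC : C%:R / (X%:R * (1 - t)) <= 1.
  rewrite tE ler_pdivrMr ?mul1r ?mulr_gt0 ?ltr0n ?invr_gt0 // ler_pdivlMr //.
  by rewrite -natrM ler_nat; have /andP[] := aux _ _ C D3.
have rE : r%:R = 2 * M%:R + 7 :> rat by rewrite /r natrD natrM.
have rh := ler_wpM2l (ler0n rat r) half.
move: up low errC err err2 rh rE.
move: (\sum_(a < X) _) (_ / (_ * _)) (_ * t ^+ X) (X%:R * _ / _) (t ^+ (r ^ 2)) r%:R M%:R => *.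
lra.
Qed.

End RealCharacter.

(** * Complex characters *)

(** With a and b the roots of order m + 1 of n and n + 1, this is the elementary
    replacement of the derivative of x^(-1/(m+1)). *)
Lemma root_gap (R : numFieldType) (a b : R) m :
  1 <= a -> a <= b -> b ^+ m.+1 = a ^+ m.+1 + 1 ->
  a^-1 - b^-1 <= (m.+1%:R * a ^+ m.+1)^-1 /\
  (b ^+ m.+1 * b)^-1 <= m.+1%:R * (a^-1 - b^-1).
Proof.
move=> a1 ab e; have a0 : 0 < a := lt_le_trans ltr01 a1; have b0 := lt_le_trans a0 ab.
have b1 := le_trans a1 ab.
pose P := \sum_(i < m.+1) b ^+ (m - i) * a ^+ i.
have DP : (b - a) * P = 1 by rewrite -subrXX e addrAC subrr add0r.
have PU : P <= m.+1%:R * b ^+ m.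
  rewrite mulr_natl -[X in _ *+ X]card_ord -sumr_const; apply: ler_sum => i _.
  have im : (i <= m)%N by rewrite -ltnS.
  rewrite -[X in _ <= b ^+ X](subnK im) exprD ler_wpM2l ?exprn_ge0 ?(ltW b0) //.
  by rewrite lerXn2r // nnegrE ltW.
have PL : m.+1%:R * a ^+ m <= P.
  rewrite mulr_natl -[X in _ *+ X]card_ord -sumr_const; apply: ler_sum => i _.
  have im : (i <= m)%N by rewrite -ltnS.
  rewrite -[X in a ^+ X <= _](subnK im) exprD ler_wpM2r ?exprn_ge0 ?(ltW a0) //.
  by rewrite lerXn2r // nnegrE ltW.
have P0 : 0 < P by apply: lt_le_trans PL; rewrite mulr_gt0 ?ltr0n ?exprn_gt0.
have E : a^-1 - b^-1 = (P * (a * b))^-1.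
  have -> : b = a + P^-1 by rewrite -[P^-1]mul1r -DP mulfK ?gt_eqF // addrC subrK.
  field; rewrite !gt_eqF //= mulr_gt0 || rewrite !gt_eqF //=.
  by rewrite addr_gt0 ?mulr_gt0.
rewrite E; split.
  rewrite lef_pV2 ?posrE ?mulr_gt0 ?ltr0n ?exprn_gt0 //.
  rewrite exprSr mulrA ler_pM ?mulr_ge0 ?ler0n ?exprn_ge0 ?(ltW a0) //.
  by rewrite ler_peMr // ltW.
rewrite -[m.+1%:R]invrK -invfM lef_pV2 ?posrE ?mulr_gt0 ?invr_gt0 ?ltr0n ?exprn_gt0 //.
rewrite ler_pdivrMl ?ltr0n // exprSr.
have -> : m.+1%:R * (b ^+ m * b * b) = m.+1%:R * b ^+ m * (b * b) by rewrite !mulrA.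
rewrite ler_pM ?mulr_ge0 ?(ltW a0) ?(ltW b0) ?(ltW P0) //.
by rewrite ler_wpM2r // ltW.
Qed.

Section Weights.

Variable m : nat.

(** n^(-1/(m+1)); the completely multiplicative weights n^-s with s = 1 + 1/(m+1)
    are built from it inside the algebraic numbers. *)
Definition rootV (n : nat) : algC := (m.+1.-root n%:R)^-1.
Local Notation v := rootV.
Definition weight (n : nat) : algC := v n / n%:R.
Local Notation w := weight.

Lemma root_ge1 n : (0 < n)%N -> 1 <= m.+1.-root (n%:R : algC).
Proof. by move=> n0; rewrite rootC_ge1 // ler1n. Qed.

Lemma rootV_ge0 n : 0 <= v n.
Proof. by rewrite invr_ge0 rootC_ge0 ?ler0n. Qed.

Lemma rootV_le1 n : (0 < n)%N -> v n <= 1.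
Proof. by move=> n0; rewrite invf_le1 ?root_ge1 // (lt_le_trans ltr01) ?root_ge1. Qed.

Lemma rootVM a b : v (a * b) = v a * v b.
Proof. by rewrite /v natrM rootCMl ?ler0n // invfM. Qed.

Lemma rootV1 : v 1 = 1. Proof. by rewrite /v rootC1 // invr1. Qed.

Lemma rootVX k : v (k ^ m.+1) = k%:R^-1.
Proof. by rewrite /v natrX rootCX ?ler0n // rootCK. Qed.

Lemma weightM a b : w (a * b) = w a * w b.
Proof. by rewrite /w rootVM natrM invfM mulrACA. Qed.

Lemma weight1 : w 1 = 1. Proof. by rewrite /w rootV1 divr1. Qed.

Lemma weight_ge0 n : 0 <= w n.
Proof. by rewrite divr_ge0 ?rootV_ge0 ?ler0n. Qed.

Lemma weight_le1 n : w n <= 1.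
Proof.
rewrite /weight; case: n => [|n]; first by rewrite invr0 mulr0 ler01.
by rewrite ler_pdivrMr ?ltr0n // mul1r (le_trans (rootV_le1 (ltn0Sn n))) // ler1n.
Qed.

Lemma rootV_step n : (0 < n)%N ->
  v n - v n.+1 <= (m.+1 * n)%N%:R^-1 /\ w n.+1 <= m.+1%:R * (v n - v n.+1).
Proof.
move=> n0; have nk k : (m.+1.-root (k%:R : algC)) ^+ m.+1 = k%:R by rewrite rootCK.
have [] := @root_gap algC (m.+1.-root n%:R) (m.+1.-root n.+1%:R) m (root_ge1 n0).
- by rewrite ler_rootC ?nnegrE ?ler0n // ler_nat.
- by rewrite !nk natr1.
rewrite !nk /weight natrM => h1 h2; split=> //.
by rewrite -invfM mulrC.
Qed.
End Weights.

(** Telescoping: the weights are at most m + 1 times the decrements of rootV. *)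
Lemma weight_tail m Y X : (0 < Y)%N ->
  \sum_(Y.+1 <= n < X.+1) weight m n <= m.+1%:R * rootV m Y.
Proof.
move=> Y0; have [YX|XY] := leqP Y X; last first.
  by rewrite big_geq ?mulr_ge0 ?ler0n ?rootV_ge0 // ltnW.
rewrite big_add1 /=; apply: le_trans (_ : m.+1%:R * (rootV m Y - rootV m X) <= _).
  have -> : rootV m Y - rootV m X = \sum_(Y <= n < X) (rootV m n - rootV m n.+1).
    by rewrite -[LHS]opprB -(telescope_sumr _ YX) -sumrN; apply: eq_bigr => i _; rewrite opprB.
  rewrite mulr_sumr; apply: ler_sum_nat => n /andP[Yn _].
  by have [] := rootV_step m (leq_trans Y0 Yn).
by rewrite ler_wpM2l ?ler0n // gerBl rootV_ge0.
Qed.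

Lemma weight_tail_small m E : (0 < E)%N -> exists2 Y, (0 < Y)%N &
  forall Z X, (Y <= Z)%N -> \sum_(Z.+1 <= n < X.+1) weight m n <= E%:R^-1.
Proof.
move=> E0; exists ((m.+1 * E) ^ m.+1)%N; first by rewrite expn_gt0 muln_gt0 E0.
move=> Z X YZ; have Z0 : (0 < Z)%N by apply: leq_trans YZ; rewrite expn_gt0 muln_gt0 E0.
apply: le_trans (weight_tail m X Z0) _.
have h : rootV m Z <= (m.+1 * E)%N%:R^-1.
  rewrite -(rootVX m) /rootV lef_pV2 ?posrE ?(lt_le_trans ltr01) ?root_ge1 ?expn_gt0 ?muln_gt0 ?E0 //.
  by rewrite ler_rootC ?nnegrE ?ler0n // ler_nat.
apply: le_trans (ler_wpM2l (ler0n _ _) h) _.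
by rewrite natrM invfM mulrA divff ?mul1r // pnatr_eq0.
Qed.

Lemma weight_total m X : \sum_(1 <= n < X.+1) weight m n <= 1 + m.+1%:R.
Proof.
case: X => [|X]; first by rewrite big_geq // addr_ge0 ?ler0n.
by rewrite big_ltn // weight1 lerD // (le_trans (weight_tail m X.+1 (leqnn 1))) // rootV1 mulr1.
Qed.

Lemma sum_multiples (V : nmodType) (P : pred nat) (F : nat -> V) q X : (0 < q)%N ->
  \sum_(1 <= n < X.+1 | (q %| n)%N && P n) F n = \sum_(1 <= b < (X %/ q).+1 | P (q * b)%N) F (q * b)%N.
Proof.
move=> q0; rewrite -[LHS]big_filter -[RHS](big_map (muln q) P F) -[RHS]big_filter; apply: perm_big.
have q_inj : injective (muln q) by move=> a b /eqP; rewrite eqn_pmul2l // => /eqP.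
apply: uniq_perm; rewrite ?filter_uniq ?map_inj_uniq ?iota_uniq // => a.
rewrite !mem_filter andbAC; case: (P a); rewrite ?andbF ?andbT //.
rewrite mem_index_iota; apply/andP/mapP => [[/dvdnP[b ->] /andP[b0 bX]]|[b]].
  exists b; last by rewrite mulnC.
  by rewrite ltnS in bX; rewrite mem_index_iota ltnS leq_divRL // bX andbT; move: b0; rewrite muln_gt0 => /andP[].
rewrite mem_index_iota ltnS leq_divRL // => /andP[b0 bX] ->.
by rewrite dvdn_mulr // muln_gt0 q0 b0 ltnS mulnC.
Qed.

(** If z has order f, the product of the factors over a period is 1 - u^f. *)
Lemma euler_factor (R : numFieldType) (z u : R) r : z ^+ r.+1 = 1 \/ z = 0 ->
  0 <= u <= 1 -> `|\prod_(k < r.+1) (1 - z ^+ k.+1 * u)| <= 1.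
Proof.
move=> zr /andP[u0 u1]; case: zr => [zr|->]; last first.
  by rewrite big1 ?normr1 // => k _; rewrite exprS !mul0r subr0.
have -> : \prod_(k < r.+1) (1 - z ^+ k.+1 * u) = \prod_(k < r.+1) (1 - z ^+ k * u).
  by rewrite big_ord_recr big_ord_recl /= zr expr0 mulrC.
have [f pf] := prim_order_exists (ltn0Sn r) zr.
move=> /dvdnP[e ->].
have f0 := prim_order_gt0 pf.
have block : \prod_(k < f) (1 - z ^+ k * u) = 1 - u ^+ f.
  have [->|un0] := eqVneq u 0.
    by rewrite big1 ?expr0n ?gtn_eqF ?subr0 // => k _; rewrite mulr0 subr0.
  have := congr1 (horner^~ u^-1) (factor_Xn_sub_1 pf).
  rewrite horner_prod big_mkord hornerD hornerN hornerXn hornerC => h.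
  have -> : 1 - u ^+ f = u ^+ f * (u ^- f - 1) by rewrite mulrBr mulr1 divff // expf_neq0.
  rewrite -exprVn -h -[X in u ^+ X]card_ord -prodr_const -big_split; apply: eq_bigr => k _ /=.
  by rewrite hornerD hornerN hornerX hornerC mulrBr divff // mulrC.
elim: e => [|e IH]; first by rewrite mul0n big_ord0 normr1.
rewrite mulSn big_split_ord /= block normrM.
under eq_bigr do rewrite exprD (prim_expr_order pf) mul1r.
rewrite mulr_ile1 ?normr_ge0 // ger0_norm ?subr_ge0 ?exprn_ile1 //.
by rewrite gerBl exprn_ge0.
Qed.

Section EulerSieve.

Variables (x : nat -> algC) (m : nat).
Hypothesis x1 : x 1%N = 1.
Hypothesis xM : forall a b, x (a * b)%N = x a * x b.
Hypothesis norm_x : forall a, `|x a| <= 1.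
Local Notation w := (weight m).

Definition coprime_to (S : seq nat) (n : nat) := all (fun q => ~~ (q %| n)%N) S.

(** Partial sums of the L-series of the k-th power, over the n without prime
    factor in S. *)
Definition sieved (X : nat) (S : seq nat) (k : nat) : algC :=
  \sum_(1 <= n < X.+1 | coprime_to S n) x n ^+ k * w n.

Let norm_term n k : `|x n ^+ k * w n| <= w n.
Proof.
rewrite normrM (ger0_norm (weight_ge0 m n)) ler_piMl ?weight_ge0 //.
by rewrite normrX exprn_ile1.
Qed.

(** Removing the multiples of q: by complete multiplicativity they form q times a
    shorter sum of the same kind. *)
Lemma sieved_cons X S q k : prime q -> all prime S -> q \notin S ->
  sieved X (q :: S) k = sieved X S k - x q ^+ k * w q * sieved (X %/ q) S k.
Proof.
move=> pr_q pS qS; apply/esym/eqP; rewrite subr_eq; apply/eqP.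
rewrite /sieved (bigID (fun n => q %| n)%N) /= addrC; congr (_ + _).
  by apply: eq_bigl => n; rewrite andbC.
rewrite (eq_bigl (fun n => (q %| n)%N && coprime_to S n)) => [|n]; last by rewrite andbC.
rewrite sum_multiples ?prime_gt0 // mulr_sumr.
have cS b : coprime_to S (q * b) = coprime_to S b.
  apply: eq_in_all => l lS; rewrite Gauss_dvdr // prime_coprime ?(allP pS) //.
  rewrite (dvdn_prime2 (allP pS _ lS) pr_q); by apply: contraNN qS => /eqP <-.
rewrite (eq_bigl _ _ cS); apply: eq_bigr => b _.
by rewrite xM weightM exprMn mulrACA.
Qed.

Definition euler (S : seq nat) (k : nat) : algC := \prod_(q <- S) (1 - x q ^+ k * w q).

(** A finite form of the Euler product, uniform in k: the errors come from the
    difference of the sums up to X and X / q, which is a tail of the weights. *)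
Lemma sieved_euler S : all prime S -> uniq S -> forall E, (0 < E)%N ->
  exists X0, forall X k, (X0 <= X)%N ->
  `|euler S k * sieved X [::] k - sieved X S k| <= E%:R^-1.
Proof.
elim: S => [|q S IH] /=.
  move=> _ _ E E0; exists 0%N => X k _.
  by rewrite /euler big_nil mul1r subrr normr0 invr_ge0 ler0n.
move=> /andP[pr_q pS] /andP[qS uS] E E0.
have E40 : (0 < 4 * E)%N by rewrite muln_gt0.
have E20 : (0 < 2 * E)%N by rewrite muln_gt0.
have [X0 HX0] := IH pS uS _ E40.
have [Y Y0 HY] := weight_tail_small m E20.
exists (maxn X0 (Y * q)) => X k; rewrite geq_max => /andP[X0X YX].
rewrite sieved_cons // /euler big_cons -/(euler S k).
pose c := x q ^+ k * w q; rewrite -/c.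
have c1 : `|c| <= 1 by apply: le_trans (norm_term _ _) (weight_le1 _ _).
clearbody c.
have -> : (1 - c) * euler S k * sieved X [::] k - (sieved X S k - c * sieved (X %/ q) S k) =
   (1 - c) * (euler S k * sieved X [::] k - sieved X S k) - c * (sieved X S k - sieved (X %/ q) S k).
  by ring.
have XqX : (X %/ q <= X)%N := leq_div X q.
have tail : `|sieved X S k - sieved (X %/ q) S k| <= (2 * E)%N%:R^-1.
  rewrite /sieved (big_cat_nat (n := (X %/ q).+1)) //= addrAC subrr add0r.
  apply: le_trans (ler_norm_sum _ _ _) _.
  apply: le_trans (HY (X %/ q)%N X _); last by rewrite leq_divRL ?prime_gt0.
  rewrite big_mkcond; apply: ler_sum => n _; case: ifP => _; last exact: weight_ge0.
  exact: norm_term.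
apply: le_trans (ler_normB _ _) _; rewrite !normrM.
have c2 : `|1 - c| <= 2 by apply: le_trans (ler_normB _ _) _; rewrite normr1 -[2]/(1 + 1) lerD.
have -> : E%:R^-1 = 2 * (4 * E)%N%:R^-1 + 1 * (2 * E)%N%:R^-1 :> algC.
  by rewrite !natrM; field; rewrite pnatr_eq0 -lt0n.
by apply: lerD; apply: ler_pM => //; exact: HX0.
Qed.

(** After removal of the multiples of all small primes the term n = 1
    dominates. *)
Lemma sieved_main : exists S, [/\ all prime S, uniq S &
  forall X k, (0 < X)%N -> 3 / 4 <= `|sieved X S k|].
Proof.
have [Y Y0 HY] := weight_tail_small m (isT : (0 < 4)%N).
exists [seq q <- iota 0 Y.+1 | prime q]; split.
- exact: filter_all.
- by rewrite filter_uniq // iota_uniq.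
move=> X k X0; rewrite /sieved big_mkcond big_ltn //= ifT; last first.
  apply/allP => q; rewrite mem_filter => /andP[pr_q _].
  by rewrite dvdn1; apply: contraL pr_q => /eqP->.
rewrite x1 weight1 expr1n mulr1.
set R := bigop _ _ _.
have R1 : `|R| <= 4%:R^-1.
  apply: le_trans (HY Y X (leqnn Y)).
  apply: le_trans (ler_norm_sum _ _ _) _.
  rewrite (big_nat_widenl Y.+1 2) // [leRHS]big_mkcond.
  apply: ler_sum_nat => n /andP[n1 nX] /=; case: ltnP => nY.
    by case: ifP => _; rewrite ?normr0 ?weight_ge0.
  have pS : pdiv n \in [seq q <- iota 0 Y.+1 | prime q].
    by rewrite mem_filter pdiv_prime // mem_iota add0n ltnS (leq_trans (pdiv_leq (ltnW n1))).
  rewrite ifF ?normr0 //; apply/negP => /allP /(_ _ pS).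
  by rewrite pdiv_dvd.
apply: le_trans (_ : `|1| - `|R| <= _).
  have -> : 3 / 4 = 1 - 4%:R^-1 :> algC by field.
  by rewrite normr1 lerB.
by rewrite lerBlDr (le_trans _ (ler_normB _ _)) // addrK.
Qed.

End EulerSieve.

(** By comparison with the telescoping sum of 1 / (k (k + 1)). *)
Lemma sum_inv_sqr (R : numFieldType) n : \sum_(i < n) (i.+1 ^ 2)%N%:R^-1 <= 2 :> R.
Proof.
suff H k : \sum_(i < k.+1) (i.+1 ^ 2)%N%:R^-1 <= 2 - k.+1%:R^-1 :> R.
  case: n => [|n]; first by rewrite big_ord0 ler0n.
  by apply: le_trans (H n) _; rewrite gerBl invr_ge0 ler0n.
elim: k => [|k IH]; first by rewrite big_ord_recr big_ord0 /= add0r exp1n invr1 -addrA subrr addr0.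
rewrite big_ord_recr /=; apply: le_trans (lerD IH (lexx _)) _.
rewrite -addrA lerD2l -lerBrDl opprK [leRHS]addrC.
have -> : k.+1%:R^-1 - k.+2%:R^-1 = (k.+1 * k.+2)%N%:R^-1 :> R.
  have k1 : k.+1%:R != 0 :> R by rewrite pnatr_eq0.
  have k2 : k.+2%:R != 0 :> R by rewrite pnatr_eq0.
  have e : k.+2%:R = k.+1%:R + 1 :> R by rewrite natr1.
  rewrite natrM e; rewrite e in k2; move: k.+1%:R k1 k2 => u u0 u1.
  by field; rewrite u0 u1.
by rewrite lef_pV2 ?posrE ?ltr0n // ler_nat -mulnn leq_pmul2r.
Qed.

Section ComplexCharacter.

Variables (x : nat -> algC) (M C r : nat).
Hypothesis M_gt0 : (0 < M)%N.
Hypothesis x1 : x 1%N = 1.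
Hypothesis xM : forall a b, x (a * b)%N = x a * x b.
Hypothesis x_per : forall a, x (a + M)%N = x a.
Hypothesis x_root : forall a, x a ^+ r.+3 = 1 \/ x a = 0.
Hypothesis x_nontriv : forall k, (0 < k < r.+3)%N ->
  exists2 a, coprime a M & x a ^+ k != 1.
Hypothesis x_harm : forall T, (0 < T)%N ->
  `|\sum_(a < T) x a.+1 / a.+1%:R| <= C%:R / T%:R.

Let norm_x a : `|x a| <= 1.
Proof.
case: (x_root a) => [e|->]; last by rewrite normr0 ler01.
have /eqP : `|x a| ^+ r.+3 = 1 by rewrite -normrX e normr1.
by rewrite pexpr_eq1 // => /eqP ->.
Qed.

Let x_conj a : x a ^+ r.+2 = (x a)^*.
Proof.
case: (x_root a) => [e|->]; last by rewrite conjC0 exprS mul0r.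
have /eqP : `|x a| ^+ r.+3 = 1 by rewrite -normrX e normr1.
rewrite pexpr_eq1 // => /eqP n1.
have x0 : x a != 0 by rewrite -normr_eq0 n1 oner_eq0.
by apply: (mulfI x0); rewrite -exprS e -normCK n1 expr1n.
Qed.

Let sievedE m X k : sieved x m X [::] k = \sum_(a < X) x a.+1 ^+ k * weight m a.+1.
Proof. by rewrite /sieved big_add1 /= big_mkord. Qed.

Lemma sum_power0 k : (0 < k < r.+3)%N -> \sum_(a < M) x a ^+ k = 0.
Proof.
move=> k_r; have [a aM xa] := x_nontriv k_r.
have per b : x (b %% M) ^+ k = x b ^+ k by rewrite (periodic_mod x_per).
have e : \sum_(b < M) x b ^+ k = x a ^+ k * \sum_(b < M) x b ^+ k.
  rewrite -{1}(periodic_reindexM M_gt0 per aM) mulr_sumr.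
  by apply: eq_bigr => b _; rewrite xM exprMn.
move/eqP: e; rewrite -{1}[\sum_(_ < _) _]mul1r -subr_eq0 -mulrBl mulf_eq0 subr_eq0 eq_sym.
by rewrite (negPf xa) => /eqP.
Qed.

Lemma power_bound m X k : (0 < k < r.+3)%N -> `|sieved x m X [::] k| <= M%:R.
Proof.
move=> k_r; rewrite sievedE.
have per b : x (b %% M) ^+ k = x b ^+ k by rewrite (periodic_mod x_per).
have norm_xk a : `|x a ^+ k| <= 1 by rewrite normrX exprn_ile1.
have := @abel_bound _ (fun a => x a.+1 ^+ k) (fun a => weight m a.+1) M%:R X _ _ _.
rewrite weight1 mulr1; apply => n.
- apply: (periodic_sum_bound (f := fun a => x a.+1 ^+ k)) => // [a|].
    by rewrite -addSn x_per.
  under eq_bigr do rewrite -addn1.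
  by rewrite (periodic_reindexD M_gt0 per) sum_power0.
- have v0 := rootV_ge0 m n.+1.
  rewrite /weight ler_pM ?rootV_ge0 ?invr_ge0 ?ler0n //.
    have [_ h] := rootV_step m (ltn0Sn n).
    rewrite -subr_ge0 -(pmulr_rge0 _ (ltr0Sn algC m)).
    by apply: le_trans h; apply: weight_ge0.
  by rewrite lef_pV2 ?posrE ?ltr0n // ler_nat.
- exact: weight_ge0.
Qed.

(** Summation by parts against the decrements of rootV, which are at most
    1 / ((m + 1) n); the partial harmonic sums are at most C / n.  This is where
    the vanishing of the L-function at 1 enters. *)
Lemma first_power_bound m X : (m < X)%N ->
  `|sieved x m X [::] 1| <= (3 * C)%N%:R / m.+1%:R.
Proof.
move=> mX; rewrite sievedE.
under eq_bigr do rewrite expr1 /weight mulrCA mulrC.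
case: X mX => // X mX.
rewrite (abel_summation (fun a => x a.+1 / a.+1%:R) (fun a => rootV m a.+1)).
have -> : (3 * C)%N%:R / m.+1%:R = C%:R / m.+1%:R + C%:R / m.+1%:R * 2 :> algC.
  by rewrite natrM; move: m.+1%:R^-1 => u; ring.
apply: le_trans (ler_normD _ _) _; apply: lerD.
  rewrite normrM (ger0_norm (rootV_ge0 _ _)) -[leRHS]mulr1.
  rewrite ler_pM ?rootV_ge0 ?rootV_le1 //.
  apply: le_trans (x_harm (ltn0Sn X)) _.
  by rewrite ler_wpM2l ?ler0n // lef_pV2 ?posrE ?ltr0n // ler_nat.
apply: le_trans (ler_wpM2l _ (sum_inv_sqr algC X)); last by rewrite divr_ge0 ?ler0n.
rewrite mulr_sumr; apply: le_trans (ler_norm_sum _ _ _) _; apply: ler_sum => i _.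
have [h _] := rootV_step m (ltn0Sn i).
have d0 : 0 <= rootV m i.+1 - rootV m i.+2.
  rewrite subr_ge0 /rootV lef_pV2 ?posrE ?(lt_le_trans ltr01) ?root_ge1 //.
  by rewrite ler_rootC ?nnegrE ?ler0n // ler_nat.
rewrite normrM (ger0_norm d0).
apply: le_trans (ler_pM (normr_ge0 _) d0 (x_harm (ltn0Sn i)) h) _.
by rewrite natrM -mulnn natrM !invfM mulrACA [C%:R * _ * _]mulrAC mulrA.
Qed.

(** The product of the L-series of all the powers of the character, taken at
    1 + 1 / (m + 1), is at least 2^-(r+3): the Euler factors of all the powers
    multiply to at most 1 at each prime (euler_factor), and without the small
    primes each series is close to 1.  But the pole of the zeta factor, of size
    m, cannot compensate for the two factors of size 1 / m that come from the
    character and its complex conjugate, which are distinct as the order r + 3 is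
    at least 3. *)
Theorem complex_character_absurd : False.
Proof.
pose K := (18 * C ^ 2 * M ^ r)%N.
pose m := (K * 2 ^ r.+3)%N.
have [S [pS uS main]] := sieved_main m x1 norm_x.
have [X0 HX0] := sieved_euler m xM norm_x pS uS (isT : (0 < 4)%N).
pose X := maxn X0 m.+1.
have X0X : (X0 <= X)%N by rewrite leq_maxl.
have mX : (m < X)%N by rewrite leq_max ltnSn orbT.
have Xgt0 : (0 < X)%N := leq_ltn_trans (leq0n _) mX.
pose A k := sieved x m X [::] k.
have low k : 1 / 2 <= `|euler x m S k| * `|A k|.
  have h := HX0 X k X0X; have h' := main X k Xgt0.
  rewrite -normrM; have -> : 1 / 2 = 3 / 4 - 4%:R^-1 :> algC by field.
  apply: le_trans (lerB h' h) _.
  by rewrite lerBlDr distrC -[X in `|X| <= _](subrK (euler x m S k * A k)) addrC ler_normD.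
have prod_low : (1 / 2) ^+ r.+3 <= \prod_(k < r.+3) `|A k.+1|.
  apply: le_trans (_ : \prod_(k < r.+3) (`|euler x m S k.+1| * `|A k.+1|) <= _).
    rewrite -[X in _ ^+ X]card_ord -prodr_const; apply: ler_prod => k _.
    by rewrite low andbT divr_ge0 ?ler0n.
  rewrite big_split /= ler_piMl ?prodr_ge0 //.
  rewrite -normr_prod /euler exchange_big /= normr_prod.
  apply: prodr_ile1 => q _; rewrite normr_ge0.
  by apply: euler_factor; rewrite ?weight_ge0 ?weight_le1.
have m0 : m.+1%:R != 0 :> algC by rewrite pnatr_eq0.
have prod_up : \prod_(k < r.+3) `|A k.+1| <= K%:R / m.+1%:R.
  have first := first_power_bound mX.
  have last2 : `|A r.+2| <= (3 * C)%N%:R / m.+1%:R.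
    suff -> : A r.+2 = (sieved x m X [::] 1)^* by rewrite norm_conjC.
    rewrite /A !sievedE rmorph_sum; apply: eq_bigr => a _ /=.
    by rewrite x_conj rmorphM expr1 /= (geC0_conj (weight_ge0 _ _)).
  have last1 : `|A r.+3| <= 2 * m.+1%:R.
    apply: (@le_trans _ _ (1 + m.+1%:R)).
      apply: le_trans (weight_total m X); rewrite /A /sieved.
      apply: le_trans (ler_norm_sum _ _ _) _; apply: ler_sum => n _.
      rewrite normrM (ger0_norm (weight_ge0 _ _)) ler_piMl ?weight_ge0 //.
      by rewrite normrX exprn_ile1.
    by rewrite mulr_natl mulr2n lerD2r ler1n.
  have middle : \prod_(k < r) `|A k.+2| <= M%:R ^+ r.
    rewrite -[X in _ ^+ X]card_ord -prodr_const; apply: ler_prod => k _.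
    rewrite normr_ge0 power_bound //; have := ltn_ord k; lia.
  rewrite big_ord_recl !big_ord_recr /=.
  have -> : K%:R / m.+1%:R = (3 * C)%N%:R / m.+1%:R * (M%:R ^+ r * ((3 * C)%N%:R / m.+1%:R) * (2 * m.+1%:R)) :> algC.
    rewrite /K !natrM !natrX; move: m.+1%:R m0 => u u0; field; exact: u0.
  rewrite ler_pM ?mulr_ge0 ?prodr_ge0 // ler_pM ?mulr_ge0 ?prodr_ge0 // ler_pM ?prodr_ge0 //.
have := le_trans prod_low prod_up.
rewrite expr_div_n expr1n -natrX ler_pdivlMr ?ltr0n // mul1r ler_pdivrMl ?ltr0n ?expn_gt0 //.
by rewrite -natrM ler_nat mulnC -/m ltnn.
Qed.

End ComplexCharacter.

(** * Characters modulo 4 d *)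

(** In the quotient by H the image of a is not in the kernel of some irreducible
    character, and the quotient is abelian. *)
Lemma separating_character (gT : finGroupType) (G H : {group gT}) a :
  abelian G -> H \subset G -> a \in G -> a \notin H ->
  exists chi : 'CF(G), [/\ chi \is a linear_char, forall h, h \in H -> chi h = 1 & chi a != 1].
Proof.
move=> abG HG aG aH; have nHG : (H <| G)%g by rewrite -sub_abelian_normal.
have aN : a \in ('N(H))%g by rewrite (subsetP (normal_norm nHG)).
have [i ai] : exists i : Iirr (G / H)%g, coset H a \notin cfker 'chi_i.
  apply/existsP; rewrite -negb_forall; apply: contra aH => /forallP h.
  have : coset H a \in \bigcap_i cfker 'chi[G / H]_i by apply/bigcapP => i _; exact: h.
  by rewrite TI_cfker_irr => /set1P /coset_idr; apply.
have lin_i : 'chi_i \is a linear_char by apply/char_abelianP; exact: quotient_abelian.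
exists ('chi_i %% H)%CF; split.
- exact: cfMod_lin_char.
- move=> h hH; rewrite cfModE ?(subsetP HG) //.
  by rewrite coset_id // lin_char1.
rewrite cfModE //; apply: contra ai => /eqP e.
by rewrite cfkerEirr inE e lin_char1.
Qed.

Lemma sum_odd_terms (V : nmodType) (F : nat -> V) T :
  (forall a, ~~ odd a -> F a = 0) ->
  \sum_(a < T) F a.+1 = \sum_(k < uphalf T) F (2 * k + 1)%N.
Proof.
move=> Fev; elim: T => [|T IH]; first by rewrite !big_ord0.
rewrite big_ord_recr IH /= uphalf_half; have [oT|eT] := boolP (odd T).
  by rewrite Fev ?addr0 /= ?oT // add0n.
rewrite add0n big_ord_recr /=; congr (_ + F _).
by have := odd_double_half T; rewrite (negPf eT) add0n => <-; rewrite doubleK -mul2n addn1.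
Qed.

Definition dirichlet (M : nat) (f : {unit 'Z_M} -> algC) (a : nat) : algC :=
  if coprime a M then f (residue M a) else 0.

Section Residues.

Variable M : nat.
Hypothesis M_gt1 : (1 < M)%N.

Lemma residueE (a : nat) : coprime a M -> val (residue M a) = a%:R :> 'Z_M.
Proof. by move=> aM; rewrite val_residue // -pmulrn. Qed.

Lemma residueM (a b : nat) : coprime a M -> coprime b M ->
  residue M (a * b)%N = (residue M a * residue M b)%g.
Proof.
move=> aM bM; apply: val_inj; rewrite /= residueE ?coprimeMl ?aM //.
by rewrite natrM -!residueE.
Qed.

Lemma eq_residue (a b : nat) : coprime a M -> coprime b M ->
  (residue M a == residue M b) = (a == b %[mod M]).
Proof.
move=> aM bM; rewrite -val_eqE /= !residueE // -val_eqE /= !val_Zp_nat //.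
Qed.

Lemma residue1 : residue M 1%N = 1%g.
Proof. by apply: val_inj; rewrite /= residueE ?coprime1n. Qed.

Lemma residueX (a t : nat) : coprime a M -> residue M (a ^ t)%N = (residue M a ^+ t)%g.
Proof.
move=> aM; elim: t => [|t IH]; first exact: residue1.
by rewrite expnS residueM ?coprimeXl // IH expgS.
Qed.

Lemma residue_surj (u : {unit 'Z_M}) : exists2 a : nat, coprime a M & residue M a = u.
Proof.
have h : ((val u : nat)%:R : 'Z_M) = val u by rewrite natr_Zp.
have cu : coprime (val u : 'Z_M) M by rewrite coprime_sym -unitZpE // h; exact: valP u.
by exists (val u : nat) => //; apply: val_inj; rewrite residueE.
Qed.

Lemma residueN1 : residue M (- 1)%R = residue M M.-1.
Proof.
have cM : coprime M.-1 M by rewrite coprimePn // ltnW.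
apply: val_inj; rewrite residueE // val_residue //; last by rewrite coprimezE /= coprime1n.
have e : M.-1%:R + 1 = 0 :> 'Z_M by rewrite natr1 (prednK (ltnW M_gt1)) pchar_Zp.
by move/eqP: e; rewrite addr_eq0 => /eqP ->.
Qed.

End Residues.

Lemma harmonic_odd (R : numFieldType) (f : nat -> R) (C : nat) :
  (forall a, ~~ odd a -> f a = 0) ->
  (forall T, (0 < T)%N -> `|\sum_(k < T) f (2 * k + 1)%N / (2 * k + 1)%N%:R| <= C%:R / T%:R) ->
  forall T, (0 < T)%N -> `|\sum_(a < T) f a.+1 / a.+1%:R| <= (2 * C)%N%:R / T%:R.
Proof.
move=> fev fC T T0; rewrite (@sum_odd_terms _ (fun a => f a / a%:R)) => [|a /fev ->]; last by rewrite mul0r.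
have U0 : (0 < uphalf T)%N by case: (T) T0.
apply: le_trans (fC _ U0) _; rewrite natrM mulrAC [leRHS]mulrC ler_wpM2l ?ler0n //.
have -> : 2 / T%:R = (T%:R / 2)^-1 :> R by rewrite invf_div.
rewrite lef_pV2 ?posrE ?divr_gt0 ?ltr0n // ler_pdivrMr ?ltr0n // -natrM ler_nat.
by rewrite -{1}(odd_double_half T) uphalf_half -muln2 mulnDl leq_add2r leq_pmulr.
Qed.

Lemma coprime_4M a d : coprime a (4 * d) = odd a && coprime a d.
Proof. by rewrite coprimeMr -[4%N]/(2 ^ 2)%N coprime_pexpr // coprimen2. Qed.

Section Unbalanced.

Variables (d p n : nat).
Local Notation M := (4 * d)%N.
Hypotheses (d_gt0 : (0 < d)%N) (n_gt0 : (0 < n)%N) (p_M : coprime p M).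
Hypothesis balanced : forall j, odd j ->
  (\sum_(t < n * 2) ((p ^ t * j) %% M < 2 * d))%N = n.

Let M_gt1 : (1 < M)%N. Proof. by rewrite (leq_trans _ (leq_pmulr 4 d_gt0)). Qed.
Let M_gt0 : (0 < M)%N := ltnW M_gt1.

Let coprime_D2d a : coprime (a + 2 * d) M = coprime a M.
Proof.
rewrite !coprime_4M oddD oddM addbF; congr (_ && _).
by rewrite -coprime_modl addnC modnMDl coprime_modl.
Qed.

Let coprime_w : coprime (1 + 2 * d) M.
Proof. by rewrite coprime_D2d coprime1n. Qed.

Let coprime_c : coprime (2 * d).-1 M.
Proof.
have c2d : coprime (2 * d).-1 (2 * d) by rewrite coprimePn // muln_gt0.
rewrite coprime_4M -coprimen2; apply/andP; split; apply: coprime_dvdr c2d.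
  exact: dvdn_mulr.
exact: dvdn_mull.
Qed.

Let coprime_n1 : coprime M.-1 M. Proof. by rewrite coprimePn. Qed.

Let residue_w : residue M (1 + 2 * d)%N = (residue M (2 * d).-1 * residue M M.-1)%g.
Proof.
rewrite -residueM //; apply/eqP; rewrite eq_residue ?coprimeMl ?coprime_c //.
have e : ((2 * d).-1 * M.-1 = (2 * d - 2) * M + (1 + 2 * d))%N by move: d_gt0; case: (d) => // k _; nia.
by rewrite e modnMDl.
Qed.

Let residue_cc : (residue M (2 * d).-1 * residue M (2 * d).-1 = 1)%g.
Proof.
rewrite -residueM // -(residue1 M_gt1); apply/eqP; rewrite eq_residue ?coprimeMl ?coprime_c ?coprime1n //.
have e : ((2 * d).-1 * (2 * d).-1 = d.-1 * M + 1)%N by move: d_gt0; case: (d) => // k _; nia.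
by rewrite e modnMDl.
Qed.

(** Encoded by its functional equations: multiplication by 1 + 2 d is the
    translation by 2 d on the odd residues. *)
Definition odd_character (x : nat -> algC) : Prop :=
  [/\ x 1%N = 1, forall a b, x (a * b)%N = x a * x b, forall a, x (p * a)%N = x a,
      forall a, x (a + 2 * d)%N = - x a & forall a, (a <= M)%N -> x (M - a)%N = - x a].

(** The subgroup generated by p and 2 d - 1 does not contain -1: as 2 d - 1 is of
    order 2 and (2 d - 1) (-1) = 1 + 2 d, that would put -1 or 1 + 2 d among the
    powers of p.  A character that separates -1 from this subgroup is -1 at -1
    and 1 at 2 d - 1. *)
Lemma exists_odd_character :
  residue M (- 1)%R \notin <[residue M p]>%g ->
  residue M (1 + 2 * d)%N \notin <[residue M p]>%g ->
  exists (x : nat -> algC) (r : nat), odd_character x /\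
   [/\ (1 < r)%N, forall a, ~~ coprime a M -> x a = 0, forall a, coprime a M -> x a ^+ r = 1 &
      forall k, (0 < k < r)%N -> exists2 a, coprime a M & x a ^+ k != 1].
Proof.
rewrite residueN1 // => n1p wp.
pose pb := residue M p; pose c := residue M (2 * d).-1; pose n1 := residue M M.-1.
have n1H : n1 \notin (<[pb]> <*> <[c]>)%g.
  rewrite cent_joinEr; last first.
    by apply: subset_trans (subsetT _) _; apply: sub_abelian_cent (units_Zp_abelian M) (subsetT _).
  apply/mulsgP => -[_ _ /cycleP[i ->] /cycleP[j ->] e].
  have cj : (c ^+ j = 1 \/ c ^+ j = c)%g.
    rewrite -(odd_double_half j) expgD -mul2n expgM expgS expg1 residue_cc expg1n mulg1.
    by case: odd; [right|left]; rewrite ?expg1.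
  case: cj e => -> e.
    by case/negP: n1p; rewrite -/n1 e mulg1 mem_cycle.
  by case/negP: wp; rewrite residue_w -/n1 e -/c -/pb [(_ * c)%g](centsP (units_Zp_abelian M)) ?inE // mulgA residue_cc mul1g mem_cycle.
have [chi [lin_chi chiH chi_n1]] := @separating_character _ [set: {unit 'Z_M}]%G
  (<[pb]> <*> <[c]>)%G n1 (units_Zp_abelian M) (subsetT _) (in_setT _) n1H.
have chiM u v : chi (u * v)%g = chi u * chi v by rewrite lin_charM ?inE.
have chi1 : chi 1%g = 1 by rewrite lin_char1.
have chi_n1E : chi n1 = -1.
  have : (n1 * n1 = 1)%g.
    rewrite /n1 -residueM // -(residue1 M_gt1); apply/eqP; rewrite eq_residue ?coprimeMl ?coprime_n1 ?coprime1n //.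
    have e : (M.-1 * M.-1 = (M - 2) * M + 1)%N by move: M_gt1; case: (M) => // k; nia.
    by rewrite e modnMDl.
  move/(congr1 chi); rewrite chiM chi1 -expr2 => /eqP.
  by rewrite sqrf_eq1 (negPf chi_n1) => /eqP.
have chi_pb : chi pb = 1 by rewrite chiH // mem_gen // inE cycle_id.
have chi_c : chi c = 1 by rewrite chiH // mem_gen // inE cycle_id orbT.
pose x := dirichlet chi; exists x.
have xE a : coprime a M -> x a = chi (residue M a) by rewrite /x /dirichlet => ->.
have x0 a : ~~ coprime a M -> x a = 0 by rewrite /x /dirichlet => /negPf ->.
have xM a b : x (a * b)%N = x a * x b.
  have [aM|aM] := boolP (coprime a M); last by rewrite (x0 _ aM) mul0r x0 // coprimeMl (negPf aM).
  have [bM|bM] := boolP (coprime b M); last by rewrite (x0 _ bM) mulr0 x0 // coprimeMl (negPf bM) andbF.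
  by rewrite !xE ?coprimeMl ?aM // residueM // chiM.
have eq_x a b : a = b %[mod M] -> x a = x b.
  move=> ab; have cab : coprime a M = coprime b M by rewrite -coprime_modl ab coprime_modl.
  have [aM|aM] := boolP (coprime a M); last by rewrite !x0 // -cab.
  have bM : coprime b M by rewrite -cab.
  by rewrite !xE //; congr (chi _); apply/eqP; rewrite eq_residue // ab.
have xord : exists r, (0 < r)%N && [forall u, chi u ^+ r == 1].
  exists #|[set: {unit 'Z_M}]|; rewrite cardG_gt0; apply/forallP => u.
  by rewrite -lin_charX ?inE // expg_cardG ?inE // chi1.
pose r := ex_minn xord; exists r.
have [r0 /forallP r1] : (0 < r)%N /\ [forall u, chi u ^+ r == 1].
  by apply/andP; rewrite /r; case: ex_minnP.
have r_min k : (0 < k < r)%N -> exists u, chi u ^+ k != 1.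
  move=> /andP[k0]; rewrite /r; case: ex_minnP => r' _ r_min kr; apply/existsP.
  by rewrite -negb_forall; apply: contraL kr => h; rewrite -leqNgt r_min // k0.
split.
  split=> //.
  - by rewrite xE ?coprime1n // residue1.
  - by move=> a; rewrite xM xE // chi_pb mul1r.
  - move=> a; have [aM|aM] := boolP (coprime a M); last by rewrite !x0 ?oppr0 // coprime_D2d.
    have oa : odd a by move: aM; rewrite coprime_4M => /andP[].
    rewrite (@eq_x _ ((1 + 2 * d) * a)%N); last first.
      have -> : ((1 + 2 * d) * a = a./2 * M + (a + 2 * d))%N.
        by rewrite -{1 3}(odd_double_half a) oa; clear; nia.
      by rewrite modnMDl.
    by rewrite xM (xE (1 + 2 * d)%N) // residue_w chiM chi_c mul1r chi_n1E mulN1r.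
  move=> a aM; rewrite (@eq_x _ (M.-1 * a)%N); first by rewrite xM xE // chi_n1E mulN1r.
  apply/eqP; rewrite -(eqn_modDr a) subnK // -{2}[a]mul1n -mulnDl addn1 prednK //.
  by rewrite modnn modnMr.
split.
- rewrite ltn_neqAle eq_sym r0 andbT; apply: contraNneq chi_n1 => rE.
  by have := r1 n1; rewrite rE expr1.
- exact: x0.
- by move=> a aM; rewrite xE //; apply/eqP.
move=> k /r_min[u uk]; have [a aM ua] := residue_surj M_gt1 u.
by exists a; rewrite ?xE ?ua.
Qed.

Let even_coprime a : ~~ odd a -> ~~ coprime a M.
Proof. by move=> ea; rewrite coprime_4M (negPf ea). Qed.

(** An integer valued function with the symmetries of x, so that real analysis
    applies to it; x is a linear combination of such functions. *)
Definition fibre (x : nat -> algC) (v : algC) (a : nat) : int :=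
  (x a == v)%:R - (x a == - v)%:R.

Lemma fibre_bound x v : odd_character x ->
  exists C : nat, forall T, (0 < T)%N ->
    `|\sum_(k < T) (fibre x v (2 * k + 1)%N)%:~R / (2 * k + 1)%N%:R : rat| <= C%:R / T%:R.
Proof.
case=> _ _ xp x2d xN.
have fN a b : x a = - x b -> fibre x v a = - fibre x v b.
  by move=> e; rewrite /fibre e opprB eqr_opp eqr_oppLR.
apply: (harmonic_bound d_gt0 n_gt0 p_M) balanced => [a|a aM|a].
- exact: fN.
- by apply: fN; apply: xN.
- by rewrite /fibre xp.
Qed.

Lemma fibre_combination_bound x (s : seq algC) : odd_character x ->
  (forall v, v \in s -> `|v| <= 1) ->
  exists C : nat, forall T, (0 < T)%N ->
    `|\sum_(k < T) (\sum_(v <- s) v * (fibre x v (2 * k + 1)%N)%:~R) / (2 * k + 1)%N%:R|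
      <= C%:R / T%:R.
Proof.
move=> odd_x; elim: s => [|v s IH] s1.
  exists 0%N => T T0; rewrite big1 ?normr0 ?mul0r // => k _; by rewrite big_nil mul0r.
have [|C HC] := IH; first by move=> u us; apply: s1; rewrite inE us orbT.
have [D HD] := fibre_bound v odd_x; exists (D + C)%N => T T0.
have -> : \sum_(k < T) (\sum_(u <- v :: s) u * (fibre x u (2 * k + 1)%N)%:~R) / (2 * k + 1)%N%:R =
    v * ratr (\sum_(k < T) (fibre x v (2 * k + 1)%N)%:~R / (2 * k + 1)%N%:R) +
    \sum_(k < T) (\sum_(u <- s) u * (fibre x u (2 * k + 1)%N)%:~R) / (2 * k + 1)%N%:R.
  rewrite rmorph_sum mulr_sumr -big_split; apply: eq_bigr => k _ /=.
  by rewrite big_cons mulrDl fmorph_div /= ratr_int ratr_nat mulrA.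
rewrite natrD mulrDl (le_trans (ler_normD _ _)) // lerD ?HC // normrM.
rewrite -[leRHS]mul1r ler_pM ?s1 ?mem_head //.
have := HD T T0; rewrite -(ler_rat algC) ratr_norm fmorph_div /= !ratr_nat.
exact.
Qed.

Theorem powers_unbalanced :
  residue M (- 1)%R \in <[residue M p]>%g \/
  residue M (1 + 2 * d)%N \in <[residue M p]>%g.
Proof.
apply/orP; apply: contraT; rewrite negb_or => /andP[n1p wp].
have [x [r [odd_x [r1 x0 xr r_min]]]] := exists_odd_character n1p wp.
have [x1 xM xp x2d xN] := odd_x.
have r0 : (0 < r)%N := ltnW r1.
have x_per a : x (a + M)%N = x a.
  by rewrite (_ : a + M = a + 2 * d + 2 * d)%N ?x2d ?opprK //; clear; lia.
have [r2|r2] := eqVneq r 2%N.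
  (* a real character *)
  exfalso; rewrite {r_min r0 r1}r2 in xr.
  have x_val a : [\/ x a = 0, x a = 1 | x a = -1].
    have [aM|/x0 ->] := boolP (coprime a M); last by constructor 1.
    by have /eqP := xr a aM; rewrite sqrf_eq1 => /orP[] /eqP ->; [constructor 2|constructor 3].
  have N11 : (-1 == 1 :> algC) = false by apply/negbTE; rewrite eq_sym -subr_eq0 opprK (pnatr_eq0 algC 2).
  pose y := fibre x 1.
  have yE a : x a = (y a)%:~R.
    rewrite /y /fibre rmorphB /=.
    case: (x_val a) => ->; rewrite ?eqxx ?N11 1?[1 == -1]eq_sym ?N11.
    - by rewrite ![0 == _]eq_sym oppr_eq0 oner_eq0 subrr.
    - by rewrite subr0.
    - by rewrite sub0r.
  have [C HC] := fibre_bound 1 odd_x.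
  have y_even a : ~~ odd a -> y a = 0.
    by move/even_coprime/x0/eqP; rewrite yE intr_eq0 => /eqP.
  have y2d a : y (a + 2 * d)%N = - y a.
    by apply: (@intr_inj algC); rewrite rmorphN /= -!yE x2d.
  have harm := harmonic_odd (f := fun a => (y a)%:~R : rat)
    (fun a ea => congr1 intr (y_even a ea)) HC.
  apply: (@real_character_absurd y M (2 * C)) => //.
  - by apply: (@intr_inj algC); rewrite -yE x1.
  - by move=> a b; apply: (@intr_inj algC); rewrite rmorphM /= -!yE.
  - move=> a; case: (x_val a); rewrite yE => e; [constructor 1|constructor 2|constructor 3];
      apply: (@intr_inj algC); by rewrite e ?rmorphN.
  - by move=> a; apply: (@intr_inj algC); rewrite -!yE.
  have y_per a : y (a %% M)%N = y a.
    by apply: periodic_mod => b; apply: (@intr_inj algC); rewrite -!yE.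
  apply/eqP; have /eqP : (\sum_(a < M) y a) *+ 2 = 0.
    rewrite mulr2n -{1}(periodic_reindexD M_gt0 y_per (2 * d)) -big_split big1 //= => a _.
    by rewrite y2d addNr.
  by rewrite mulrn_eq0.
(* a character with values outside of the real line *)
case: r r0 r1 r2 xr r_min => [|[|[|r]]] // _ _ _ xr r_min.
exfalso; pose s := unity_roots r.+3.
have s1 v : v \in s -> `|v| <= 1.
  by rewrite mem_unity_roots // => /eqP vr; rewrite (norm_unity_root _ vr).
have [C HC] := fibre_combination_bound odd_x s1.
(* fibres at v and - v recover the character twice *)
have sum_fibre a : \sum_(v <- s) v * (fibre x v a)%:~R = 2 * x a.
  have s0 v : v \in s -> v != 0.
    by rewrite mem_unity_roots //; apply: contraTneq => ->; rewrite exprS mul0r eq_sym oner_eq0.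
  have [aM|/x0 xa] := boolP (coprime a M); last first.
    rewrite big_seq big1 ?xa ?mulr0 // => v /s0 v0.
    by rewrite /fibre xa ![0 == _]eq_sym oppr_eq0 (negPf v0) mulr0.
  have pick y : y ^+ r.+3 = 1 -> \sum_(v <- s) v * (y == v)%:R = y.
    move=> yr; have ys : y \in s by rewrite mem_unity_roots // yr.
    rewrite (bigD1_seq y) ?uniq_unity_roots //= eqxx mulr1 big1 ?addr0 // => v vy.
    by rewrite eq_sym (negPf vy) mulr0.
  have xa2d : (- x a) ^+ r.+3 = 1 by rewrite -x2d xr ?coprime_D2d.
  transitivity (\sum_(v <- s) v * (x a == v)%:R - \sum_(v <- s) v * (- x a == v)%:R).
    rewrite -sumrB; apply: eq_bigr => v _.
    by rewrite /fibre rmorphB /= mulrBr !rmorph_nat eqr_oppLR.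
  by rewrite !pick ?xr // opprK mulr_natl mulr2n.
have harm T : (0 < T)%N -> `|\sum_(k < T) x (2 * k + 1)%N / (2 * k + 1)%N%:R| <= C%:R / T%:R.
  move=> T0; apply: le_trans (HC T T0).
  under [in leRHS]eq_bigr do rewrite sum_fibre -mulrA.
  by rewrite -mulr_sumr normrM normr_nat ler_peMl ?normr_ge0 // ler1n.
apply: (@complex_character_absurd x M (2 * C) r) => //.
- move=> a; have [aM|aM] := boolP (coprime a M); [left; exact: xr|right; exact: x0].
- by apply: harmonic_odd => // a /even_coprime/x0.
Qed.

End Unbalanced.

(** * Maximality and the powers of p modulo 4 d *)

(** The norm of a generator G of E* is a root of unity of order Q - 1 in E, hence
    the image of an element of F. *)
Lemma norm_compatible_generators (F : finFieldType) : odd #|F| ->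
  exists (E : finFieldType) (iota : {rmorphism F -> E}) (g : F) (G : E),
  [/\ (#|E|.-1).-primitive_root G, #|E| = (#|F| ^ 2)%N & iota g = G ^+ #|F|.+1].
Proof.
move=> /quadratic_extension[E [iota card_E]].
have [G prim_G] := finField_prim_root E; have [g0 prim_g0] := finField_prim_root F.
have prim_z : (#|F|.-1).-primitive_root (iota g0) by rewrite fmorph_primitive_root.
have M_eq : (#|F|.+1 * #|F|.-1 = #|E|.-1)%N.
  by rewrite card_E; case: #|F| => // k; rewrite /=; lia.
have [i gi] : {i : 'I_(#|F|.-1) | G ^+ #|F|.+1 = iota g0 ^+ i}.
  by apply: (prim_rootP prim_z); rewrite -exprM M_eq prim_expr_order.
by exists E, iota, (g0 ^+ i), G; rewrite rmorphXn.
Qed.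

Section Congruences.

Variables (d p : nat).
Local Notation M := (4 * d)%N.
Hypotheses (d_ge3 : (3 <= d)%N) (odd_d : odd d).
Hypotheses (pr_p : prime p) (p_mod4 : p = 3 %[mod 4]) (p_d : ~~ (p %| d)%N).

Let d0 : (0 < d)%N. Proof. exact: leq_trans d_ge3. Qed.
Let d1 : (1 < d)%N. Proof. exact: leq_trans d_ge3. Qed.
Let M_gt1 : (1 < M)%N. Proof. by rewrite (leq_trans _ (leq_pmulr 4 d0)). Qed.
Let odd_p : odd p.
Proof. by rewrite -(odd_mod p (erefl : odd 4 = false)) p_mod4. Qed.
Let p_M : coprime p M.
Proof. by rewrite coprime_4M odd_p prime_coprime. Qed.
Local Notation pb := (residue M p).

(** The two classes that exchange the halves of the circle of odd residues modulo
    4 d, preserving or reversing the orientation. *)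
Definition half_turn (q : nat) : Prop := (M %| q + 1)%N \/ q = 1 + 2 * d %[mod M].

Let pow_mod4 t : (p ^ t = 3 %[mod 4]) <-> odd t.
Proof.
have -> : ((p ^ t) %% 4 = if odd t then 3 else 1)%N.
  elim: t => [|t IH] //; rewrite expnS -modnMm IH p_mod4 /=; by case: odd.
by case: odd.
Qed.

Lemma half_turn_mod4 q : half_turn q -> q = 3 %[mod 4].
Proof.
have d4 : (4 %| M)%N by exact: dvdn_mulr.
case=> [/(dvdn_trans d4)|e]; first by move=> /dvdnP[k]; clear; lia.
rewrite -(modn_dvdm q d4) e modn_dvdm //.
by move: (odd_double_half d); rewrite odd_d; clear; lia.
Qed.

Lemma half_turn_sqr q : half_turn q -> q ^ 2 = 1 %[mod M].
Proof.
case=> [/dvdnP[k qk]|e].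
  have [q0|q0] := posnP q; first by move: qk; rewrite q0 add0n; case: (k) => // k'; nia.
  apply/eqP; rewrite eqn_mod_dvd ?expn_gt0 ?q0 //.
  by rewrite -[X in (_ - X)%N](exp1n 2) subn_sqr qk dvdn_mull // dvdn_mull.
rewrite -modnXm e modnXm (_ : (1 + 2 * d) ^ 2 = (1 + d) * M + 1)%N ?modnMDl //.
by clear; nia.
Qed.

Lemma residue_power t : (pb ^+ t)%g = residue M (p ^ t)%N.
Proof. by rewrite residueX. Qed.

Lemma half_turnP t : half_turn (p ^ t) <->
  (pb ^+ t)%g = residue M (- 1)%R \/ (pb ^+ t)%g = residue M (1 + 2 * d)%N.
Proof.
have pM : coprime (p ^ t) M by rewrite coprimeXl.
have cN : coprime M.-1 M by rewrite coprimePn // ltnW.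
have cw : coprime (1 + 2 * d) M.
  rewrite coprime_4M oddD oddM /=.
  by rewrite -coprime_modl addnC modnMDl coprime_modl coprime1n.
rewrite residueN1 // residue_power /half_turn.
have -> : (M %| p ^ t + 1)%N = (p ^ t == M.-1 %[mod M]).
  by rewrite -(eqn_modDr 1) addn1 [(M.-1 + 1)%N]addn1 prednK ?modnn // ltnW.
rewrite -eq_residue //; split=> -[h|h]; [left|right|left|right].
- exact/eqP.
- by apply/eqP; rewrite eq_residue //; apply/eqP.
- exact/eqP.
- by apply/eqP; rewrite -eq_residue //; apply/eqP.
Qed.

Lemma half_turn_mem :
  (residue M (- 1)%R \in <[pb]>%g \/ residue M (1 + 2 * d)%N \in <[pb]>%g) <->
  exists t, half_turn (p ^ t).
Proof.
split=> [[/cycleP[t e]|/cycleP[t e]]|[t /half_turnP[<-|<-]]].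
- by exists t; apply/half_turnP; left.
- by exists t; apply/half_turnP; right.
- by left; exact: mem_cycle.
- by right; exact: mem_cycle.
Qed.

Lemma power1P t : (pb ^+ t == 1)%g = (p ^ t == 1 %[mod M]).
Proof. by rewrite residue_power -(residue1 M_gt1) eq_residue ?coprimeXl ?coprime1n. Qed.

(** Half turns are 3 modulo 4, hence odd powers of p, and have square 1; so the
    order of p divides twice an odd number but not that number. *)
Lemma half_turn_order t : half_turn (p ^ t) ->
  exists k, [/\ #[pb]%g = (2 * k)%N, odd k &
    forall n, half_turn (p ^ n) <-> exists m, (1 <= m)%N /\ odd m /\ n = (k * m)%N].
Proof.
move=> ht; have odd_half n : half_turn (p ^ n) -> odd n.
  by move=> /half_turn_mod4 /pow_mod4.
have not1 n : half_turn (p ^ n) -> (pb ^+ n)%g != 1%g.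
  move=> hn; rewrite power1P; apply/eqP => e; have := half_turn_mod4 hn.
  have d4 : (4 %| M)%N by exact: dvdn_mulr.
  by rewrite -(modn_dvdm _ d4) e modn_dvdm.
have sqr1 n : half_turn (p ^ n) -> (#[pb]%g %| n * 2)%N.
  by move=> hn; rewrite order_dvdn power1P expnM; apply/eqP/half_turn_sqr.
have even_o : ~~ odd #[pb]%g.
  apply/negP => oo; have := sqr1 t ht; rewrite Gauss_dvdl ?coprimen2 //.
  by rewrite order_dvdn; apply/negP/not1.
pose k := #[pb]%g./2; have oE : #[pb]%g = (2 * k)%N.
  by rewrite mul2n -[LHS](odd_double_half #[pb]%g) (negPf even_o).
have k_dvd n : half_turn (p ^ n) -> (k %| n)%N.
  by move/sqr1; rewrite oE mulnC dvdn_pmul2r.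
have odd_k : odd k.
  by have /dvdnP[m tk] := k_dvd t ht; have := odd_half t ht; rewrite tk oddM => /andP[].
have pow_k m : odd m -> (pb ^+ (k * m) = pb ^+ k)%g.
  move=> om; rewrite -(odd_double_half m) om mulnDr muln1 expgD -mul2n mulnCA mulnA -oE.
  by rewrite expgM expg_order expg1n mulg1.
exists k; split=> // n; split=> [hn|[m [_ [om ->]]]].
  have /dvdnP[m nk] := k_dvd n hn; exists m.
  have om : odd m by have := odd_half n hn; rewrite nk oddM => /andP[].
  by rewrite nk mulnC; split; [case: (m) om|].
apply/half_turnP; rewrite pow_k //.
have /dvdnP[l tk] := k_dvd t ht.
have ol : odd l by have := odd_half t ht; rewrite tk oddM => /andP[].
by have /half_turnP := ht; rewrite tk [(l * k)%N]mulnC pow_k.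
Qed.

Section Field.

Variables (n : nat) (F : finFieldType).
Hypotheses (n_gt0 : (0 < n)%N) (card_F : #|F| = ((p ^ n) ^ 2)%N).

Let odd_F : odd #|F|. Proof. by rewrite card_F !oddX odd_p orbT. Qed.

Let div_card : (p ^ n) ^ 2 = 1 %[mod M] -> (M %| #|F|.-1)%N.
Proof.
move=> e; rewrite card_F -subn1 -eqn_mod_dvd; first exact/eqP.
by rewrite !expn_gt0 prime_gt0.
Qed.

Lemma half_turn_maximal : half_turn (p ^ n) -> maximalH d (p ^ n) F.
Proof.
move=> hn; have [E [iota [g [G [prim_G card_E iota_g]]]]] := norm_compatible_generators odd_F.
apply: (maximal_sufficient prim_G card_E iota_g pr_p p_mod4 card_F odd_d d1 p_d).
- by case: hn; [left|right].
- by apply: div_card; exact: half_turn_sqr.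
- exact: half_turn_mod4.
Qed.

(** Both the number of the p^t j in the lower half and its complement, which is
    the corresponding number for - j, are at most n. *)
Lemma maximal_powers : maximalH d (p ^ n) F ->
  [/\ (#[pb]%g %| n * 2)%N, odd n & exists t, half_turn (p ^ t)].
Proof.
move=> max; have [E [iota [g [G [prim_G card_E iota_g]]]]] := norm_compatible_generators odd_F.
have [M_N q3 JsumE] := maximal_necessary prim_G card_E iota_g pr_p p_mod4 card_F odd_d d1 p_d max.
split.
  rewrite order_dvdn power1P expnM eqn_mod_dvd ?expn_gt0 ?prime_gt0 //.
  by rewrite subn1 -card_F.
  exact/pow_mod4.
apply/half_turn_mem; have [e N_eq] := dvdnP M_N.
have card_F' : #|F| = (p ^ (n * 2))%N by rewrite card_F expnM.
have prim_gF := prim_g prim_G card_E iota_g.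
rewrite mulnC in N_eq.
have lower := count_lower_half prim_gF pr_p odd_p n_gt0 card_F' N_eq JsumE.
apply: (powers_unbalanced d0 n_gt0 p_M) => j odd_j; apply/eqP; rewrite eqn_leq lower //=.
have odd_j' : odd (M.-1 * j).
  by rewrite oddM odd_j andbT -[odd _]negbK -oddS prednK ?oddM // ltnW.
have := lower _ odd_j'.
rewrite [X in (X <= _)%N -> _](eq_bigr (fun t : 'I_(n * 2) => 1 - ((p ^ t * j) %% M < 2 * d))%N) => [|t _].
  rewrite sumnB => [|t _]; last by case: (_ < _)%N.
  by rewrite sum1_card card_ord leq_subLR muln2 -addnn leq_add2r.
have odd_a : odd ((p ^ t * j) %% M).
  by rewrite odd_mod ?oddM // oddX odd_p orbT odd_j.
have a_M : ((p ^ t * j) %% M < M)%N by rewrite ltn_mod ltnW.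
have -> : ((p ^ t * (M.-1 * j)) %% M = M - (p ^ t * j) %% M)%N.
  rewrite mulnCA -modnMmr; move: (_ %% M)%N odd_a a_M => a odd_a a_M.
  have a0 : (0 < a)%N by case: (a) odd_a.
  have aux m b : (b < m)%N -> (0 < b)%N -> (m.-1 * b = b.-1 * m + (m - b))%N.
    by case: m b => // m [|b] // bm _; rewrite /= subSS !mulnS [(b * m)%N]mulnC; clear -bm; lia.
  by rewrite aux // modnMDl modn_small // ltn_subrL a0 ltnW.
move: (_ %% M)%N odd_a a_M => a odd_a a_M.
have a2d : a != (2 * d)%N by apply: contraTneq odd_a => ->; rewrite oddM.
by case: ltnP => h; case: ltnP => h'; rewrite //=; clear -h h' a2d a_M; lia.
Qed.

End Field.

End Congruences.

Local Close Scope ring_scope.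

Theorem proposition4p1p1 (d p : nat)
    (hd : (3 <= d)%N) (hdodd : odd d)
    (hp : prime p) (hp4 : p = 3 %[mod 4]) (hpd : ~~ (p %| d)%N) :
  let pbar : {unit 'Z_(4 * d)} := residue (4 * d) p in
  let some_maximal : Prop :=
    exists (n : nat) (F : finFieldType), (0 < n)%N /\ maximalH d (p ^ n) F in
  (some_maximal <->
     residue (4 * d) (- 1)%R \in <[pbar]>%g \/
     residue (4 * d) (1 + 2 * d)%N \in <[pbar]>%g)
  /\
  (some_maximal ->
     exists k : nat,
       #[pbar]%g = (2 * k)%N /\
       odd k /\
       forall (n : nat) (F : finFieldType),
         (0 < n)%N -> #|F| = ((p ^ n) ^ 2)%N ->
         (maximalH d (p ^ n) F <->
            exists m : nat, (1 <= m)%N /\ odd m /\ n = (k * m)%N) /\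
         (maximalH d (p ^ n) F <->
            ((p ^ n)%N%:Z = - 1 %[mod (4 * d)%N%:Z])%Z \/
            ((p ^ n)%N%:Z = (1 + 2 * d)%N%:Z %[mod (4 * d)%N%:Z])%Z)).
Proof.
move=> pbar some_maximal.
have half_of_maximal : some_maximal -> exists t, half_turn d (p ^ t).
  case=> n [F [n0 max]].
  by have [] := maximal_powers hd hdodd hp hp4 hpd n0 (proj1 max) max.
split.
  split=> h; first by apply/(half_turn_mem hd hp hp4 hpd); exact: half_of_maximal.
  have [t ht] := (half_turn_mem hd hp hp4 hpd).1 h.
  have t0 : (0 < t)%N.
    by have := half_turn_mod4 hdodd ht; case: (t).
  have t20 : (0 < t * 2)%N by rewrite muln_gt0 t0.
  have [F _ card_F] := pPrimePowerField hp t20.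
  exists t, F; split=> //; apply: (half_turn_maximal hd hdodd hp hp4 hpd) => //.
  by rewrite card_F expnM.
move=> /half_of_maximal[t ht].
have [k [oE odd_k turns]] := half_turn_order hd hdodd hp hp4 hpd ht.
exists k; split=> //; split=> // n F n0 card_F.
have max_turn : maximalH d (p ^ n) F <-> half_turn d (p ^ n).
  split=> [max|]; last exact: (half_turn_maximal hd hdodd hp hp4 hpd).
  have [ord_n odd_n _] := maximal_powers hd hdodd hp hp4 hpd n0 card_F max.
  apply/turns; move: ord_n; rewrite oE mulnC dvdn_pmul2r // => /dvdnP[m nm].
  have om : odd m by move: odd_n; rewrite nm oddM => /andP[].
  by exists m; rewrite nm mulnC; split=> //; case: (m) om.
split; first exact: iff_trans max_turn (turns n).
apply: iff_trans max_turn _; rewrite /half_turn.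
have -> : (4 * d %| p ^ n + 1)%N = ((p ^ n)%N%:Z == - 1 %[mod (4 * d)%N%:Z])%Z.
  by rewrite eqz_mod_dvd opprK.
have e2 : (p ^ n == 1 + 2 * d %[mod 4 * d])%N = ((p ^ n)%N%:Z == (1 + 2 * d)%N%:Z %[mod (4 * d)%N%:Z])%Z.
  by rewrite !modz_nat eqz_nat.
split=> -[h|h]; [left; exact/eqP|right|left; exact/eqP|right].
  by apply/eqP; rewrite -e2; apply/eqP.
by apply/eqP; rewrite e2; apply/eqP.
Qed.
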